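(* Let $\Omega\subseteq\mathbb R^n$ be open, where $n\in\mathbb N$. A function $u\in W^{1,\infty}(\Omega)$ is $\infty$-Harmonic, namely a viscosity solution to $$\Delta_\infty u:=Du\otimes Du:D^2u=0\quad\text{in }\Omega,$$ if and only if $$\operatorname*{ess\,sup}_{\{|Du|\ge\|Du\|_{L^\infty(\{\phi\ne0\})}-\varepsilon\}\cap\{\phi\ne0\}}\big[Du\cdot D\phi\big]\ge0$$ for any $\phi\in W^{1,\infty}_0(\Omega)\setminus\{0\}$ and all $\varepsilon>0$.
   Context: $W^{1,\infty}_0(\Omega)$ is the closure of $C^\infty_c(\Omega)$ in $W^{1,\infty}(\Omega)$ in the weak* topology, meaning: $\phi\in W^{1,\infty}_0(\Omega)$ iff there are $\phi_j\in C^\infty_c(\Omega)$ with $\phi_j\to\phi$ in $L^\infty(\Omega)$ and $D\phi_j\rightharpoonup D\phi$ weakly* in $L^\infty(\Omega;\mathbb R^n)$. Such $\phi$ are continuous, so $\{\phi\ne0\}$ is open. $\Omega$ is not assumed bounded. Essential suprema are with respect to Lebesgue measure. *)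

(* Defs.v *)
From HB Require Import structures.
From mathcomp Require Import all_boot all_order all_algebra.
From mathcomp Require Import all_classical all_reals all_analysis.
From mathcomp Require Import measurable_realfun ess_sup_inf.

Set Implicit Arguments.
Unset Strict Implicit.
Unset Printing Implicit Defensive.

Import Order.TTheory GRing.Theory Num.Theory.
Import numFieldNormedType.Exports.

Local Open Scope classical_set_scope.
Local Open Scope ring_scope.

Definition rV_display : measure_display. Proof. exact: default_measure_display. Qed.

Section measurable_rV.
Context {R : realType} {n : nat}.

Let coord (i : 'I_n) (x : 'rV[R]_n) : R := x 0 i.

Let rV_measurable0 : g_sigma_preimage coord set0.
Proof. exact: sigma_algebra0. Qed.

Let rV_measurableC A : g_sigma_preimage coord A -> g_sigma_preimage coord (~` A).
Proof. exact: sigma_algebraC. Qed.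

Let rV_measurable_bigcup (F : (set 'rV[R]_n)^nat) :
  (forall i, g_sigma_preimage coord (F i)) ->
  g_sigma_preimage coord (\bigcup_i F i).
Proof. exact: sigma_algebra_bigcup. Qed.

(* The product of the Borel sigma-algebras of the factors, that is, the Borel
   sigma-algebra of R^n (see [open_measurable_rV]). *)
HB.instance Definition _ := @isMeasurable.Build rV_display 'rV[R]_n
  (g_sigma_preimage coord) rV_measurable0 rV_measurableC rV_measurable_bigcup.

Lemma measurable_coord (i : 'I_n) :
  measurable_fun [set: 'rV[R]_n] (fun x : 'rV[R]_n => x 0 i).
Proof.
move=> _ Y mY; rewrite setTI; apply: sub_sigma_algebra => /=.
rewrite -bigcup_seq/=; exists i => /=; first by rewrite mem_index_enum.
by exists Y => //; rewrite setTI.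
Qed.

Lemma measurable_fun_coordP d (T : measurableType d) (f : T -> 'rV[R]_n) :
  (forall i, measurable_fun [set: T] (fun t => f t 0 i)) ->
  measurable_fun [set: T] f.
Proof.
move=> mf _ A; rewrite setTI => mA.
have : preimage_set_system [set: T] f (g_sigma_preimage coord) (f @^-1` A).
  by exists A => //; rewrite setTI.
rewrite -g_sigma_preimage_comp; apply: smallest_sub.
  exact: sigma_algebra_measurable.
move=> B; rewrite -bigcup_seq => -[i _ [C mC <-]].
exact: mf.
Qed.

End measurable_rV.

Lemma open_measurable_rV (R : realType) (n : nat) (A : set 'rV[R]_n) :
  open A -> measurable A.
Proof.
move=> oA.
pose box (p : 'rV[rat]_n * nat) := [set x : 'rV[R]_n |
  forall i, `|x 0 i - ratr (p.1 0 i)| < p.2.+1%:R^-1].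
have mbox p : measurable (box p).
  have -> : box p = \bigcap_(i in [set: 'I_n])
      (fun x : 'rV[R]_n => x 0 i) @^-1` ball (ratr (p.1 0 i) : R) p.2.+1%:R^-1.
    by apply/seteqP; split=> x /= h i; [move=> _|]; have := h i;
       rewrite /ball/= distrC; [|apply].
  apply: fin_bigcap_measurable => // i _.
  by rewrite -[X in measurable X]setTI; apply: measurable_coord => //;
     apply: open_measurable; exact: ball_open.
have -> : A = \bigcup_(p in [set p | box p `<=` A]) box p.
  apply/seteqP; split=> [x Ax|x [p /= sp bp]]; last exact: sp.
  have /nbhs_ballP[e /= e0 xeA] : nbhs x A by exact: open_nbhs_nbhs.
  have [k ke] : exists k : nat, k.+1%:R^-1 < e / 2.
    have e20 : 0 < e / 2 by rewrite divr_gt0.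
    exists (Num.truncn (e / 2)^-1).
    by rewrite invf_plt ?posrE// truncnS_gt.
  have [q hq] : exists q : 'rV[rat]_n,
      forall i, `|x 0 i - ratr (q 0 i)| < k.+1%:R^-1.
    have h i : exists q : rat, `|x 0 i - ratr q| < k.+1%:R^-1.
      have [|q] := @rat_in_itvoo R (x 0 i) (x 0 i + k.+1%:R^-1).
        by rewrite ltrDl invr_gt0.
      rewrite in_itv/= => /andP[q1 q2]; exists q.
      by rewrite distrC gtr0_norm ?subr_gt0// ltrBlDl.
    exists (\row_i projT1 (cid (h i))) => i; rewrite mxE.
    exact: (projT2 (cid (h i))).
  exists (q, k) => //= y /= yq; apply: xeA.
  split=> // i j; rewrite !ord1 /ball/=.
  rewrite -(subrKA (ratr (q 0 j))) (splitr e).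
  rewrite (le_lt_trans (ler_normD _ _))// ltrD//.
    exact: lt_trans (hq j) ke.
  by rewrite distrC; exact: lt_trans (yq j) ke.
have -> : \bigcup_(p in [set p | box p `<=` A]) box p =
    \bigcup_(k : nat) (if unpickle k is Some p then
      if pselect (box p `<=` A) then box p else set0 else set0).
  apply/seteqP; split=> [x [p /= sp bp]|x [k _]].
    by exists (pickle p) => //; rewrite pickleK; case: pselect.
  case: unpickle => [p|[]]; case: pselect => [sp bp|? []]; by exists p.
apply: bigcup_measurable => k _.
case: unpickle => [p|]; last exact: measurable0.
by case: pselect => ?; [exact: mbox|exact: measurable0].
Qed.

Section lebesgue_rV.
Context {R : realType}.

Definition cons_rV n (p : measurableTypeR R * 'rV[R]_n) : 'rV[R]_n.+1 :=
  \row_i oapp (p.2 0) p.1 (unlift ord0 i).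

Lemma measurable_cons_rV n : measurable_fun setT (@cons_rV n).
Proof.
apply: measurable_fun_coordP => i; under eq_fun do rewrite mxE.
case: unliftP => [j _|_] /=; last exact: measurable_fst.
exact: (measurableT_comp (measurable_coord j) measurable_snd).
Qed.

HB.instance Definition _ n :=
  isMeasurableFun.Build _ _ _ _ (@cons_rV n) (@measurable_cons_rV n).

Section step.
Variables (n : nat) (m : {sigma_finite_measure set 'rV[R]_n -> \bar R}).

Definition lebesgue_step : set 'rV[R]_n.+1 -> \bar R :=
  pushforward (@lebesgue_measure R \x m)%E (@cons_rV n).

Let step0 : lebesgue_step set0 = 0%E.
Proof. exact: measure0. Qed.

Let step_ge0 A : (0 <= lebesgue_step A)%E.
Proof. exact: measure_ge0. Qed.

Let step_sigma_additive : semi_sigma_additive lebesgue_step.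
Proof. exact: measure_semi_sigma_additive. Qed.

HB.instance Definition _ := isMeasure.Build _ _ _ lebesgue_step
  step0 step_ge0 step_sigma_additive.

Let step_sigma_finite : sigma_finite setT lebesgue_step.
Proof.
have [F UF mF] : sigma_finite setT (@lebesgue_measure R \x m)%E.
  have /sigma_finiteP[F [TF ndF Foo]] := sigma_finiteT (@lebesgue_measure R).
  have /sigma_finiteP[G [TG ndG Goo]] := sigma_finiteT m.
  exists (fun k => F k `*` G k).
    rewrite -setXTT TF TG predeqE => -[x y]; split.
      move=> [/= [k _ Fkx] [l _ Gly]]; exists (maxn k l) => //; split.
      - by move: x Fkx; exact/subsetPset/ndF/leq_maxl.
      - by move: y Gly; exact/subsetPset/ndG/leq_maxr.
    by move=> [k _ []/= ? ?]; split; exists k.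
  move=> k; have [? ?] := Foo k; have [? ?] := Goo k.
  split; first exact: measurableX.
  by rewrite product_measure1E// lte_mul_pinfty// ge0_fin_numE.
pose g (x : 'rV[R]_n.+1) : measurableTypeR R * 'rV[R]_n :=
    (x 0 ord0, \row_j x 0 (lift ord0 j)).
have consK : cancel (@cons_rV n) g.
  move=> [a v]; rewrite /g mxE unlift_none/=; congr pair.
  by apply/rowP => j; rewrite !mxE liftK.
have mg : measurable_fun setT g.
  apply: measurable_fun_pair; first exact: measurable_coord.
  apply: measurable_fun_coordP => j; under eq_fun do rewrite mxE.
  exact: measurable_coord.
exists (fun k => g @^-1` F k); first by rewrite -preimage_bigcup -UF preimage_setT.
move=> k; split.
  by rewrite -[X in measurable X]setTI; apply: mg => //; exact: (mF k).1.
rewrite /lebesgue_step /pushforward -comp_preimage.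
rewrite (_ : g \o _ = id); first exact: (mF k).2.
by apply/funext => p; exact: consK.
Qed.

HB.instance Definition _ :=
  Measure_isSigmaFinite.Build _ _ _ lebesgue_step step_sigma_finite.

End step.

(* The n-fold product of the Lebesgue measure of the line; for n = 0 it is the
   unit mass on the only point of R^0. *)
Fixpoint lebesgue_rV n : {sigma_finite_measure set 'rV[R]_n -> \bar R} :=
  match n with
  | 0 => \d_(0 : 'rV[R]_0)
  | n.+1 => lebesgue_step (lebesgue_rV n)
  end.

End lebesgue_rV.
Arguments lebesgue_rV {R} n.

Lemma lebesgue_rV_box (R : realType) n (A : 'I_n -> set (measurableTypeR R)) :
  (forall i, measurable (A i)) ->
  lebesgue_rV n [set x : 'rV[R]_n | forall i, A i (x 0 i)] =
  (\prod_(i < n) lebesgue_measure (A i))%E.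
Proof.
elim: n A => [|n IHn] A mA.
  rewrite big_ord0 /= diracE mem_set// => -[].
  by [].
rewrite big_ord_recl -IHn//= /lebesgue_step /pushforward.
set B := [set x : 'rV[R]_n | _].
have mB : measurable B.
  have -> : B = \bigcap_(i in [set: 'I_n]) (fun x : 'rV[R]_n => x 0 i) @^-1` A (lift ord0 i).
    by apply/seteqP; split=> x h i; [move=> _; exact: h|exact: h].
  apply: fin_bigcap_measurable => // i _.
  by rewrite -[X in measurable X]setTI; apply: measurable_coord => //; exact: mA.
rewrite -product_measure1E//; congr (_ _).
apply/seteqP; split=> [[a v] /= h|[a v] [/= Aa Bv] i].
  split=> [|i]; [have := h ord0|have := h (lift ord0 i)].
    by rewrite mxE unlift_none.
  by rewrite mxE liftK.
by rewrite mxE; case: unliftP => [j|] ->; [exact: Bv|].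
Qed.

Section calculus.
Context {R : realType} {n : nat}.
Local Notation V := 'rV[R]_n.
Implicit Types (A Omega : set V) (f : V -> R).

Definition dotp (x y : V) : R := \sum_i x 0 i * y 0 i.

(* The norm that the library puts on 'rV[R]_n is the sup norm. *)
Definition enorm (x : V) : R := Num.sqrt (dotp x x).

Definition partial (i : 'I_n) f (x : V) : R := 'D_(delta_mx 0 i) f x.

Definition grad f (x : V) : V := \row_i partial i f x.

(* [f] is C^k on the open set [A]: it is continuous, or it is differentiable
   and its first partial derivatives are C^(k-1). *)
Fixpoint Ck (k : nat) A f : Prop :=
  match k with
  | 0 => forall x, A x -> {for x, continuous f}
  | k.+1 => (forall x, A x -> differentiable f x) /\
            forall i, Ck k A (partial i f)
  end.

Definition test_function Omega f : Prop :=
  let supp := closure [set x | f x != 0] in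
  [/\ forall k, Ck k setT f, compact supp & supp `<=` Omega].

(* The contraction Df (x) Df : D^2 f. *)
Definition infty_laplacian f (x : V) : R :=
  \sum_i \sum_j partial i f x * partial j f x * partial i (partial j f) x.

Definition viscosity_solution Omega (u : V -> R) : Prop :=
  [/\ forall x, Omega x -> {for x, continuous u},
      forall psi, Ck 2 Omega psi -> forall x, Omega x ->
        (\forall y \near x, u y - psi y <= u x - psi x) ->
        0 <= infty_laplacian psi x
    & forall psi, Ck 2 Omega psi -> forall x, Omega x ->
        (\forall y \near x, u x - psi x <= u y - psi y) ->
        infty_laplacian psi x <= 0].

End calculus.

Section sobolev.
Context {R : realType} {n : nat}.
Local Notation V := 'rV[R]_n.
Local Notation mu := (@lebesgue_rV R n).
Implicit Types (D Omega : set V) (u phi : V -> R) (Du Dphi : V -> V).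

(* Its value is -oo when [D] is a null set. *)
Definition ess_sup_on D (f : V -> \bar R) : \bar R :=
  ess_sup mu (patch (cst -oo%E) D f).

Definition Linfty_norm D (f : V -> R) : \bar R :=
  ('N[mu]_+oo[EFin \o (f \_ D)])%E.

Definition Linfty Omega (f : V -> R) : Prop :=
  measurable_fun Omega f /\ (Linfty_norm Omega f < +oo)%E.

Definition weak_gradient Omega u Du : Prop :=
  forall zeta, test_function Omega zeta -> forall i,
    \int[mu]_(x in Omega) (u x * partial i zeta x) =
    - \int[mu]_(x in Omega) (Du x 0 i * zeta x).

(* [u] belongs to W^{1,oo}(Omega) and [Du] represents its weak gradient; both
   are representatives of their classes modulo null sets. *)
Definition W1infty Omega u Du : Prop :=
  [/\ Linfty Omega u, forall i, Linfty Omega (fun x => Du x 0 i)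
    & weak_gradient Omega u Du].

(* Weak* convergence in L^oo(Omega; R^n) as the dual of L^1(Omega; R^n). *)
Definition weak_star_cvg Omega (F : nat -> V -> V) (G : V -> V) : Prop :=
  forall g : V -> V,
    (forall i, mu.-integrable Omega (fun x => (g x 0 i)%:E)) ->
    \int[mu]_(x in Omega) dotp (F j x) (g x) @[j --> \oo] -->
    \int[mu]_(x in Omega) dotp (G x) (g x).

(* The closure of C^oo_c(Omega) in W^{1,oo}(Omega) for the sequential weak*
   topology. [phi] is any representative of its class: replacing it by the
   continuous one changes the set where [phi] is nonzero by a null set only. *)
Definition W1infty0 Omega phi Dphi : Prop :=
  W1infty Omega phi Dphi /\
  exists phi_ : nat -> V -> R,
    [/\ forall j, test_function Omega (phi_ j),
        Linfty_norm Omega (phi_ j \- phi) @[j --> \oo] --> 0%E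
      & weak_star_cvg Omega (fun j => grad (phi_ j)) Dphi].

(* An element of W^{1,oo}(Omega) has a unique continuous representative, and
   it is for this representative that the equation is meant. *)
Definition infty_harmonic Omega u : Prop :=
  exists2 v, u = v %[ae mu in Omega] & viscosity_solution Omega v.

End sobolev.

(* Main.v *)
Require Import Defs.
From HB Require Import structures.
From mathcomp Require Import all_boot all_order all_algebra.
From mathcomp Require Import all_classical all_reals all_analysis.
From mathcomp Require Import measurable_realfun ess_sup_inf ring lra.
Set Implicit Arguments.
Unset Strict Implicit.
Unset Printing Implicit Defensive.
Import Order.TTheory GRing.Theory Num.Theory.
Import numFieldNormedType.Exports.
Import HBSimple.
Local Open Scope classical_set_scope.
Local Open Scope ring_scope.

(* Both sides are compared with the geometry of cones x |-> c + p |x - y|.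

   Suppose the inequality fails for phi: on {phi <> 0} the product Du . Dphi is
   at most - c < 0 wherever |Du| is close to its essential supremum M. For a
   small t > 0 the gradient of w = u + t phi is then bounded by some L < M there.
   A viscosity solution enjoys comparison with cones, so that its maximal slope
   over balls increases along a path of steepest ascent. Let L < K < M; the open
   set {phi <> 0} contains a point of slope at least K, in {phi < 0}, say, up to
   changing the signs of u and phi. Following steepest ascent by steps of fixed
   length r, u gains at least K r and w at most L r, hence t phi loses (K - L) r
   per step. The path stays in {phi < 0}, away from its boundary because phi is
   uniformly continuous, and phi would be unbounded.

   Conversely, let the inequality hold for all phi, and let psi touch u from above
   at x0 with Delta_oo psi (x0) < 0. By a second order expansion, u lies strictly
   below a cone of slope p = |Dpsi (x0)| > 0 that touches it at x0 and has its
   vertex behind x0. Lowering the cone gives a small cap phi = (u - cone)^+ with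
   Du . Dphi >= |Du| (|Du| - p); the inequality for - phi shows |Du| <= p on the
   cap, which is impossible along the ray from x0 to the vertex. *)

(** * Lebesgue measure *)

(** The gradients are weak and their bounds hold almost everywhere, whereas slopes, cones and paths
    live at points. Mollification bridges the gap in both directions: a bound |D| <= K a.e. becomes
    a Lipschitz bound along segments ([wgrad_lipschitz]), and a local Lipschitz bound becomes a
    bound a.e. ([lipschitz_wgrad_le]). The second direction tests the weak limit of the mollified
    gradients on the set where |D| > K.

    The bound L < M has two sources. Where |Du| is close to M, |Du + t Dphi|^2 <= M^2 - 2 t c + t^2
    |Dphi|^2, and t is taken so small that the last term costs at most t c; elsewhere |Du| has a
    margin that t |Dphi| does not use up.

    The cap (u - cone)^+ must be shown to lie in [W1infty0]. Its weak gradient is found from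
    difference quotients ([wgrad_indic]), and its mollifications are the approximating test
    functions.

    A cone has no second derivatives at its vertex. Comparison with cones is therefore proved with
    polynomials in the squared distance, which are smooth everywhere.

    Representatives that are bounded and measurable on the whole space replace u, Du, phi and Dphi
    at the outset, so that integrability becomes a structural matter. *)

Section sup_norm.
Context {R : realType} {n : nat}.
Implicit Types (x : 'rV[R]_n) (r : R).

Lemma coord_le_norm x i : `|x 0 i| <= `|x|.
Proof.
by rewrite [leRHS]/Num.norm /= mx_normrE; apply: (le_bigmax _ _ (0, i)).
Qed.

Lemma norm_ltP x r : 0 < r -> (`|x| < r <-> forall i, `|x 0 i| < r).
Proof.
move=> r0; split=> [xr i|xr]; first exact: le_lt_trans (coord_le_norm x i) xr.
rewrite [ltLHS]/Num.norm /= mx_normrE; apply/bigmax_ltP; split=> // -[j i] _ /=.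
by rewrite (ord1 j).
Qed.

Lemma norm_leP x r : 0 <= r -> (`|x| <= r <-> forall i, `|x 0 i| <= r).
Proof.
move=> r0; split=> [xr i|xr]; first exact: le_trans (coord_le_norm x i) xr.
rewrite [leLHS]/Num.norm /= mx_normrE; apply/bigmax_leP; split=> // -[j i] _ /=.
by rewrite (ord1 j).
Qed.

Definition open_box (a b : 'rV[R]_n) : set 'rV[R]_n :=
  [set x | forall i, a 0 i < x 0 i < b 0 i].

Definition open_boxes : set (set 'rV[R]_n) :=
  [set A | exists a b, A = open_box a b].

Lemma open_boxI a b c d : open_box a b `&` open_box c d =
  open_box (\row_i Num.max (a 0 i) (c 0 i)) (\row_i Num.min (b 0 i) (d 0 i)).
Proof.
apply/seteqP; split=> [x [xab xcd] i|x xabcd].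
  rewrite !mxE gt_max lt_min.
  by have /andP[-> ->] := xab i; have /andP[-> ->] := xcd i.
by split=> i; have := xabcd i; rewrite !mxE gt_max lt_min => /andP[/andP[h1 h2] /andP[h3 h4]]; rewrite ?h1 ?h2 ?h3 ?h4.
Qed.

Lemma setI_closed_open_boxes : setI_closed open_boxes.
Proof. by move=> _ _ [a [b ->]] [c [d ->]]; rewrite open_boxI; do 2 eexists. Qed.

Lemma ball_open_box x r : 0 < r ->
  [set y | `|y - x| < r] = open_box (x - const_mx r) (x + const_mx r).
Proof.
move=> r0; apply/seteqP; split=> [y /(norm_ltP _ r0) yxr i|y xyr].
  by have := yxr i; rewrite !mxE ltr_distl.
by apply/(norm_ltP _ r0) => i; have := xyr i; rewrite !mxE ltr_distl.
Qed.

Lemma measurable_open_box a b : measurable (open_box a b).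
Proof.
have -> : open_box a b =
    \bigcap_(i in [set: 'I_n]) (fun x : 'rV[R]_n => x 0 i) @^-1` `]a 0 i, b 0 i[%classic.
  by apply/seteqP; split=> [x h i _|x h i] /=; [rewrite in_itv; exact: h|
     have := h i I; rewrite /= in_itv].
apply: fin_bigcap_measurable => // i _.
by rewrite -[X in measurable X]setTI; apply: measurable_coord.
Qed.

Lemma ltr_trunc_norm x i (k : nat) : `|x| < k%:R -> - k%:R < x 0 i < k%:R.
Proof. by move=> xk; rewrite -ltr_norml (le_lt_trans (coord_le_norm x i)). Qed.

(** Open boxes are closed under intersection, so this description serves both the uniqueness theorem
    for measures and the lambda-system induction in [weakly_null_indicI]. A half-space in one
    coordinate is a countable union of growing boxes. *)
Lemma measurable_rVE : @measurable _ 'rV[R]_n = <<s open_boxes >>.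
Proof.
apply/seteqP; split; last first.
  apply: smallest_sub; first exact: sigma_algebra_measurable.
  by move=> _ [a [b ->]]; exact: measurable_open_box.
apply: smallest_sub; first exact: smallest_sigma_algebra.
move=> A; rewrite /= -bigcup_seq => -[i _ [Y mY <-]]; rewrite setTI.
pose T := g_sigma_algebraType open_boxes.
pose c : T -> measurableTypeR R := fun x => (x : 'rV[R]_n) 0 i.
suff : measurable_fun [set: T] c.
  by move=> /(_ measurableT _ mY); rewrite setTI.
apply: (measurability _ (RGenOInfty.measurableE R)) => // _ [_ [a ->] <-].
rewrite setTI.
have -> : c @^-1` `]a, +oo[%classic = \bigcup_k
   open_box (\row_j if j == i then a else - k%:R) (const_mx k%:R).
  apply/seteqP; split=> [x|x [k _ /(_ i)]]; rewrite /= in_itv /= andbT.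
    move=> ax; exists (Num.truncn (`|x : 'rV[R]_n|)).+1 => // j; rewrite !mxE.
    have /(_ j)/andP[lx ->] := fun j =>
      @ltr_trunc_norm (x : 'rV[R]_n) j _ (truncnS_gt `|x : 'rV[R]_n|).
    by rewrite andbT; case: eqP => // ->.
  by rewrite !mxE eqxx => /andP[].
apply: bigcup_measurable => k _.
by apply: sub_sigma_algebra; do 2 eexists.
Qed.

Lemma bigcup_open_box_natr :
  \bigcup_k open_box (const_mx (- k%:R)) (const_mx k%:R) = [set: 'rV[R]_n].
Proof.
apply/seteqP; split=> // x _; exists (Num.truncn `|x|).+1 => // i.
by rewrite !mxE; apply: ltr_trunc_norm; rewrite truncnS_gt.
Qed.

Lemma lebesgue_open_box a b :
  lebesgue_rV n (open_box a b) = (\prod_(i < n) Num.max (b 0 i - a 0 i) 0)%:E.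
Proof.
have -> : open_box a b = [set x | forall i, (`]a 0 i, b 0 i[%classic : set (measurableTypeR R)) (x 0 i)].
  by apply/seteqP; split=> x h i; have := h i; rewrite /= in_itv.
rewrite (lebesgue_rV_box (A := fun i => `]a 0 i, b 0 i[%classic))// -prodEFin; apply: eq_bigr => i _.
rewrite lebesgue_measure_itv/= lte_fin; case: ltP => ab.
  by rewrite max_l// subr_ge0 ltW.
by rewrite max_r// subr_le0.
Qed.

Lemma lebesgue_bounded (A : set 'rV[R]_n) r : measurable A ->
  (forall x, A x -> `|x| <= r) -> (lebesgue_rV n A < +oo)%E.
Proof.
move=> mA Ar; apply: (@le_lt_trans _ _ (lebesgue_rV n
    (open_box (const_mx (- (`|r| + 1))) (const_mx (`|r| + 1))))).
  apply: le_measure; rewrite ?inE//; first exact: measurable_open_box.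
  move=> x /Ar xr i; rewrite !mxE -ltr_norml.
  rewrite (le_lt_trans (coord_le_norm x i))// (le_lt_trans xr)//.
  by rewrite (le_lt_trans (ler_norm r))// ltrDl.
by rewrite lebesgue_open_box ltry.
Qed.

Lemma lebesgue_open_gt0 (A : set 'rV[R]_n) : open A -> A !=set0 ->
  (0 < lebesgue_rV n A)%E.
Proof.
move=> oA [x Ax].
have /nbhs_ballP[e /= e0 xeA] : nbhs x A by exact: open_nbhs_nbhs.
apply: (@lt_le_trans _ _ (lebesgue_rV n [set y | `|y - x| < e])).
  rewrite ball_open_box// lebesgue_open_box lte_fin prodr_gt0// => i _.
  rewrite !mxE lt_max; apply/orP; left.
  by rewrite [ltRHS](_ : _ = e + e) ?addr_gt0//; ring.
apply: le_measure; rewrite ?inE//; last first.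
- by move=> y /= yx; apply: xeA; rewrite -ball_normE/= distrC.
- exact: open_measurable_rV.
- by rewrite ball_open_box//; exact: measurable_open_box.
Qed.

End sup_norm.

(** * Invariance of the measure under reflections and translations *)

Section invariance.
Context {R : realType} {n : nat}.
Local Notation V := 'rV[R]_n.
Local Notation mu := (@lebesgue_rV R n).

(** This one family yields every invariance: convolution needs [c - x] itself, and a translation is
    a composition of two reflections. *)
Definition reflection (c x : V) : V := c - x.

Lemma measurable_reflection c : measurable_fun setT (reflection c).
Proof.
apply: measurable_fun_coordP => i; under eq_fun do rewrite !mxE.
by apply: measurable_funB => //; exact: measurable_coord.
Qed.

HB.instance Definition _ c :=
  isMeasurableFun.Build _ _ _ _ (reflection c) (@measurable_reflection c).

Lemma lebesgue_reflection c A : measurable A ->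
  mu (reflection c @^-1` A) = mu A.
Proof.
move=> mA; symmetry; move: A mA.
apply: (measure_unique open_boxes
  (fun k => open_box (const_mx (- k%:R)) (const_mx k%:R)) measurable_rVE
  setI_closed_open_boxes _ _ mu (pushforward mu (reflection c))).
- by move=> k; do 2 eexists.
- exact: bigcup_open_box_natr.
- move=> _ [a [b ->]]; rewrite /pushforward /=.
  have E : reflection c @^-1` open_box a b = open_box (c - b) (c - a).
    apply/seteqP; split=> x /= h i; have := h i; rewrite !mxE.
      by move=> /andP[h1 h2]; apply/andP; split; lra.
    by move=> /andP[h1 h2]; apply/andP; split; lra.
  rewrite -[RHS]/(mu (reflection c @^-1` open_box a b)) E !lebesgue_open_box; congr EFin; apply: eq_bigr => i _.
  by rewrite !mxE; congr Num.max; ring.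
- by move=> k; rewrite [ltLHS]lebesgue_open_box ltry.
Qed.

Lemma ge0_integral_reflection c (f : V -> \bar R) : measurable_fun setT f ->
  (forall x, 0 <= f x)%E ->
  (\int[mu]_x f (c - x)%R = \int[mu]_x f x)%E.
Proof.
move=> mf f0.
have -> : (\int[mu]_x f x = \int[pushforward mu (reflection c)]_x f x)%E.
  by apply: eq_measure_integral => A mA _; exact/esym/lebesgue_reflection.
by rewrite ge0_integral_pushforward// ?preimage_setT//; exact: measurable_reflection.
Qed.

(** Measurability suffices because positive and negative parts are transformed separately as
    extended integrals. *)
Lemma Rintegral_reflection c (f : V -> R) : measurable_fun setT f ->
  \int[mu]_x f (c - x) = \int[mu]_x f x.
Proof.
move=> mf; have mEf : measurable_fun setT (EFin \o f) by exact/measurable_EFinP.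
rewrite /Rintegral; congr fine; rewrite integralE [RHS]integralE; congr (_ - _)%E.
  rewrite -[RHS](@ge0_integral_reflection c (EFin \o f)^\+%E).
  - by apply: eq_integral => x _; rewrite !funeposE.
  - exact: measurable_funepos.
  - by [].
rewrite -[RHS](@ge0_integral_reflection c (EFin \o f)^\-%E).
- by apply: eq_integral => x _; rewrite !funenegE.
- exact: measurable_funeneg.
- by [].
Qed.

Lemma measurable_translation (c : V) : measurable_fun setT (fun x : V => x + c).
Proof.
apply: measurable_fun_coordP => i; under eq_fun do rewrite !mxE.
by apply: measurable_funD => //; exact: measurable_coord.
Qed.

Lemma Rintegral_translation c (f : V -> R) : measurable_fun setT f ->
  \int[mu]_x f (x + c) = \int[mu]_x f x.
Proof.
move=> mf; rewrite -(Rintegral_reflection 0 (f := fun x => f (x + c))); last first.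
  exact: measurableT_comp mf (measurable_translation c).
rewrite -[RHS](Rintegral_reflection c)//; apply: eq_Rintegral => x _.
by rewrite sub0r addrC.
Qed.

End invariance.

(** * Partial derivatives *)

Lemma cvg_sumr (R : realType) (T I : Type) (F : set_system T) (r : seq I)
    (f : I -> T -> R) (l : I -> R) : Filter F ->
  (forall i, f i x @[x --> F] --> l i) ->
  \sum_(i <- r) f i x @[x --> F] --> \sum_(i <- r) l i.
Proof.
move=> FF fl; elim: r => [|i r IHr].
  by under eq_cvg do rewrite big_nil; rewrite big_nil; exact: cvg_cst.
by under eq_cvg do rewrite big_cons; rewrite big_cons; exact: cvgD.
Qed.

Section calculus.
Context {R : realType} {n : nat}.
Local Notation V := 'rV[R]_n.
Implicit Types (f g : V -> R) (x h : V).

Lemma derive_partial f x h : differentiable f x ->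
  'D_h f x = \sum_i h 0 i * partial i f x.
Proof.
move=> df; rewrite deriveE// [in LHS](row_sum_delta h) linear_sum.
by apply: eq_bigr => i _; rewrite linearZ /partial deriveE.
Qed.

Lemma derivable_partial f x i : differentiable f x -> derivable f x (delta_mx 0 i).
Proof. by move=> df; apply: diff_derivable. Qed.

Lemma is_derive_line f x h (t : R) : differentiable f (x + t *: h) ->
  is_derive t 1 (fun s => f (x + s *: h)) (\sum_i h 0 i * partial i f (x + t *: h)).
Proof.
move=> df; rewrite -derive_partial//.
have E : (fun s : R => s^-1 *: (((fun s0 : R => f (x + s0 *: h)) \o shift t) (s *: 1) -
     f (x + t *: h))) = (fun s : R => s^-1 *: ((f \o shift (x + t *: h)) (s *: h) - f (x + t *: h))).
  apply/funext => s /=; congr (_ *: (f _ - _)).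
  by rewrite [s *: 1]mulr1 scalerDl addrCA.
have dh := diff_derivable df (v := h).
apply: DeriveDef; last by rewrite /derive E.
by rewrite /derivable E.
Qed.

Lemma line_mvt f x h : (forall t : R, 0 <= t <= 1 -> differentiable f (x + t *: h)) ->
  exists2 c : R, 0 <= c <= 1 &
    f (x + h) - f x = \sum_i h 0 i * partial i f (x + c *: h).
Proof.
move=> df.
have dl (t : R) : 0 <= t <= 1 -> is_derive t 1 (fun s => f (x + s *: h))
    (\sum_i h 0 i * partial i f (x + t *: h)) by move=> /df; exact: is_derive_line.
have [| |c c01] := @MVT_segment R (fun s => f (x + s *: h))
    (fun t => \sum_i h 0 i * partial i f (x + t *: h)) 0 1 ler01.
- by move=> t; rewrite in_itv/= => /andP[t0 t1]; apply: dl; rewrite !ltW.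
- apply: derivable_within_continuous => s; rewrite in_itv/= => t01.
  exact: (@ex_derive _ _ _ _ _ _ _ (dl s t01)).
- rewrite scale1r scale0r addr0 subr0 mulr1 => E.
  by exists c; first by move: c01; rewrite in_itv.
Qed.

Lemma sumr_coord_le x (c : R) (a : 'I_n -> R) : (forall i, `|a i| <= c) ->
  `|\sum_i x 0 i * a i| <= n%:R * c * `|x|.
Proof.
move=> ac; apply: (le_trans (ler_norm_sum _ _ _)).
apply: (@le_trans _ _ (\sum_(i < n) `|x| * c)).
  apply: ler_sum => i _; rewrite normrM ler_pM//; exact: coord_le_norm.
by rewrite sumr_const card_ord -mulr_natl; lra.
Qed.

Lemma lipschitz_partial f (c : R) : (forall x, differentiable f x) ->
  (forall i x, `|partial i f x| <= c) ->
  forall x h, `|f (x + h) - f x| <= n%:R * c * `|h|.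
Proof.
move=> df fc x h; have [//|t _ ->] := @line_mvt f x h.
by apply: sumr_coord_le => i; exact: fc.
Qed.

Lemma taylor1_partial f (c : R) : (forall x, differentiable f x) ->
  (forall i x, differentiable (partial i f) x) ->
  (forall i j x, `|partial i (partial j f) x| <= c) ->
  forall x h, `|f (x + h) - f x - \sum_i h 0 i * partial i f x| <=
    n%:R * (n%:R * c) * `|h| ^+ 2.
Proof.
move=> df ddf fc x h; have [//|t /andP[t0 t1] ->] := @line_mvt f x h.
rewrite -sumrB; under eq_bigr do rewrite -mulrBr.
have c0 : n%:R * c * `|h| >= 0.
  (* For n = 0 no index bounds [c] from below, but then the factor [n%:R] vanishes. *)
  case: (pickP 'I_n) => [i _|n0]; first by rewrite !mulr_ge0// (le_trans _ (fc i i 0)).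
  by rewrite -[n in n%:R]card_ord eq_card0// !mul0r.
rewrite expr2 !mulrA -[X in _ <= X * _]mulrA -mulrA.
apply: sumr_coord_le => i.
apply: (le_trans (lipschitz_partial (c := c) _ _ _ _)) => //.
rewrite normrZ ger0_norm// mulrA.
by rewrite [leLHS](_ : _ = t * (n%:R * c * `|h|)) ?ler_piMl//; ring.
Qed.

Lemma dotp_is_linear (a : V) : linear_for *:%R (dotp ^~ a).
Proof.
move=> c x y; rewrite /dotp scaler_sumr -big_split /=; apply: eq_bigr => i _.
by rewrite !mxE mulrDl -mulrA.
Qed.

Lemma continuous_dotpl (a : V) : continuous (dotp ^~ a).
Proof.
move=> x; apply: (@cvg_sumr R V _ (nbhs x)) => i.
by apply: cvgM; [exact: coord_continuous|exact: cvg_cst].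
Qed.

(** A quadratic remainder is little-o of the identity, and the differential is unique. This serves
    whenever the gradient can be guessed: convolutions, squared distances, coordinates. *)
Lemma differentiable_remainder f x (a : V) (c : R) :
  (forall h, `|h| <= 1 -> `|f (x + h) - f x - \sum_i h 0 i * a 0 i| <= c * `|h| ^+ 2) ->
  differentiable f x /\ forall i, partial i f x = a 0 i.
Proof.
move=> fh.
pose df : {linear V -> R} := HB.pack (dotp ^~ a)
  (GRing.isLinear.Build _ _ _ _ _ (dotp_is_linear a)).
have fo : f \o shift x = cst (f x) + df +o_ (0 : V) id.
  apply/eqaddoP => e e0; have ec0 : 0 < e / (`|c| + 1) by rewrite divr_gt0// ltr_wpDl.
  near=> h.
  have h1 : `|h| <= 1 by near: h; exact: (nbhs0_le (V := V) ltr01).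
  rewrite /cst/= !fctE /= opprD addrA [h + x]addrC.
  apply: (le_trans (fh h h1)); rewrite expr2 mulrA ler_wpM2r//.
  have : `|h| <= e / (`|c| + 1) by near: h; exact: (nbhs0_le (V := V) ec0).
  rewrite ler_pdivlMr ?ltr_wpDl// => he.
  apply: le_trans he; rewrite mulrC ler_wpM2l// (le_trans (ler_norm c))// lerDl//.
have cdf : continuous df by exact: continuous_dotpl.
have E := diff_unique cdf fo.
have dfx : differentiable f x by apply/diff_locallyP; rewrite E.
split=> // i; rewrite /partial deriveE// E /= /dotp (bigD1 i)//= big1 ?addr0.
  by rewrite mxE !eqxx mul1r.
by move=> j ji; rewrite mxE eqxx/= (negbTE ji) mul0r.
Unshelve. all: by end_near.
Qed.

End calculus.

(** * Integration *)

Section integration.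
Context {R : realType} {n : nat}.
Local Notation V := 'rV[R]_n.
Local Notation mu := (@lebesgue_rV R n).
Implicit Types (f g : V -> R) (x h : V).

Definition locally_bounded f := forall r : R, exists c : R, forall x, `|x| <= r -> `|f x| <= c.

(** Bounded on every ball, not just near each point. The class is stable under the operations used
    below, and its members of bounded support are integrable ([L1fun_lbm]), so integrability goals
    follow the shape of the integrand. *)
Definition lbm f := measurable_fun [set: V] f /\ locally_bounded f.

Definition bounded_support f := exists r : R, forall x, f x != 0 -> `|x| <= r.

Definition L1fun f := mu.-integrable [set: V] (EFin \o f).

Lemma bounded_support_lt f : bounded_support f ->
  exists2 r : R, 0 < r & forall x, f x != 0 -> `|x| <= r.
Proof.
move=> [r fr]; exists (`|r| + 1); first by rewrite ltr_wpDl.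
by move=> x /fr xr; rewrite (le_trans xr)// (le_trans (ler_norm r))// lerDl.
Qed.

Lemma measurable_norm_le (r : R) : measurable [set x : V | `|x| <= r].
Proof.
rewrite (_ : mkset _ = ~` [set x : V | r < `|x|]); last first.
  by apply/seteqP; split=> x /=; [move=> xr; rewrite ltNge xr|rewrite ltNge => /negP/negPn].
apply: measurableC; apply: open_measurable_rV.
by have /continuousP := @norm_continuous R V; move=> /(_ _ (@open_gt R r)).
Qed.

Lemma L1fun_lbm f : lbm f -> bounded_support f -> L1fun f.
Proof.
move=> [mf lf] /bounded_support_lt[r r0 fr].
have [c fc] := lf r.
pose B := [set x : V | `|x| <= r].
have mB : measurable B by exact: measurable_norm_le.
rewrite /L1fun (_ : EFin \o f = (EFin \o f) \_ B); last first.
  apply/funext => x; rewrite /patch /=; case: ifPn => // /negP xB.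
  congr EFin; apply/eqP; apply: contrapT => /negP /fr xr.
  by apply: xB; rewrite inE.
rewrite -integrable_mkcond//; apply: measurable_bounded_integrable => //.
- exact: lebesgue_bounded (fun x Bx => Bx).
- exact: measurable_funTS.
- exists c; split; first exact: num_real.
  by move=> d cd x Bx /=; rewrite (le_trans (fc _ Bx))// ltW.
Qed.

Lemma lbm_cst (c : R) : lbm (cst c).
Proof. by split; [exact: measurable_cst|move=> r; exists `|c|]. Qed.

Lemma lbmD f g : lbm f -> lbm g -> lbm (fun x => f x + g x).
Proof.
move=> [mf lf] [mg lg]; split; first exact: measurable_funD.
move=> r; have [c fc] := lf r; have [d gd] := lg r; exists (c + d) => x xr.
by rewrite (le_trans (ler_normD _ _))// lerD ?fc ?gd.
Qed.

Lemma lbmM f g : lbm f -> lbm g -> lbm (fun x => f x * g x).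
Proof.
move=> [mf lf] [mg lg]; split; first exact: measurable_funM.
move=> r; have [c fc] := lf r; have [d gd] := lg r; exists (c * d) => x xr.
by rewrite normrM ler_pM ?fc ?gd.
Qed.

Lemma lbmZ (c : R) f : lbm f -> lbm (fun x => c * f x).
Proof. by apply: lbmM; exact: lbm_cst. Qed.

Lemma lbmN f : lbm f -> lbm (fun x => - f x).
Proof.
move=> /(lbmZ (-1)); rewrite (_ : (fun _ => _) = (fun x => - f x))//.
by apply/funext => x; rewrite mulN1r.
Qed.

Lemma lbmB f g : lbm f -> lbm g -> lbm (fun x => f x - g x).
Proof. by move=> lf /lbmN; exact: lbmD. Qed.

Lemma lbm_norm f : lbm f -> lbm (fun x => `|f x|).
Proof.
move=> [mf lf]; split; first exact: measurableT_comp.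
by move=> r; have [c fc] := lf r; exists c => x xr; rewrite normr_id fc.
Qed.

Lemma lbm_sum I (s : seq I) (F : I -> V -> R) : (forall i, lbm (F i)) ->
  lbm (fun x => \sum_(i <- s) F i x).
Proof.
move=> lF; elim: s => [|i s IHs].
  by under eq_fun do rewrite big_nil; exact: lbm_cst.
by under eq_fun do rewrite big_cons; exact: lbmD.
Qed.

Lemma lbm_comp f (p : V -> V) (c : R) : measurable_fun setT p ->
  (forall x, `|p x| <= `|x| + c) -> lbm f -> lbm (f \o p).
Proof.
move=> mp pc [mf lf]; split; first exact: measurableT_comp.
move=> r; have [d fd] := lf (r + c); exists d => x xr /=.
by apply: fd; rewrite (le_trans (pc x))// lerD2r.
Qed.

Lemma lbm_reflection f (c : V) : lbm f -> lbm (fun x => f (c - x)).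
Proof.
apply: (lbm_comp (c := `|c|) (measurable_reflection c)) => x.
by rewrite (le_trans (ler_normB _ _))// addrC.
Qed.

Lemma lbm_translation f (c : V) : lbm f -> lbm (fun x => f (x + c)).
Proof.
apply: (lbm_comp (c := `|c|) (measurable_translation c)) => x.
by rewrite (le_trans (ler_normD _ _)).
Qed.

Lemma measurable_continuous f : continuous f -> measurable_fun setT f.
Proof.
move=> /continuousP cf; apply: (measurability _ (RGenOpens.measurableE R)).
move=> _ [_ [a [b ->] <-]]; rewrite setTI; apply: open_measurable_rV.
by apply: cf; exact: interval_open.
Qed.

Lemma lbm_continuous f : continuous f -> lbm f.
Proof.
move=> cf; split; first exact: measurable_continuous.
move=> r; pose B := [set x : V | `|x| <= r].
have cB : compact B.
  apply: bounded_closed_compact.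
    exists r; split; first exact: num_real.
    by move=> s rs x Bx /=; rewrite (le_trans Bx)// ltW.
  have /continuous_closedP this := @norm_continuous R V; exact: (this _ (@closed_le R r)).
have : compact (f @` B).
  by apply: continuous_compact => //; exact: continuous_subspaceT.
move=> /compact_bounded[c [_ fc]]; exists (c + 1) => x xr.
by apply: fc; [rewrite ltrDl|exists x].
Qed.

Lemma lbm_indic (A : set V) : measurable A -> lbm \1_A.
Proof.
move=> mA; split; first exact: measurable_indic.
by move=> r; exists 1 => x _; rewrite indicE; case: (_ \in _); rewrite ?normr1// normr0.
Qed.

Lemma bounded_supportMl f g : bounded_support f -> bounded_support (fun x => f x * g x).
Proof.
by move=> [r fr]; exists r => x; rewrite mulf_eq0 negb_or => /andP[/fr].
Qed.

Lemma bounded_supportMr f g : bounded_support g -> bounded_support (fun x => f x * g x).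
Proof.
by move=> [r fr]; exists r => x; rewrite mulf_eq0 negb_or => /andP[_ /fr].
Qed.

Lemma bounded_supportD f g : bounded_support f -> bounded_support g ->
  bounded_support (fun x => f x + g x).
Proof.
move=> /bounded_support_lt[r r0 fr] /bounded_support_lt[s s0 gs]; exists (r + s) => x.
have [f0|/fr xr _] := eqVneq (f x) 0; last by rewrite (le_trans xr)// lerDl ltW.
by rewrite f0 add0r => /gs xs; rewrite (le_trans xs)// lerDr ltW.
Qed.

Lemma bounded_supportB f g : bounded_support f -> bounded_support g ->
  bounded_support (fun x => f x - g x).
Proof.
move=> bf [r gr]; apply: (@bounded_supportD f (fun x => - g x)) => //.
by exists r => x; rewrite oppr_eq0; exact: gr.
Qed.

Lemma bounded_support_reflection f (c : V) : bounded_support f ->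
  bounded_support (fun x => f (c - x)).
Proof.
move=> [r fr]; exists (r + `|c|) => x /fr xr.
by rewrite -{1}(subKr c x) (le_trans (ler_normB _ _))// addrC lerD2r.
Qed.

Lemma bounded_support_translation f (c : V) : bounded_support f ->
  bounded_support (fun x => f (x + c)).
Proof.
move=> [r fr]; exists (r + `|c|) => x /fr xr.
by rewrite -[x](addrK c) (le_trans (ler_normB _ _))// lerD2r.
Qed.

Lemma bounded_support_indic (A : set V) (r : R) : (forall x, A x -> `|x| <= r) ->
  bounded_support \1_A.
Proof.
move=> Ar; exists r => x; rewrite indicE; case: (boolP (x \in A)) => [|_].
  by rewrite inE => /Ar.
by rewrite eqxx.
Qed.

Local Notation I f := (\int[mu]_x f x).

Lemma L1funD f g : L1fun f -> L1fun g -> L1fun (fun x => f x + g x).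
Proof. by move=> sf sg; exact: (integrableD measurableT sf sg). Qed.

Lemma L1funB f g : L1fun f -> L1fun g -> L1fun (fun x => f x - g x).
Proof. by move=> sf sg; exact: (integrableB measurableT sf sg). Qed.

Lemma L1funZ (c : R) f : L1fun f -> L1fun (fun x => c * f x).
Proof. by move=> sf; exact: (integrableZl measurableT c sf). Qed.

Lemma L1fun_measurable f : L1fun f -> measurable_fun setT f.
Proof. by move=> /measurable_int/measurable_EFinP. Qed.

Lemma eq_RI f g : f =1 g -> I f = I g.
Proof. by move=> /funext ->. Qed.

Lemma RID f g : L1fun f -> L1fun g -> \int[mu]_x (f x + g x) = I f + I g.
Proof. exact: RintegralD. Qed.

Lemma RIB f g : L1fun f -> L1fun g -> \int[mu]_x (f x - g x) = I f - I g.
Proof. exact: RintegralB. Qed.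

Lemma RIZ (c : R) f : L1fun f -> \int[mu]_x (c * f x) = c * I f.
Proof. exact: RintegralZl. Qed.

Lemma RIN f : L1fun f -> \int[mu]_x (- f x) = - I f.
Proof.
move=> sf; rewrite -[RHS]mulN1r -RIZ//; apply: eq_RI => x.
by rewrite mulN1r.
Qed.

Lemma L1fun_sum J (s : seq J) (F : J -> V -> R) : (forall i, L1fun (F i)) ->
  L1fun (fun x => \sum_(i <- s) F i x).
Proof.
move=> sF; rewrite /L1fun (_ : _ \o _ = fun x => (\sum_(i <- s) (F i x)%:E)%E).
  by apply: integrable_sum => // i _; exact: sF.
by apply/funext => x /=; rewrite sumEFin.
Qed.

Lemma RIsum J (s : seq J) (F : J -> V -> R) : (forall i, L1fun (F i)) ->
  \int[mu]_x (\sum_(i <- s) F i x) = \sum_(i <- s) I (F i).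
Proof.
move=> sF; elim: s => [|i s IHs].
  by under eq_RI do rewrite big_nil; rewrite big_nil Rintegral_cst//= mul0r.
under eq_RI do rewrite big_cons; rewrite big_cons -IHs RID//.
exact: L1fun_sum.
Qed.

Lemma RI_ge0 f : (forall x, 0 <= f x) -> 0 <= I f.
Proof. by move=> f0; apply: Rintegral_ge0. Qed.

Lemma RI_le f g : L1fun f -> L1fun g -> (forall x, f x <= g x) -> I f <= I g.
Proof. by move=> sf sg fg; apply: le_Rintegral. Qed.

Lemma RI_norm f : L1fun f -> `|I f| <= \int[mu]_x `|f x|.
Proof. exact: le_normr_Rintegral. Qed.

Lemma L1fun_norm f : L1fun f -> L1fun (fun x => `|f x|).
Proof. exact: integrable_norm. Qed.

Lemma RI_norm_le f g : L1fun f -> L1fun g -> (forall x, `|f x| <= g x) ->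
  `|I f| <= I g.
Proof.
by move=> sf sg fg; rewrite (le_trans (RI_norm sf))// RI_le//; exact: L1fun_norm.
Qed.

Lemma RI_mkcond (A : set V) f : \int[mu]_(x in A) f x = \int[mu]_x (\1_A x * f x).
Proof.
rewrite Rintegral_mkcond; apply: eq_RI => x; rewrite /patch indicE.
by case: (_ \in _); rewrite ?mul1r// mul0r.
Qed.

Lemma L1fun_le f g : measurable_fun setT f -> L1fun g ->
  (forall x, `|f x| <= g x) -> L1fun f.
Proof.
move=> mf sg fg; apply: le_integrable sg => //; first exact/measurable_EFinP.
by move=> x _ /=; rewrite lee_fin (le_trans (fg x))// ler_norm.
Qed.

Lemma RI_dominated (F : nat -> V -> R) f g : (forall k, measurable_fun setT (F k)) ->
  (forall x, F k x @[k --> \oo] --> f x) -> L1fun g ->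
  (forall k x, `|F k x| <= g x) ->
  I (F k) @[k --> \oo] --> I f.
Proof.
move=> mF Ff sg Fg.
have Fe x : (F k x)%:E @[k --> \oo] --> (f x)%:E by apply: cvg_EFin; [near=> k|exact: Ff].
have mf : measurable_fun setT f by apply: measurable_fun_cvg mF _ => x _; exact: Ff.
have [] := @dominated_convergence _ _ R mu setT measurableT (fun k x => (F k x)%:E)
  (EFin \o f) (EFin \o g) _ _ _ sg _.
- by move=> k; exact/measurable_EFinP.
- exact/measurable_EFinP.
- by apply: aeW => x _; exact: Fe.
- by apply: aeW => x k _ /=; rewrite lee_fin.
by move=> sf _; rewrite -(fineK (integrable_fin_num _ sf))// => /fine_cvgP[_].
Unshelve. all: by end_near.
Qed.

End integration.

(** * Test functions *)

Section smooth_line.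
Context {R : realType}.
Implicit Types (f g : R -> R) (t : R).

(** Level 0 asks for nothing, not even continuity, so level [k.+1] is what yields continuity of the
    k-th derivative. *)
Fixpoint Ck1 (k : nat) f : Prop :=
  match k with
  | 0 => True
  | k.+1 => exists g, (forall t, is_derive t 1 f (g t)) /\ Ck1 k g
  end.

Lemma Ck1S k f : Ck1 k.+1 f -> Ck1 k f.
Proof.
elim: k f => [//|k IHk] f [g [fg sg]]; exists g; split=> //.
exact: IHk.
Qed.

Lemma Ck1_cst k (c : R) : Ck1 k (cst c).
Proof.
elim: k c => [//|k IHk] c; exists (cst 0); split=> // t.
exact: is_derive_cst.
Qed.

Lemma Ck1D k f g : Ck1 k f -> Ck1 k g -> Ck1 k (fun t => f t + g t).
Proof.
elim: k f g => [//|k IHk] f g [df [fdf sdf]] [dg [gdg sdg]].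
exists (fun t => df t + dg t); split; last exact: IHk.
by move=> t; exact: is_deriveD.
Qed.

Lemma Ck1M k f g : Ck1 k f -> Ck1 k g -> Ck1 k (fun t => f t * g t).
Proof.
elim: k f g => [//|k IHk] f g cf cg.
have [df [fdf sdf]] := cf; have [dg [gdg sdg]] := cg.
exists (fun t => f t * dg t + g t * df t); split; last first.
  by apply: Ck1D; apply: IHk => //; exact: Ck1S.
by move=> t; exact: is_deriveM.
Qed.

Lemma Ck1_affine k f (c d : R) : Ck1 k f -> Ck1 k (fun t => f (c * t + d)).
Proof.
elim: k f => [//|k IHk] f [df [fdf sdf]].
exists (fun t => df (c * t + d) * c); split; last first.
  by apply: Ck1M; [exact: IHk|exact: Ck1_cst].
move=> t; have -> : (fun t => f (c * t + d)) = f \o (fun t => c * t + d) by [].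
apply: is_derive1_comp.
have -> : c = c *: 1 + 0 by rewrite addr0 [_ *: _]mulr1.
apply: is_deriveD; rewrite [c *: 1 + 0]addr0.
have -> : *%R (c *: 1) = (fun x : R => c *: x).
  by apply/funext => x; rewrite [c *: 1]mulr1.
exact: is_deriveZ.
Qed.

(** The functions t^-m exp(-1/t), extended by 0. The family is closed under differentiation up to
    linear combinations, so smoothness is an induction that never computes a higher derivative. *)
Definition exp_inv (m : nat) (t : R) : R :=
  if 0 < t then t^-1 ^+ m * expR (- t^-1) else 0.

Lemma exp_inv_le0 m t : t <= 0 -> exp_inv m t = 0.
Proof. by rewrite /exp_inv leNgt => /negbTE ->. Qed.

Lemma exp_inv_ge0 m t : 0 <= exp_inv m t.
Proof.
rewrite /exp_inv; case: ifP => // t0.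
by rewrite mulr_ge0 ?expR_ge0// exprn_ge0// invr_ge0 ltW.
Qed.

(** One term of the exponential series at 1/t gives t^-(m+2) <= (m+2)! exp(1/t). A quadratic bound
    is what makes the derivative at 0 vanish. *)
Lemma exp_inv_quadratic m t : exp_inv m t <= (m.+2)`!%:R * t ^+ 2.
Proof.
rewrite /exp_inv; case: ifP => t0; last by rewrite mulr_ge0// sqr_ge0.
have s0 : 0 <= t^-1 by rewrite invr_ge0 ltW.
have := expR_ge1Dxn m.+1 s0; set s := t^-1 => h.
have {}h : s ^+ m.+2 <= m.+2`!%:R * expR s.
  rewrite -ler_pdivrMl ?ltr0n ?fact_gt0// mulrC.
  by apply: le_trans h; rewrite lerDr.
have -> : s ^+ m = s ^+ m.+2 * t ^+ 2.
  by rewrite -addn2 exprD -mulrA -exprMn mulVf ?gt_eqF// expr1n mulr1.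
rewrite expRN mulrAC ler_wpM2r ?sqr_ge0//.
by rewrite ler_pdivrMr ?expR_gt0.
Qed.

Lemma is_derive_exp_inv m t :
  is_derive t 1 (exp_inv m) (- m%:R * exp_inv m.+1 t + exp_inv m.+2 t).
Proof.
have [t0|t0|->] := ltgtP t 0.
- rewrite !exp_inv_le0 ?ltW// mulr0 addr0.
  have H : is_derive t (1 : R) (fun=> 0 : R) 0 by exact: is_derive_cst.
  apply: near_eq_is_derive H.
  by near=> s; rewrite exp_inv_le0// ltW//; near: s; exact: lt_nbhsl.
- apply: (@near_eq_is_derive R _ _ (fun t => t^-1 ^+ m * expR (- t^-1))).
    near=> s; rewrite /exp_inv; have -> // : 0 < s.
    by near: s; exact: lt_nbhsr.
  rewrite /exp_inv t0.
  have tn0 : t != 0 by rewrite gt_eqF.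
  have dV : is_derive t 1 (fun t : R => t^-1) (- t ^- 2 *: 1).
    by apply: (@is_deriveV R id) => //; exact: is_derive_id.
  have d1 : is_derive t 1 (fun t : R => t^-1 ^+ m) (m%:R * t^-1 ^+ m.-1 *: (- t ^- 2 *: 1)).
    have -> : (fun t : R => t^-1 ^+ m) = (fun t : R => t^-1) ^+ m.
      by apply/funext => s; rewrite exprfctE.
    exact: is_deriveX.
  have d2 : is_derive t 1 (expR \o (fun t : R => - t^-1)) (expR (- t^-1) * (- (- t ^- 2 *: 1))).
    by apply: is_derive1_comp; exact: is_deriveN.
  have := is_deriveM d1 d2; congr is_derive.
  rewrite /= -![_ *: _]/(_ * _) !mulr1.
  case: m {d1} => [|m]; first by rewrite !mul0r oppr0 !mul0r; rewrite expr0; field.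
  by rewrite -!exprVn; set s := t^-1; rewrite /= !exprS; ring.
- rewrite !exp_inv_le0// mulr0 addr0.
  have c0 : (fun h : R => h^-1 *: ((exp_inv m \o shift 0) (h *: 1) - exp_inv m 0)) @ 0^' --> (0 : R).
    apply/cvgrPdist_le => e e0.
    have c0 : (0 : R) < m.+2`!%:R by rewrite ltr0n fact_gt0.
    near=> h; rewrite sub0r normrN /= (exp_inv_le0 m (lexx _)) subr0 addr0 [h *: 1]mulr1.
    rewrite [_ *: _]/(_ * _) normrM (ger0_norm (exp_inv_ge0 _ _)).
    have h0 : h != 0 by near: h; exact: nbhs_dnbhs_neq.
    rewrite normfV ler_pdivrMl ?normr_gt0//.
    apply: (le_trans (exp_inv_quadratic _ _)).
    rewrite -real_normK ?num_real// expr2 mulrCA ler_wpM2l// mulrC -ler_pdivlMr//.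
    by near: h; apply: dnbhs0_le; rewrite divr_gt0.
  split; first by apply/cvg_ex; exists 0.
  exact/cvg_lim.
Unshelve. all: by end_near.
Qed.

Lemma Ck1_exp_inv k m : Ck1 k (exp_inv m).
Proof.
elim: k m => [//|k IHk] m.
exists (fun t => - m%:R * exp_inv m.+1 t + exp_inv m.+2 t); split.
  exact: is_derive_exp_inv.
apply: Ck1D; last exact: IHk.
by apply: Ck1M; [exact: Ck1_cst|exact: IHk].
Qed.

Lemma exp_inv0_le1 t : exp_inv 0 t <= 1.
Proof.
rewrite /exp_inv; case: ifP => // t0.
by rewrite expr0 mul1r -expR0 ler_expR oppr_le0 invr_ge0 ltW.
Qed.

Lemma exp_inv0_eq0 t : (exp_inv 0 t != 0) = (0 < t).
Proof.
rewrite /exp_inv; case: ifP => t0; last by rewrite eqxx.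
by rewrite expr0 mul1r gt_eqF// expR_gt0.
Qed.

Lemma cvg_exp_inv t : 0 < t -> exp_inv 0 (k.+1%:R * t) @[k --> \oo] --> (1 : R).
Proof.
move=> t0.
have -> : (fun k : nat => exp_inv 0 (k.+1%:R * t)) = (fun k => expR (- (k.+1%:R^-1 * t^-1))).
  apply/funext => k; rewrite /exp_inv mulr_gt0 ?ltr0n// expr0 mul1r invfM.
  by [].
rewrite -[X in _ --> X]expR0; apply: continuous_cvg; first exact: continuous_expR.
rewrite -[X in _ --> X]oppr0; apply: cvgN; rewrite -[X in _ --> X](mul0r t^-1).
by apply: cvgM; [exact: cvg_harmonic|exact: cvg_cst].
Qed.

End smooth_line.

Section test_functions.
Context {R : realType} {n : nat}.
Local Notation V := 'rV[R]_n.
Implicit Types (f g : V -> R) (x h : V) (Omega : set V).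

Definition tensor (b : 'I_n -> R -> R) x : R := \prod_i b i (x 0 i).

Lemma differentiable_prod_coord (s : seq 'I_n) (b : 'I_n -> R -> R) x :
  (forall i t, derivable (b i) t 1) ->
  differentiable (fun x : V => \prod_(i <- s) b i (x 0 i)) x.
Proof.
move=> db; elim: s => [|i s IHs].
  by under eq_fun do rewrite big_nil; exact: differentiable_cst.
under eq_fun do rewrite big_cons; apply: differentiableM => //.
apply: (@differentiable_comp _ _ _ _ (fun x : V => x 0 i) (b i)).
  exact: differentiable_coord.
exact/derivable1_diffP.
Qed.

Lemma partial_tensor (b : 'I_n -> R -> R) (i : 'I_n) (db : R -> R) :
  (forall t : R, is_derive t 1 (b i) (db t)) ->
  partial i (tensor b) = tensor (fun j => if j == i then db else b j).
Proof.
move=> bdb; apply/funext => x.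
pose c := \prod_(j | j != i) b j (x 0 j).
have E t : tensor b (t *: delta_mx 0 i + x) = b i (t *: 1 + x 0 i) * c.
  rewrite /tensor (bigD1 i)//= !mxE !eqxx; congr (_ * _).
  by apply: eq_bigr => j ji; rewrite !mxE (negbTE ji) andbF mulr0 add0r.
have d : is_derive (x 0 i) 1 (fun s => b i s * c) (db (x 0 i) * c).
  have := is_deriveM (bdb (x 0 i)) (is_derive_cst c (x 0 i) 1).
  by congr is_derive; rewrite scaler0 add0r mulrC.
have -> : tensor (fun j => if j == i then db else b j) x = db (x 0 i) * c.
  rewrite /tensor (bigD1 i)//= eqxx; congr (_ * _).
  by apply: eq_bigr => j ji; rewrite (negbTE ji).
rewrite -[RHS](@derive_val _ _ _ _ _ _ _ d) /partial /derive.
have -> // : (fun h : R => h^-1 *: ((tensor b \o shift x) (h *: delta_mx 0 i) - tensor b x)) =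
  (fun h : R => h^-1 *: (((fun s => b i s * c) \o shift (x 0 i)) (h *: 1) - b i (x 0 i) * c)).
apply/funext => h /=; rewrite E; congr (_ *: (_ - _)).
by rewrite /tensor (bigD1 i).
Qed.

(** A partial derivative replaces one factor by its derivative, so tensors are stable and induction
    on the order applies. The additional level of [Ck1] pays for continuity at the last order. *)
Lemma Ck_tensor k (b : 'I_n -> R -> R) : (forall i, Ck1 k.+1 (b i)) -> Ck k setT (tensor b).
Proof.
have dbl k' (b' : 'I_n -> R -> R) : (forall i, Ck1 k'.+1 (b' i)) -> forall i t, derivable (b' i) t 1.
  by move=> sb i t; have [g [bg _]] := sb i; exact: (@ex_derive _ _ _ _ _ _ _ (bg t)).
elim: k b => [|k IHk] b sb.
  by move=> x _; apply: differentiable_continuous; apply: differentiable_prod_coord; exact: dbl sb.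
split=> [x _|i]; first by apply: differentiable_prod_coord; exact: dbl sb.
have [db [bdb sdb]] := sb i.
rewrite (partial_tensor bdb); apply: IHk => j.
by case: eqP => // _; exact: Ck1S.
Qed.

Lemma test_functionP Omega f (B : set V) (r : R) : (forall k, Ck k setT f) ->
  closed B -> B `<=` Omega -> (forall x, B x -> `|x| <= r) ->
  (forall x, f x != 0 -> B x) -> test_function Omega f.
Proof.
move=> cf cB BO Br fB.
have sB : closure [set x | f x != 0] `<=` B.
  by rewrite closureE => x; apply; split=> // y /fB.
split=> //; last by apply: subset_trans BO.
apply: (subclosed_compact _ _ sB); first exact: closed_closure.
apply: bounded_closed_compact => //.
exists r; split; first exact: num_real.
by move=> s rs x /Br xr /=; rewrite (le_trans xr)// ltW.
Qed.

Section elim.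
Variables (Omega : set V) (f : V -> R).
Hypothesis tf : test_function Omega f.

Lemma test_differentiable x : differentiable f x.
Proof. by have [/(_ 1%N)[df _] _ _] := tf; exact: df. Qed.

Lemma test_continuous : continuous f.
Proof. by move=> x; apply: differentiable_continuous; exact: test_differentiable. Qed.

Lemma test_eq0 x : ~ Omega x -> f x = 0.
Proof.
move=> Ox; apply/eqP; apply: contrapT => /negP fx.
by have [_ _ sO] := tf; apply: Ox; apply: sO; exact: subset_closure.
Qed.

Lemma test_bounded_support : bounded_support f.
Proof.
have [_ /compact_bounded[r [_ fr]] _] := tf; exists (r + 1) => x fx.
by apply: fr; [rewrite ltrDl|exact: subset_closure].
Qed.

(** Off its closed support a function vanishes on a whole neighbourhood, so its derivative vanishes
    there and the support does not grow. *)
Lemma test_partial i : test_function Omega (partial i f).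
Proof.
have [cf kf sO] := tf.
have sub : [set x | partial i f x != 0] `<=` closure [set x | f x != 0].
  move=> x /= pfx; apply: contrapT => /= nx; move/negP: pfx; apply; apply/eqP.
  have : open (~` closure [set x | f x != 0]).
    by apply: closed_openC; exact: closed_closure.
  rewrite openE => /(_ x nx) /= xn.
  have f0 : \forall y \near x, f y = cst 0 y.
    near=> y; have /= : (~` closure [set x | f x != 0]) y by near: y.
    move=> ny; apply/eqP; apply: contrapT => /negP fy; apply: ny.
    exact: subset_closure.
  rewrite /partial (near_eq_derive _ f0).
  exact: derive_cst.
have cl : closure [set x | partial i f x != 0] `<=` closure [set x | f x != 0].
  by rewrite [X in X `<=` _]closureE => x; apply; split=> //; exact: closed_closure.
split.
- by move=> k; have [_] := cf k.+1; apply.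
- exact: (subclosed_compact (@closed_closure _ _) kf cl).
- exact: subset_trans cl sO.
Unshelve. all: by end_near.
Qed.

Lemma test_lbm : lbm f.
Proof. exact: lbm_continuous test_continuous. Qed.

Lemma test_L1fun g : lbm g -> L1fun (fun x => g x * f x).
Proof.
move=> lg; apply: L1fun_lbm; first exact: lbmM lg test_lbm.
exact: bounded_supportMr test_bounded_support.
Qed.

End elim.

Lemma test_sub (A B : set V) f : A `<=` B -> test_function A f -> test_function B f.
Proof. by move=> AB [cf kf sA]; split=> //; exact: subset_trans AB. Qed.

Definition closed_box (a b : V) : set V := [set x | forall i, a 0 i <= x 0 i <= b 0 i].

Lemma closed_closed_box a b : closed (closed_box a b).
Proof.
have -> : closed_box a b = \bigcap_(i in [set: 'I_n]) (fun x : V => x 0 i) @^-1` `[a 0 i, b 0 i].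
  by apply/seteqP; split=> [x h i _|x h i]; [rewrite /= in_itv; exact: h|
    have := h i I; rewrite /= in_itv].
apply: closed_bigI => i _.
have /continuous_closedP := @coord_continuous R 1 n 0 i; apply.
exact: interval_closed.
Qed.

Lemma closed_box_bounded a b x : closed_box a b x -> `|x| <= `|a| + `|b|.
Proof.
move=> xab; apply/norm_leP; first by rewrite addr_ge0.
move=> i; have /andP[ax xb] := xab i.
have := coord_le_norm a i; have := coord_le_norm b i.
by rewrite !ler_norml => /andP[b1 b2] /andP[a1 a2]; have := normr_ge0 a; have := normr_ge0 b; lra.
Qed.

(** For each [k] it is nonzero exactly on the open box. As [k] grows the arguments of [exp_inv 0]
    tend to infinity, where its limit is 1, so the bumps tend to the indicator of the box and never
    exceed it. *)
Definition box_bump (k : nat) (a b : V) : V -> R := tensor (fun i t =>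
  exp_inv 0 (k.+1%:R * (t - a 0 i)) * exp_inv 0 (k.+1%:R * (b 0 i - t))).

Lemma box_bump_ge0 k a b x : 0 <= box_bump k a b x.
Proof. by apply: prodr_ge0 => i _; rewrite mulr_ge0// exp_inv_ge0. Qed.

Lemma box_bump_le1 k a b x : box_bump k a b x <= 1.
Proof.
rewrite /box_bump /tensor; apply: prodr_ile1 => i _.
by rewrite mulr_ge0 ?exp_inv_ge0//= mulr_ile1// ?exp_inv_ge0 ?exp_inv0_le1.
Qed.

Lemma box_bump_neq0 k a b x : box_bump k a b x != 0 <-> open_box a b x.
Proof.
split=> [/prodf_neq0 h i|h].
  have := h i isT; rewrite mulf_eq0 negb_or !exp_inv0_eq0.
  by rewrite !pmulr_rgt0 ?ltr0n// !subr_gt0.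
apply/prodf_neq0 => i _; rewrite mulf_eq0 negb_or !exp_inv0_eq0.
by rewrite !pmulr_rgt0 ?ltr0n// !subr_gt0.
Qed.

Lemma cvg_box_bump a b x : box_bump k a b x @[k --> \oo] --> (\1_(open_box a b) x : R).
Proof.
rewrite indicE; case: (boolP (x \in open_box a b)) => [|/negP xab].
  rewrite inE => xab /=; have <- : \prod_(i < n) (1 : R) = 1 by rewrite big1.
  have cvg_prodr (s : seq 'I_n) (F : 'I_n -> nat -> R) : (forall i, F i k @[k --> \oo] --> (1 : R)) ->
      \prod_(i <- s) F i k @[k --> \oo] --> (\prod_(i <- s) 1 : R).
    move=> Fl; elim: s => [|i s IHs].
      by under eq_cvg do rewrite big_nil; rewrite big_nil; exact: cvg_cst.
    by under eq_cvg do rewrite big_cons; rewrite big_cons; exact: cvgM.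
  apply: cvg_prodr => i; rewrite -[X in _ --> X]mulr1.
  by have /andP[ax xb] := xab i; apply: cvgM; apply: cvg_exp_inv; rewrite subr_gt0.
have -> : (fun k => box_bump k a b x) = cst 0; last exact: cvg_cst.
apply/funext => k; apply/eqP; apply: contrapT => /negP /box_bump_neq0 ?.
by apply: xab; rewrite inE.
Qed.

Lemma Ck_box_bump j k a b : Ck j setT (box_bump k a b).
Proof.
apply: Ck_tensor => i; apply: Ck1M.
  rewrite (_ : (fun _ => _) = fun t => exp_inv 0 (k.+1%:R * t + - (k.+1%:R * a 0 i))).
    exact: (Ck1_affine _ _ (Ck1_exp_inv _ _)).
  by apply/funext => t; rewrite mulrBr.
rewrite (_ : (fun _ => _) = fun t => exp_inv 0 (- k.+1%:R * t + k.+1%:R * b 0 i)).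
  exact: (Ck1_affine _ _ (Ck1_exp_inv _ _)).
by apply/funext => t; rewrite mulrBr mulNr addrC.
Qed.

Lemma test_box_bump Omega k a b : closed_box a b `<=` Omega -> test_function Omega (box_bump k a b).
Proof.
move=> abO; apply: (test_functionP _ (@closed_closed_box a b) abO (@closed_box_bounded a b)).
  by move=> j; exact: Ck_box_bump.
by move=> x /box_bump_neq0 xab i; have /andP[ax xb] := xab i; rewrite !ltW.
Qed.

End test_functions.

(** * Weak convergence *)

Section weak_convergence.
Context {R : realType} {n : nat}.
Local Notation V := 'rV[R]_n.
Local Notation mu := (@lebesgue_rV R n).
Implicit Types (f g : V -> R) (x h : V) (Omega : set V).

Lemma open_box_cover Omega : open Omega -> Omega !=set0 ->
  exists a b : nat -> V, (forall k, closed_box (a k) (b k) `<=` Omega) /\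
    Omega `<=` \bigcup_k open_box (a k) (b k).
Proof.
move=> oO [x0 Ox0].
pose Q := ('rV[rat]_n * nat)%type.
pose lo (p : Q) : V := \row_i (ratr (p.1 0 i) - p.2.+1%:R^-1).
pose hi (p : Q) : V := \row_i (ratr (p.1 0 i) + p.2.+1%:R^-1).
have key x : Omega x -> exists p : Q,
    closed_box (lo p) (hi p) `<=` Omega /\ open_box (lo p) (hi p) x.
  move=> Ox; have /nbhs_ballP[e /= e0 xeO] : nbhs x Omega by exact: open_nbhs_nbhs.
  have e20 : 0 < e / 2 by rewrite divr_gt0.
  pose k := Num.truncn (e / 2)^-1.
  have ke : k.+1%:R^-1 < e / 2 :> R by rewrite invf_plt ?posrE// truncnS_gt.
  have h i : exists q : rat, `|x 0 i - ratr q| < k.+1%:R^-1.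
    have [|q] := @rat_in_itvoo R (x 0 i) (x 0 i + k.+1%:R^-1); first by rewrite ltrDl invr_gt0.
    rewrite in_itv/= => /andP[q1 q2]; exists q.
    by rewrite distrC gtr0_norm ?subr_gt0// ltrBlDl.
  pose q : 'rV[rat]_n := \row_i projT1 (cid (h i)).
  have hq i : `|x 0 i - ratr (q 0 i)| < k.+1%:R^-1 by rewrite mxE; exact: (projT2 (cid (h i))).
  exists (q, k); split=> [y yq|i]; last first.
    by have := hq i; rewrite !mxE /= ltr_distl.
  apply: xeO; rewrite -ball_normE /=; apply/norm_ltP => // i; rewrite !mxE.
  have /= := yq i; rewrite !mxE /= => /andP[y1 y2].
  have := hq i; rewrite ltr_distl => /andP[x1 x2].
  move: ke y1 y2 x1 x2; rewrite mxE; move: k.+1%:R^-1 (ratr _) => d r ke y1 y2 x1 x2.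
  by rewrite ltr_norml; apply/andP; split; lra.
have [p0 [p0O _]] := key _ Ox0.
(* [p0] fills the indices that code no admissible box; its existence is where a point of [Omega] is
   used. *)
pose p (k : nat) : Q := if unpickle k is Some p then
  (if pselect (closed_box (lo p) (hi p) `<=` Omega) then p else p0) else p0.
exists (lo \o p), (hi \o p); split=> [k|x /key[q [qO qx]]].
  by rewrite /p /=; case: unpickle => // q; case: pselect.
by exists (pickle q) => //; rewrite /p /= pickleK; case: pselect.
Qed.

Lemma indicI (A B : set V) x : \1_(A `&` B) x = \1_A x * \1_B x :> R.
Proof. by rewrite !indicE in_setI -natrM mulnb. Qed.

Lemma indic_ge0 (A : set V) x : 0 <= \1_A x :> R.
Proof. by rewrite indicE. Qed.

Lemma indic_le1 (A : set V) x : \1_A x <= 1 :> R.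
Proof. by rewrite indicE; case: (_ \in _). Qed.

Lemma open_box_bounded (a b : V) x : open_box a b x -> `|x| <= `|a| + `|b|.
Proof.
by move=> xab; apply: closed_box_bounded => i; have /andP[? ?] := xab i; rewrite !ltW.
Qed.

Lemma L1fun_indic (A : set V) (r : R) : measurable A -> (forall x, A x -> `|x| <= r) ->
  L1fun (\1_A : V -> R).
Proof.
move=> mA Ar; apply: L1fun_lbm; first exact: lbm_indic.
exact: bounded_support_indic Ar.
Qed.

Section bounded_sequence.
Variables (F : nat -> V -> R) (C : R).
Hypothesis mF : forall k, measurable_fun setT (F k).
Hypothesis FC : forall k x, `|F k x| <= C.

Definition weakly_null g := \int[mu]_x (F k x * g x) @[k --> \oo] --> (0 : R).

Lemma L1funM k g : L1fun g -> L1fun (fun x => F k x * g x).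
Proof.
move=> sg; apply: (@L1fun_le _ _ _ (fun x => C * `|g x|)).
- apply: measurable_funM => //.
  exact: L1fun_measurable sg.
- exact: L1funZ (L1fun_norm sg).
- by move=> x; rewrite normrM ler_wpM2r.
Qed.

(** Since [F] is bounded by [C], replacing [g] by [h] changes each integral by at most [C] times
    their L^1 distance. Hence the functions against which [F] is weakly null form a closed subset of
    L^1. *)
Lemma weakly_null_closure g : L1fun g ->
  (forall e : R, 0 < e -> exists2 h, L1fun h /\ weakly_null h &
     \int[mu]_x `|g x - h x| <= e) ->
  weakly_null g.
Proof.
move=> sg gh; apply/cvgrPdist_le => e e0.
have C1 : 0 < `|C| + 1 by rewrite ltr_wpDl.
have [|h [sh wh] ghe] := gh (e / 2 / (`|C| + 1)); first by rewrite !divr_gt0.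
near=> k; rewrite sub0r normrN.
rewrite (_ : Rintegral _ _ _ = \int[mu]_x (F k x * (g x - h x)) + \int[mu]_x (F k x * h x)); last first.
  rewrite -RID; last 2 first.
  - by apply: L1funM; exact: L1funB.
  - exact: L1funM.
  by apply: eq_RI => x; rewrite mulrBr subrK.
rewrite (le_trans (ler_normD _ _))// (splitr e) lerD//; last first.
  near: k; have /cvgrPdist_le/(_ (e / 2)) := wh.
  rewrite divr_gt0// => /(_ isT); apply: filterS => k.
  by rewrite sub0r normrN.
have sgh : L1fun (fun x => g x - h x) by exact: L1funB.
apply: (@le_trans _ _ ((`|C| + 1) * \int[mu]_x `|g x - h x|)); last first.
  by rewrite mulrC -ler_pdivlMr.
rewrite -RIZ; last exact: L1fun_norm.
apply: RI_norm_le; first exact: L1funM.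
  exact: L1funZ (L1fun_norm sgh).
move=> x; rewrite normrM ler_wpM2r// (le_trans (FC k x))// (le_trans (ler_norm C))//.
by rewrite lerDl.
Unshelve. all: by end_near.
Qed.

Lemma weakly_null0 : weakly_null (cst 0).
Proof.
rewrite /weakly_null (_ : (fun k => _) = cst 0); first exact: cvg_cst.
apply/funext => k; rewrite (_ : Rintegral _ _ _ = \int[mu]_x (cst 0 x : R)).
  by rewrite Rintegral_cst// mul0r.
by apply: eq_RI => x; rewrite mulr0.
Qed.

Lemma weakly_nullD (g h : V -> R) : L1fun g -> L1fun h -> weakly_null g -> weakly_null h ->
  weakly_null (fun x => g x + h x).
Proof.
move=> sg sh wg wh; rewrite /weakly_null -[X in _ --> X]addr0.
rewrite (_ : (fun k => _) = fun k => \int[mu]_x (F k x * g x) + \int[mu]_x (F k x * h x)).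
  exact: cvgD wg wh.
apply/funext => k; rewrite -RID; try exact: L1funM.
by apply: eq_RI => x; rewrite mulrDr.
Qed.

Lemma weakly_nullZ (c : R) g : L1fun g -> weakly_null g -> weakly_null (fun x => c * g x).
Proof.
move=> sg wg; rewrite /weakly_null -[X in _ --> X](mulr0 c).
rewrite (_ : (fun k => _) = fun k => c * \int[mu]_x (F k x * g x)).
  exact: cvgMl_tmp wg.
apply/funext => k; rewrite -RIZ; last exact: L1funM.
by apply: eq_RI => x; rewrite mulrCA.
Qed.

Lemma weakly_null_dominated (G : nat -> V -> R) (g h : V -> R) : (forall m, L1fun (G m)) ->
  (forall m, weakly_null (G m)) -> L1fun g -> L1fun h ->
  (forall m x, `|G m x| <= h x) -> (forall x, `|g x| <= h x) ->
  (forall x, G m x @[m --> \oo] --> g x) -> weakly_null g.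
Proof.
move=> sG wG sg sh Gh gh Gg; apply: weakly_null_closure => // e e0.
have : \int[mu]_x `|g x - G m x| @[m --> \oo] --> \int[mu]_x (cst 0 x : R).
  apply: (RI_dominated (g := fun x => 2 * h x)).
  - by move=> m; apply: L1fun_measurable; apply: L1fun_norm; exact: L1funB.
  - move=> x; rewrite -[X in _ --> X](normr0 R); apply: cvg_norm.
    by rewrite -(subrr (g x)); apply: cvgB; [exact: cvg_cst|exact: Gg].
  - exact: L1funZ.
  - move=> m x; rewrite normr_id (le_trans (ler_normB _ _))//.
    by rewrite mulr_natl mulr2n lerD.
rewrite (_ : \int[mu]_x _ = 0); last by rewrite Rintegral_cst// mul0r.
move=> /cvgrPdist_le/(_ e e0)[m _ /(_ m (leqnn m))].
rewrite sub0r normrN => ge; exists (G m) => //.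
exact: le_trans (ler_norm _) ge.
Qed.

Section weak.
Variables (Omega : set V).
Hypothesis F0 : forall zeta, test_function Omega zeta -> weakly_null zeta.

Lemma weakly_null_open_box (a b : V) : closed_box a b `<=` Omega ->
  weakly_null \1_(open_box a b).
Proof.
move=> abO; have sI := L1fun_indic (measurable_open_box a b) (@open_box_bounded a b).
apply: (@weakly_null_dominated (fun m => box_bump m a b) _ \1_(open_box a b)) => //.
- move=> m; have tb := test_box_bump m abO.
  by apply: L1fun_lbm; [exact: test_lbm tb|exact: test_bounded_support tb].
- by move=> m; apply: F0; exact: test_box_bump.
- move=> m x; rewrite ger0_norm ?box_bump_ge0//.
  have [->|/box_bump_neq0 xab] := eqVneq (box_bump m a b x) 0; first exact: indic_ge0.
  by rewrite indicE mem_set// box_bump_le1.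
- by move=> x; rewrite ger0_norm ?indic_ge0.
- exact: cvg_box_bump.
Qed.

(** For a fixed box the good sets [A] form a lambda system, by linearity and dominated convergence.
    It contains the boxes, because an intersection of two boxes is a box, hence all measurable
    sets. *)
Lemma weakly_null_indicI (a b : V) (A : set V) : closed_box a b `<=` Omega -> measurable A ->
  weakly_null (fun x => \1_A x * \1_(open_box a b) x).
Proof.
move=> abO mA; pose Q := open_box a b.
pose H : set (set V) := [set A | measurable A /\ weakly_null (fun x => \1_A x * \1_Q x)].
have sQ (B : set V) : measurable B -> L1fun (fun x => \1_B x * \1_Q x : R).
  move=> mB; apply: L1fun_lbm.
    by apply: lbmM; apply: lbm_indic => //; exact: measurable_open_box.
  by apply: bounded_supportMr; exact: bounded_support_indic (@open_box_bounded a b).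
suff : measurable `<=` H by move=> /(_ A mA)[].
rewrite measurable_rVE; apply: lambda_system_subset => //.
- exact: setI_closed_open_boxes.
- split=> //.
  + split; first exact: measurableT.
    rewrite /weakly_null; under eq_cvg do under eq_RI do rewrite indicE in_setT mul1r.
    exact: weakly_null_open_box.
  + move=> A1 A2 A21 [m1 w1] [m2 w2]; split; first exact: measurableD.
    rewrite (_ : (fun _ => _) = fun x => \1_A1 x * \1_Q x + (-1) * (\1_A2 x * \1_Q x)).
      by apply: weakly_nullD => //; [exact: sQ|apply: L1funZ; exact: sQ|apply: weakly_nullZ => //; exact: sQ].
    apply/funext => x; rewrite mulN1r -mulrBl; congr (_ * _).
    rewrite !indicE in_setD; have [xA1|xA1] := boolP (x \in A1); last first.
      have /negbTE -> : x \notin A2 by apply: contra xA1; rewrite !inE; exact: A21.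
      by rewrite subr0.
    by case: (x \in A2); rewrite /= ?subrr ?subr0.
  + move=> G ndG HG; split; first by apply: bigcup_measurable => k _; have [] := HG k.
    apply: (@weakly_null_dominated (fun m x => \1_(G m) x * \1_Q x) _ \1_Q) => //.
    * by move=> m; apply: sQ; have [] := HG m.
    * by move=> m; have [] := HG m.
    * by apply: sQ; apply: bigcup_measurable => k _; have [] := HG k.
    * exact: L1fun_indic (measurable_open_box a b) (@open_box_bounded a b).
    * move=> m x; rewrite ger0_norm ?mulr_ge0 ?indic_ge0//.
      by rewrite ler_piMl ?indic_ge0 ?indic_le1.
    * move=> x; rewrite ger0_norm ?mulr_ge0 ?indic_ge0//.
      by rewrite ler_piMl ?indic_ge0 ?indic_le1.
    * move=> x; apply: cvgMr_tmp; rewrite indicE.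
      have [|xG] := boolP (x \in \bigcup_i G i).
        rewrite inE => -[m _ Gmx].
        apply: cvg_near_cst; exists m => // k /= mk.
        by rewrite indicE mem_set//; have /subsetPset := ndG _ _ mk; exact.
      apply: cvg_near_cst; near=> k.
      rewrite indicE; case: (boolP (x \in G k)) => // xGk.
      by have /negP[] := xG; rewrite inE; exists k => //; move: xGk; rewrite inE.
- move=> _ [c [d ->]]; split; first exact: measurable_open_box.
  rewrite (_ : (fun _ => _) = \1_(open_box c d `&` Q)); last first.
    by apply/funext => x; rewrite indicI.
  rewrite open_boxI; apply: weakly_null_open_box => x xcd.
  apply: abO => i; have := xcd i; rewrite !mxE ge_max le_min.
  by move=> /andP[/andP[_ ->] /andP[_ ->]].
Unshelve. all: by end_near.
Qed.

(** Convergence against test functions spreads to all of L^1 on [Omega]: from boxes to measurable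
    pieces of finite unions of boxes, then to simple functions, to [g] cut off to such a union, and
    to [g] by exhausting [Omega]. *)
Lemma weakly_null_L1 g : open Omega -> L1fun g -> (forall x, ~ Omega x -> g x = 0) ->
  weakly_null g.
Proof.
move=> oO sg gO.
have [Oe|/set0P Oe] := eqVneq Omega set0.
  have g0 : g = cst 0 by apply/funext => x; rewrite gO// Oe.
  by rewrite g0; exact: weakly_null0.
have [a [b [abO Oab]]] := open_box_cover oO Oe.
pose U m := \bigcup_(j in `I_m) open_box (a j) (b j).
have mU m : measurable (U m).
  by apply: bigcup_measurable => j _; exact: measurable_open_box.
have bU m : exists r : R, forall x, U m x -> `|x| <= r.
  elim: m => [|m [r IHr]]; first by exists 0 => x [j].
  exists (`|r| + (`|a m| + `|b m|)) => x [j]; rewrite /= ltnS leq_eqVlt => /orP[/eqP ->|jm abx].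
    by move=> /open_box_bounded xab; rewrite (le_trans xab)// lerDr.
  have xr : `|x| <= r by apply: IHr; exists j.
  by rewrite (le_trans xr)// (le_trans (ler_norm r))// lerDl addr_ge0.
have sU m (A : set V) : measurable A -> L1fun (fun x => \1_A x * \1_(U m) x : R).
  move=> mA; have [r Ur] := bU m; apply: L1fun_lbm; first by apply: lbmM; exact: lbm_indic.
  by apply: bounded_supportMr; exact: bounded_support_indic Ur.
have wU m (A : set V) : measurable A -> weakly_null (fun x => \1_A x * \1_(U m) x).
  elim: m A => [|m IHm] A mA.
    rewrite (_ : (fun _ => _) = cst 0); first exact: weakly_null0.
    apply/funext => x; rewrite (_ : U 0%N = set0) ?indic0 ?mulr0//.
    by apply/seteqP; split=> // y [j].
  (* Only the part of the new box outside [U m] is added, so that the pieces are disjoint and their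
     indicators add up. *)
  rewrite (_ : (fun _ => _) = fun x => \1_A x * \1_(U m) x +
      \1_(A `&` ~` U m) x * \1_(open_box (a m) (b m)) x).
    have mAU : measurable (A `&` ~` U m) by apply: measurableI => //; exact: measurableC.
    apply: weakly_nullD; [exact: sU| |exact: IHm|exact: weakly_null_indicI].
    apply: L1fun_lbm; first by apply: lbmM; apply: lbm_indic => //; exact: measurable_open_box.
    by apply: bounded_supportMr; exact: bounded_support_indic (@open_box_bounded (a m) (b m)).
  apply/funext => x; rewrite indicI -mulrA -mulrDr; congr (_ * _).
  rewrite !indicE in_setC.
  have -> : (x \in U m.+1) = (x \in U m) || (x \in open_box (a m) (b m)).
    apply/idP/idP => [|/orP[]]; rewrite !inE.
    - move=> [j /=]; rewrite ltnS leq_eqVlt => /orP[/eqP -> ?|jm ?]; apply/orP.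
        by right; rewrite inE.
      by left; rewrite inE; exists j.
    - by move=> [j /= jm ?]; exists j => //=; exact: ltnW.
    - by move=> ?; exists m => /=.
  by case: (x \in U m); rewrite /= ?mul0r ?mul1r ?addr0 ?add0r.
have sgU m (f : V -> R) : L1fun f -> L1fun (fun x => f x * \1_(U m) x).
  move=> sf; apply: (@L1fun_le _ _ _ (fun x => `|f x|)); last 2 first.
  - exact: L1fun_norm.
  - by move=> x; rewrite normrM ler_piMr// ger0_norm ?indic_ge0 ?indic_le1.
  by apply: measurable_funM; [exact: L1fun_measurable|exact: measurable_indic].
have wgU m : weakly_null (fun x => g x * \1_(U m) x).
  (* Simple functions approximate [g] in L^1, and cutting both off to [U m] does not increase the
     distance. Each simple function is a finite combination of pieces treated by [wU]. *)
  have [s_ [s_int _ sg0]] := approximation_sfun_integrable measurableT sg.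
  apply: weakly_null_closure => [|e e0]; first exact: sgU.
  have [k ke] : exists k, \int[mu]_x `|g x - s_ k x| <= e.
    have : fine (\int[mu]_x `|(g x)%:E - (s_ k x)%:E|)%E @[k --> \oo] --> (0 : R).
      by move: sg0 => /fine_cvgP[].
    move=> /cvgrPdist_le/(_ e e0)[k _ /(_ k (leqnn k))]; rewrite sub0r normrN => ke.
    by exists k; exact: le_trans (ler_norm _) ke.
  have ss : L1fun (s_ k) by exact: s_int.
  exists (fun x => s_ k x * \1_(U m) x); last first.
    apply: le_trans ke; apply: RI_le.
    - by apply: L1fun_norm; apply: L1funB; exact: sgU.
    - by apply: L1fun_norm; exact: L1funB.
    - by move=> x; rewrite -mulrBl normrM ler_piMr// ger0_norm ?indic_ge0 ?indic_le1.
  split; first exact: sgU.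
  rewrite (_ : (fun x => _) = fun x => \sum_(y <- finmap.enum_fset (fset_set (range (s_ k))))
     y * (\1_(s_ k @^-1` [set y]) x * \1_(U m) x)); last first.
    apply/funext => x; rewrite fimfunE fsbig_finite//= mulr_suml.
    by apply: eq_bigr => y _; rewrite mulrA.
  elim: (finmap.enum_fset _) => [|y l IHl].
    by under [X in weakly_null X]eq_fun do rewrite big_nil; exact: weakly_null0.
  under [X in weakly_null X]eq_fun do rewrite big_cons.
  have sy z : L1fun (fun x => z * (\1_(s_ k @^-1` [set z]) x * \1_(U m) x)).
    by apply: L1funZ; exact: sU.
  apply: weakly_nullD => //; first exact: L1fun_sum.
  by apply: weakly_nullZ; [exact: sU|exact: wU].
apply: (@weakly_null_dominated (fun m x => g x * \1_(U m) x) g (fun x => `|g x|)) => //.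
- by move=> m; exact: sgU.
- exact: L1fun_norm.
- by move=> m x; rewrite normrM ler_piMr// ger0_norm ?indic_ge0 ?indic_le1.
- move=> x; have [Ox|Ox] := pselect (Omega x); last first.
    by rewrite gO//; under eq_cvg do rewrite mul0r; exact: cvg_cst.
  have [j _ xj] := Oab x Ox.
  rewrite -[X in _ --> X]mulr1; apply: cvgMl_tmp.
  apply: cvg_near_cst; exists j.+1 => // m /= jm.
  by rewrite indicE mem_set//; exists j.
Qed.

End weak.
End bounded_sequence.
End weak_convergence.

(** * Convolution *)

Section convolution.
Context {R : realType} {n : nat}.
Local Notation V := 'rV[R]_n.
Local Notation mu := (@lebesgue_rV R n).
Implicit Types (f g zeta : V -> R) (x y h : V) (Omega : set V).

Lemma RI_eq0_ae f : L1fun f -> (forall x, 0 <= f x) -> \int[mu]_x f x = 0 ->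
  \forall x \ae mu, f x = 0.
Proof.
move=> sf f0 If.
have : (\int[mu]_x `|(f x)%:E| = 0)%E.
  rewrite (eq_integral (EFin \o f)); last by move=> x _; rewrite gee0_abs ?lee_fin.
  by rewrite -(fineK (integrable_fin_num _ sf))// -[fine _]/(Rintegral _ _ _) If.
move=> /(ae_eq_integral_abs mu measurableT (measurable_int _ sf)).
by apply: filterS => x /(_ I)[].
Qed.

Lemma RI_ae f g : measurable_fun setT f -> measurable_fun setT g ->
  (\forall x \ae mu, f x = g x) -> \int[mu]_x f x = \int[mu]_x g x.
Proof.
move=> mf mg fg; rewrite /Rintegral; congr fine.
apply: ae_eq_integral => //; try exact/measurable_EFinP.
by apply: filterS fg => x -> _.
Qed.

(** The constant sequence [f] is weakly null against test functions, hence against the integrable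
    function [f * \1_A]. For a constant sequence this says that the integral of f^2 over [A] is
    0. *)
Lemma fundamental_lemma Omega f (C : R) : open Omega -> measurable_fun setT f ->
  (forall x, `|f x| <= C) ->
  (forall zeta, test_function Omega zeta -> \int[mu]_x (f x * zeta x) = 0) ->
  \forall x \ae mu, Omega x -> f x = 0.
Proof.
move=> oO mf fC f0.
suff h (m : nat) : \forall x \ae mu, Omega x -> `|x| <= m%:R -> f x = 0.
  have : \forall x \ae mu, forall m : nat, Omega x -> `|x| <= m%:R -> f x = 0.
    exact: ae_foralln.
  apply: filterS => x hx Ox; apply: (hx (Num.truncn `|x|).+1 Ox).
  by rewrite ltW// truncnS_gt.
pose A := Omega `&` [set x | `|x| <= m%:R].
have mA : measurable A by apply: measurableI; [exact: open_measurable_rV|exact: measurable_norm_le].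
have lf : lbm f by split=> // r; exists C.
have sA g : lbm g -> L1fun (fun x => g x * \1_A x).
  move=> lg; apply: L1fun_lbm; first by apply: lbmM => //; exact: lbm_indic.
  by apply: bounded_supportMr; apply: (bounded_support_indic (r := m%:R)) => x [].
have wf : weakly_null (fun=> f) (fun x => f x * \1_A x).
  apply: (@weakly_null_L1 R n (fun=> f) C (fun=> mf) (fun=> fC) Omega) => //.
  - move=> zeta tz; rewrite /weakly_null; under eq_cvg do rewrite f0//.
    exact: cvg_cst.
  - exact: sA.
  - by move=> x Ox; rewrite indicE memNset ?mulr0// => -[].
have E : (fun x => f x * (f x * \1_A x)) = (fun x => f x * f x * \1_A x).
  by apply/funext => x; rewrite mulrA.
have : \int[mu]_x (f x * (f x * \1_A x)) = 0.
  apply: (@cvg_unique R _ (fmap (fun _ : nat => \int[mu]_x (f x * (f x * \1_A x))) \oo)) => //.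
  exact: cvg_cst.
rewrite E => /RI_eq0_ae h.
have {h} := h (sA _ (lbmM lf lf)) _.
move=> /(_ (fun x => mulr_ge0 (sqr_ge0 (f x)) (indic_ge0 A x))).
apply: filterS => x fx Ox xm; apply/eqP; move/eqP: fx.
by rewrite indicE mem_set// mulr1 mulf_eq0 orbb.
Qed.

Lemma continuous_affine (s : R) (c : V) : continuous (fun x => c + s *: x).
Proof.
by move=> x; exact: differentiable_continuous.
Qed.

Lemma differentiable_affine f (a s : R) (c : V) x : differentiable f (c + s *: x) ->
  differentiable (fun x => a * f (c + s *: x)) x.
Proof.
move=> df; have -> : (fun x => a * f (c + s *: x)) = a *: (f \o (fun x => c + s *: x)) by [].
apply: differentiableZ; apply: differentiable_comp => //.
Qed.

Lemma partial_affine f (a s : R) (c : V) x i : differentiable f (c + s *: x) ->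
  partial i (fun x => a * f (c + s *: x)) x = a * s * partial i f (c + s *: x).
Proof.
move=> df; rewrite /partial.
have -> : 'D_(delta_mx 0 i) (fun x => a * f (c + s *: x)) x =
    'D_(s *: delta_mx 0 i) (a *: f) (c + s *: x).
  rewrite /derive (_ : (fun h : R => _) = (fun h : R => h^-1 *: (((a *: f) \o shift (c + s *: x))
    (h *: (s *: delta_mx 0 i)) - (a *: f) (c + s *: x))))//.
  apply/funext => h /=; congr (_ *: (a * f _ - _)).
  by rewrite scalerDr !scalerA mulrC addrCA.
rewrite deriveZ; last exact: diff_derivable.
by rewrite !deriveE// linearZ /= -mulrA.
Qed.

Lemma Ck_affine k f (a s : R) (c : V) : Ck k setT f ->
  Ck k setT (fun x => a * f (c + s *: x)).
Proof.
elim: k f a => [|k IHk] f a cf.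
  move=> x _; have fx : {for c + s *: x, continuous f} by exact: cf.
  have : {for x, continuous (f \o (fun x => c + s *: x))}.
    by apply: continuous_comp; [exact: (@continuous_affine s c x)|exact: fx].
  by move=> h; have := cvgMl_tmp (a := a) h; exact.
have [df pf] := cf; split=> [x _|i].
  by apply: differentiable_affine; exact: df.
rewrite (_ : partial i _ = fun x => a * s * partial i f (c + s *: x)).
  by apply: IHk; exact: pf.
by apply/funext => x; apply: partial_affine; exact: df.
Qed.

Lemma test_affine Omega O' f (a s : R) (c : V) : s != 0 -> test_function O' f ->
  (forall x, O' (c + s *: x) -> Omega x) ->
  test_function Omega (fun x => a * f (c + s *: x)).
Proof.
move=> s0 tf OO'; have [cf kf sf] := tf.
pose B := (fun x => c + s *: x) @^-1` closure [set x | f x != 0].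
have [r fr] : exists r : R, forall x, closure [set x | f x != 0] x -> `|x| <= r.
  by have /compact_bounded[r [_ fr]] := kf; exists (r + 1) => x fx; apply: fr => //; rewrite ltrDl.
apply: (@test_functionP _ _ _ _ B (`|s|^-1 * (r + `|c|))).
- by move=> k; exact: Ck_affine.
- have /continuous_closedP := @continuous_affine s c.
  by apply; exact: closed_closure.
- by move=> x Bx; apply: OO'; exact: sf.
- move=> x /fr xr; rewrite ler_pdivlMl ?normr_gt0// -normrZ.
  by rewrite -[s *: x](addKr c) addrC (le_trans (ler_normB _ _))// lerD2r.
- by move=> x; rewrite mulf_eq0 negb_or => /andP[_ fx]; exact: subset_closure.
Qed.

Lemma test_bounded f : test_function setT f -> exists c : R, forall x, `|f x| <= c.
Proof.
move=> tf; have [r fr] := test_bounded_support tf.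
have [_ /(_ r)[c fc]] := test_lbm tf; exists (`|c|) => x.
have [->|/fr/fc fx] := eqVneq (f x) 0; first by rewrite normr0.
exact: le_trans fx (ler_norm c).
Qed.

Lemma test_partial_bounded f : test_function setT f ->
  exists2 c : R, 0 <= c & forall i x, `|partial i f x| <= c.
Proof.
move=> tf; have h i : exists c : R, forall x, `|partial i f x| <= c.
  by apply: test_bounded; exact: test_partial.
exists (\sum_i projT1 (cid (h i))) => [|i x].
  by apply: sumr_ge0 => i _; case: cid => c /= /(_ 0); exact: le_trans.
have := projT2 (cid (h i)) x => /le_trans; apply.
rewrite (bigD1 i)//= lerDl; apply: sumr_ge0 => j _.
by case: cid => c /= /(_ 0); exact: le_trans.
Qed.

Lemma test_lipschitz f : test_function setT f ->
  exists2 c : R, 0 <= c & forall x y, `|f x - f y| <= c * `|x - y|.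
Proof.
move=> tf; have [c c0 fc] := test_partial_bounded tf; exists (n%:R * c); first exact: mulr_ge0.
move=> x y; have := lipschitz_partial (test_differentiable tf) fc y (x - y).
by rewrite [y + _]addrC subrK.
Qed.

Lemma test_taylor f : test_function setT f ->
  exists2 c : R, 0 <= c & forall x h,
    `|f (x + h) - f x - \sum_i h 0 i * partial i f x| <= c * `|h| ^+ 2.
Proof.
move=> tf.
have h j : exists c : R, 0 <= c /\ forall i x, `|partial i (partial j f) x| <= c.
  by have [c c0 fc] := test_partial_bounded (test_partial tf j); exists c.
pose c := \sum_j projT1 (cid (h j)).
have c0 : 0 <= c by apply: sumr_ge0 => j _; case: cid => ? [].
exists (n%:R * (n%:R * c)); first by rewrite !mulr_ge0.
apply: taylor1_partial; first exact: test_differentiable tf.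
  by move=> i; exact: test_differentiable (test_partial tf i).
move=> i j x; have [_ /(_ i x)/le_trans] := projT2 (cid (h j)); apply.
rewrite /c (bigD1 j)//= lerDl; apply: sumr_ge0 => l _.
by case: cid => ? [].
Qed.

Definition convol f zeta x : R := \int[mu]_y (f y * zeta (x - y)).

Lemma convol_L1 f zeta x : lbm f -> lbm zeta -> bounded_support zeta ->
  L1fun (fun y => f y * zeta (x - y)).
Proof.
move=> lf lz bz; apply: L1fun_lbm.
  by apply: lbmM => //; exact: lbm_reflection.
by apply: bounded_supportMr; exact: bounded_support_reflection.
Qed.

Lemma convolE f zeta x : lbm f -> lbm zeta ->
  convol f zeta x = \int[mu]_z (f (x - z) * zeta z).
Proof.
move=> lf lz; rewrite -(Rintegral_reflection x (f := fun z => f (x - z) * zeta z)).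
  by apply: eq_RI => y; rewrite subKr.
by have [] := lbmM (lbm_reflection x lf) lz.
Qed.

(** The Taylor remainder of [zeta] is quadratic in [h] uniformly in the base point. Integrating it
    against [f] over a fixed ball leaves a quadratic remainder, as [differentiable_remainder]
    asks. *)
Lemma convol_differentiable f zeta x : lbm f -> test_function setT zeta ->
  differentiable (convol f zeta) x /\
  forall i, partial i (convol f zeta) x = convol f (partial i zeta) x.
Proof.
move=> lf tz; have lz := test_lbm tz; have bz := test_bounded_support tz.
have [r r0 zr] := bounded_support_lt bz.
have [c c0 zc] := test_taylor tz.
(* For [|h| <= 1] this ball contains every [y] at which [zeta (x - y)], [zeta (x + h - y)] or a
   partial derivative at [x - y] is nonzero. *)
pose B := [set y : V | `|y| <= r + `|x| + 1].
have mB : measurable B by exact: measurable_norm_le.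
have sfB : L1fun (fun y => `|f y| * \1_B y).
  apply: L1fun_lbm; first by apply: lbmM; [exact: lbm_norm|exact: lbm_indic].
  by apply: bounded_supportMr; apply: bounded_support_indic (fun x Bx => Bx).
pose a : V := \row_i convol f (partial i zeta) x.
have [//| dc pc] := @differentiable_remainder R n (convol f zeta) x a
    (c * \int[mu]_y (`|f y| * \1_B y)) _; last first.
  by split=> // i; rewrite pc mxE.
move=> h h1.
have sz z : L1fun (fun y => f y * zeta (z - y)) by exact: convol_L1.
have sp i : L1fun (fun y => h 0 i * (f y * partial i zeta (x - y))).
  have tp := test_partial tz i; apply: L1funZ; apply: convol_L1 => //.
    exact: test_lbm tp.
  exact: test_bounded_support tp.
rewrite (_ : _ - _ = \int[mu]_y (f y * (zeta (x + h - y) - zeta (x - y) -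
    \sum_i h 0 i * partial i zeta (x - y)))); last first.
  rewrite /convol -RIB// (_ : \sum_i _ = \int[mu]_y (\sum_i h 0 i * (f y * partial i zeta (x - y)))); last first.
    rewrite RIsum//; apply: eq_bigr => i _; rewrite mxE RIZ//.
    have tp := test_partial tz i; apply: convol_L1 => //; first exact: test_lbm tp.
    exact: test_bounded_support tp.
  rewrite -RIB; [|exact: L1funB|exact: L1fun_sum].
  apply: eq_RI => y; rewrite !mulrBr; congr (_ - _).
  by rewrite mulr_sumr; apply: eq_bigr => i _; rewrite mulrCA.
rewrite mulrAC -RIZ//; apply: RI_norm_le.
- rewrite (_ : (fun _ => _) = fun y => (f y * zeta (x + h - y) - f y * zeta (x - y)) -
     \sum_i h 0 i * (f y * partial i zeta (x - y))).
    by apply: L1funB; [exact: L1funB|exact: L1fun_sum].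
  apply/funext => y; rewrite !mulrBr; congr (_ - _).
  by rewrite mulr_sumr; apply: eq_bigr => i _; rewrite mulrCA.
- exact: L1funZ.
- move=> y; rewrite normrM mulrCA ler_wpM2l//.
  have [By|nBy] := boolP (y \in B).
    by rewrite indicE By mulr1 (_ : x + h - y = (x - y) + h) ?zc// addrAC.
  have out z : r < `|z| -> zeta z = 0 /\ forall i, partial i zeta z = 0.
    move=> rz; have nz : ~ closure [set x | zeta x != 0] z.
      move=> cz; have : [set x | `|x| <= r] z; last by rewrite /= leNgt rz.
      move: cz; rewrite closureE; apply; split => //.
      have /continuous_closedP := @norm_continuous R V; exact: (fun p => p _ (@closed_le R r)).
    have tz' : test_function (closure [set x | zeta x != 0]) zeta.
      by have [cz kz _] := tz; split.
    split=> [|i]; first exact: (test_eq0 tz').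
    exact: (test_eq0 (test_partial tz' i)).
  have yr : r + `|x| + 1 < `|y|.
    by rewrite ltNge; apply/negP => yr; move/negP: nBy; apply; rewrite inE.
  have n1 : r < `|x - y|.
    have := ler_normB (x - y) x; rewrite [x - y - x]addrAC subrr sub0r normrN; lra.
  have n2 : r < `|x + h - y|.
    have := ler_normB (x + h - y) (x + h); rewrite [x + h - y - _]addrAC subrr sub0r normrN.
    have := ler_normD x h; lra.
  have [-> p0] := out _ n1; have [-> _] := out _ n2.
  rewrite big1; first by rewrite !subrr normr0 !mulr_ge0// ?indic_ge0// sqr_ge0.
  by move=> i _; rewrite p0 mulr0.
Qed.

Lemma partial_convol f zeta i : lbm f -> test_function setT zeta ->
  partial i (convol f zeta) = convol f (partial i zeta).
Proof. by move=> lf tz; apply/funext => x; have [_ ->] := convol_differentiable x lf tz. Qed.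

Lemma Ck_convol k f zeta : lbm f -> test_function setT zeta -> Ck k setT (convol f zeta).
Proof.
move=> lf; elim: k zeta => [|k IHk] zeta tz.
  by move=> x _; apply: differentiable_continuous; have [] := convol_differentiable x lf tz.
split=> [x _|i]; first by have [] := convol_differentiable x lf tz.
by rewrite partial_convol//; apply: IHk; exact: test_partial.
Qed.

Lemma lbm_convol f zeta : lbm f -> test_function setT zeta -> lbm (convol f zeta).
Proof.
by move=> lf tz; apply: lbm_continuous => x; apply: (Ck_convol 0 lf tz).
Qed.

End convolution.

(** * Mollification and its convergence *)

Section mollification.
Context {R : realType} {n : nat}.
Local Notation V := 'rV[R]_n.
Local Notation mu := (@lebesgue_rV R n).
Implicit Types (f g zeta : V -> R) (x y h : V) (Omega : set V).

Lemma measurable_sub : measurable_fun setT (fun p : V * V => p.1 - p.2).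
Proof.
apply: measurable_fun_coordP => i; under eq_fun do rewrite !mxE.
apply: measurable_funB.
  exact: (measurableT_comp (measurable_coord i) measurable_fst).
exact: (measurableT_comp (measurable_coord i) measurable_snd).
Qed.

(** The joint integrand is bounded with bounded support: [g] confines [x], and y = x - (x - y) is
    then confined by the support of [zeta]. Fubini's theorem therefore applies. *)
Lemma convol_fubini f g zeta : lbm f -> lbm g -> bounded_support g ->
  test_function setT zeta ->
  \int[mu]_x (convol f zeta x * g x) =
  \int[mu]_y (f y * \int[mu]_x (g x * zeta (x - y))).
Proof.
move=> lf lg bg tz.
have lz := test_lbm tz; have bz := test_bounded_support tz.
have [r r0 gr] := bounded_support_lt bg; have [s s0 zs] := bounded_support_lt bz.
pose H (p : V * V) : R := f p.2 * zeta (p.1 - p.2) * g p.1.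
pose B := [set x : V | `|x| <= r] `*` [set y : V | `|y| <= r + s].
have mB : measurable B by apply: measurableX; exact: measurable_norm_le.
have mH : measurable_fun setT H.
  have [mf _] := lf; have [mg _] := lg; have [mz _] := lz.
  apply: measurable_funM; first apply: measurable_funM.
  - exact: (measurableT_comp mf measurable_snd).
  - exact: (measurableT_comp mz measurable_sub).
  - exact: (measurableT_comp mg measurable_fst).
have HB p : H p != 0 -> B p.
  rewrite /H !mulf_eq0 !negb_or => /andP[/andP[_ /zs zp] /gr gp]; split => //=.
  by rewrite -[p.2](subKr p.1) (le_trans (ler_normB _ _))// lerD.
have iH : (mu \x mu)%E.-integrable setT (EFin \o H).
  rewrite (_ : EFin \o H = (EFin \o H) \_ B); last first.
    apply/funext => p; rewrite /patch /=; case: ifPn => // /negP pB.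
    by congr EFin; apply/eqP; apply: contrapT => /negP /HB ?; apply: pB; rewrite inE.
  rewrite -integrable_mkcond//; apply: measurable_bounded_integrable => //.
  - have fin (t : R) : (mu [set x : V | (`|x| <= t)%R] < +oo)%E.
      by apply: lebesgue_bounded (fun x Bx => Bx); exact: measurable_norm_le.
    suff : ((mu \x mu)%E B < +oo)%E by [].
    have -> : (mu \x mu)%E B = (mu [set x | (`|x| <= r)%R] * mu [set y | (`|y| <= r + s)%R])%E.
      by apply: product_measure1E; exact: measurable_norm_le.
    by rewrite lte_mul_pinfty// ge0_fin_numE.
  - exact: measurable_funTS.
  - have [c fc] := lf.2 (r + s); have [d gd] := lg.2 r; have [e ze] := test_bounded tz.
    exists (c * e * d); split; first exact: num_real.
    move=> M lM p [p1 p2] /=; apply: le_trans (ltW lM).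
    by rewrite /H !normrM !ler_pM ?fc ?gd ?ze// mulr_ge0.
have := Fubini iH.
have E1 : (\int[mu]_x \int[mu]_y (EFin \o H) (x, y) = \int[mu]_x (convol f zeta x * g x)%:E)%E.
  apply: eq_integral => x _.
  have sx : L1fun (fun y => f y * zeta (x - y) * g x).
    apply: L1fun_lbm; first by apply: lbmM; [apply: lbmM => //; exact: lbm_reflection|exact: lbm_cst].
    by apply: bounded_supportMl; apply: bounded_supportMr; exact: bounded_support_reflection.
  rewrite -[LHS](fineK (integrable_fin_num _ sx))//; congr EFin.
  rewrite -[LHS]/(\int[mu]_y (f y * zeta (x - y) * g x)) /convol [RHS]mulrC -RIZ; last exact: convol_L1.
  by apply: eq_RI => y; rewrite mulrC.
have E2 : (\int[mu]_y \int[mu]_x (EFin \o H) (x, y) =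
    \int[mu]_y (f y * \int[mu]_x (g x * zeta (x - y)))%:E)%E.
  apply: eq_integral => y _.
  have lzy : lbm (fun x => zeta (x - y)) by exact: lbm_translation.
  have sx : L1fun (fun x => f y * zeta (x - y) * g x).
    apply: L1fun_lbm; first by apply: lbmM => //; apply: lbmM => //; exact: lbm_cst.
    exact: bounded_supportMr.
  rewrite -[LHS](fineK (integrable_fin_num _ sx))//; congr EFin.
  rewrite -[LHS]/(\int[mu]_x (f y * zeta (x - y) * g x)) -RIZ.
    by apply: eq_RI => x; rewrite mulrAC mulrA.
  by apply: L1fun_lbm; [exact: lbmM|exact: bounded_supportMl].
by rewrite E1 E2 /Rintegral => ->.
Qed.

(* Even, so that convolution with it is a self-adjoint operation. *)
Definition mollifier (k : nat) : V -> R :=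
  let d : V := const_mx k.+1%:R^-1 in
  fun z => (\int[mu]_x box_bump 0 (- d) d x)^-1 * box_bump 0 (- d) d (0 + 1 *: z).

Lemma test_box_bumpT k (a b : V) : test_function setT (box_bump k a b).
Proof. exact: test_box_bump. Qed.

Lemma RI_box_bump_gt0 k (d : V) : (forall i, 0 < d 0 i) ->
  0 < \int[mu]_x box_bump k (- d) d x.
Proof.
move=> d0; have tb := test_box_bumpT k (- d) d.
have sb : L1fun (box_bump k (- d) d).
  by apply: L1fun_lbm; [exact: test_lbm tb|exact: test_bounded_support tb].
rewrite lt_neqAle RI_ge0 ?andbT; last exact: box_bump_ge0.
apply/eqP => /esym/RI_eq0_ae h; have {h}[N [mN N0 Nb]] := h sb (@box_bump_ge0 _ _ _ _ _).
have : (mu (open_box (- d) d) <= mu N)%E.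
  apply: le_measure; rewrite ?inE//; first exact: measurable_open_box.
  by move=> x /box_bump_neq0 bx; apply: Nb => /= /eqP; apply/negP.
rewrite N0 leNgt lebesgue_open_box lte_fin prodr_gt0// => i _.
by rewrite !mxE lt_max opprK addr_gt0.
Qed.

Lemma mollifier_mass_gt0 k :
  0 < \int[mu]_x box_bump 0 (- const_mx k.+1%:R^-1) (const_mx k.+1%:R^-1 : V) x.
Proof. by apply: RI_box_bump_gt0 => i; rewrite mxE. Qed.

(** The form [0 + 1 *: z] inside [mollifier] makes it literally an instance of [test_affine]. *)
Lemma test_mollifier k : test_function setT (mollifier k).
Proof. by apply: test_affine (test_box_bumpT _ _ _) _; rewrite ?oner_neq0. Qed.

Lemma lbm_mollifier k : lbm (mollifier k).
Proof. exact: test_lbm (test_mollifier k). Qed.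

Lemma mollifier_bounded_support k : bounded_support (mollifier k).
Proof. exact: test_bounded_support (test_mollifier k). Qed.

Lemma L1fun_mollifier k : L1fun (mollifier k).
Proof. by apply: L1fun_lbm; [exact: lbm_mollifier|exact: mollifier_bounded_support]. Qed.

Lemma mollifier_ge0 k z : 0 <= mollifier k z.
Proof.
by rewrite mulr_ge0 ?box_bump_ge0// invr_ge0 ltW// mollifier_mass_gt0.
Qed.

Lemma RI_mollifier k : \int[mu]_z mollifier k z = 1.
Proof.
rewrite RIZ.
  rewrite [X in _ * X](@eq_RI _ _ _ (box_bump 0 (- const_mx k.+1%:R^-1) (const_mx k.+1%:R^-1 : V))).
    by rewrite mulVf// gt_eqF// mollifier_mass_gt0.
  by move=> x; rewrite scale1r add0r.
have tb := @test_affine R n setT setT _ 1 1 0 (oner_neq0 R)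
  (test_box_bumpT 0 (- const_mx k.+1%:R^-1) (const_mx k.+1%:R^-1 : V)) (fun x _ => I).
have := L1fun_lbm (test_lbm tb) (test_bounded_support tb).
by under eq_fun do rewrite mul1r.
Qed.

Lemma mollifierN k z : mollifier k (- z) = mollifier k z.
Proof.
rewrite /mollifier; congr (_ * _); rewrite !scale1r !add0r /box_bump /tensor.
apply: eq_bigr => i _; rewrite mulrC !mxE.
by congr (exp_inv _ (_ * _) * exp_inv _ (_ * _)); ring.
Qed.

Lemma mollifier_support k z : mollifier k z != 0 -> `|z| < k.+1%:R^-1.
Proof.
rewrite /mollifier scale1r add0r mulf_eq0 negb_or => /andP[_ /box_bump_neq0 zd].
by apply/norm_ltP => // i; have := zd i; rewrite !mxE -ltr_norml.
Qed.

Lemma RI_mollifier_reflection k x : \int[mu]_y mollifier k (x - y) = 1.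
Proof. by rewrite Rintegral_reflection ?RI_mollifier//; have [] := lbm_mollifier k. Qed.

(** The mollification at [x] is an average of the values of [f] at sup-norm distance less than
    [k.+1%:R^-1]. Boundedness, convergence at points of continuity and control of supports are all
    read off from this. *)
Lemma convol_close f k x (a e : R) : lbm f ->
  (forall y, `|x - y| < k.+1%:R^-1 -> `|f y - a| <= e) ->
  `|convol f (mollifier k) x - a| <= e.
Proof.
move=> lf fe; rewrite -[X in _ - X]mulr1 -(RI_mollifier_reflection k x).
have lm : lbm (fun y => mollifier k (x - y)) by exact: lbm_reflection (lbm_mollifier k).
have bm : bounded_support (fun y => mollifier k (x - y)).
  exact: bounded_support_reflection (mollifier_bounded_support k).
have sm : L1fun (fun y => mollifier k (x - y)) by exact: L1fun_lbm.
rewrite -RIZ// /convol -RIB; last 2 first.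
- exact: convol_L1 (lbm_mollifier k) (mollifier_bounded_support k).
- exact: L1funZ.
rewrite -[X in _ <= X]mulr1 -(RI_mollifier_reflection k x) -RIZ//.
apply: RI_norm_le.
- by apply: L1funB; [exact: convol_L1 (lbm_mollifier k) (mollifier_bounded_support k)|exact: L1funZ].
- exact: L1funZ.
- move=> y; rewrite -mulrBl normrM [X in _ * X]ger0_norm ?mollifier_ge0//.
  have [->|/mollifier_support xy] := eqVneq (mollifier k (x - y)) 0; first by rewrite !mulr0.
  by rewrite ler_wpM2r ?mollifier_ge0// fe.
Qed.

Lemma convol_bounded f k x (C : R) : lbm f -> (forall y, `|f y| <= C) ->
  `|convol f (mollifier k) x| <= C.
Proof.
move=> lf fC; rewrite -[convol _ _ _]subr0; apply: convol_close => // y _.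
by rewrite subr0.
Qed.

Lemma cvg_harmonic_inv : k.+1%:R^-1 @[k --> \oo] --> (0 : R).
Proof. exact: cvg_harmonic. Qed.

Lemma convol_cvg f x : lbm f -> {for x, continuous f} ->
  convol f (mollifier k) x @[k --> \oo] --> f x.
Proof.
move=> lf cf; apply/cvgrPdist_le => e e0.
have /cvgrPdist_le/(_ e e0)/nbhs_ballP[d /= d0 fd] := cf.
near=> k; rewrite distrC; apply: convol_close => // y xy.
rewrite distrC; apply: fd; rewrite -ball_normE /=.
apply: lt_trans xy _; near: k.
have /cvgrPdist_lt/(_ d d0) := cvg_harmonic_inv; apply: filterS => k.
by rewrite sub0r normrN ger0_norm.
Unshelve. all: by end_near.
Qed.

Lemma convol_self_adjoint f g k : lbm f -> lbm g -> bounded_support g ->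
  \int[mu]_x (convol f (mollifier k) x * g x) = \int[mu]_x (f x * convol g (mollifier k) x).
Proof.
move=> lf lg bg; rewrite (convol_fubini lf lg bg (test_mollifier k)).
have E y : \int[mu]_x (g x * mollifier k (x - y)) = convol g (mollifier k) y.
  by apply: eq_RI => x; rewrite -[in RHS](opprB x y) mollifierN.
by apply: eq_RI => y; rewrite E.
Qed.

(** Against a test function, self-adjointness moves the mollification from [f], which is merely
    bounded, to the test function, where it converges pointwise under a dominating function.
    [weakly_null_L1] extends the result to every integrable [g]. *)
Lemma convol_weak f g (C : R) : measurable_fun setT f -> (forall x, `|f x| <= C) -> L1fun g ->
  \int[mu]_x (convol f (mollifier k) x * g x) @[k --> \oo] --> \int[mu]_x (f x * g x).
Proof.
move=> mf fC sg; have lf : lbm f by split=> // r; exists C.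
have lc k : lbm (convol f (mollifier k)) by apply: lbm_convol => //; exact: test_mollifier.
pose F k x := convol f (mollifier k) x - f x.
have mF k : measurable_fun setT (F k) by have [] := lbmB (lc k) lf.
have FC k x : `|F k x| <= C + C.
  by rewrite (le_trans (ler_normB _ _))// lerD// convol_bounded.
have sM (h : V -> R) : measurable_fun setT h -> (forall x, `|h x| <= C) -> L1fun (fun x => h x * g x).
  move=> mh hC; apply: (@L1fun_le _ _ _ (fun x => C * `|g x|)).
  - by apply: measurable_funM => //; exact: L1fun_measurable.
  - by apply: L1funZ; exact: L1fun_norm.
  - by move=> x; rewrite normrM ler_wpM2r.
have sc k : L1fun (fun x => convol f (mollifier k) x * g x).
  by apply: sM; [have [] := lc k|move=> x; exact: convol_bounded].
suff : weakly_null F g.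
  rewrite /weakly_null => h.
  rewrite -[X in _ --> X]add0r.
  rewrite (_ : (fun k => _) = fun k => \int[mu]_x (F k x * g x) + \int[mu]_x (f x * g x)).
    by apply: cvgD; [exact: h|exact: cvg_cst].
  apply/funext => k; under [X in _ = X + _]eq_RI do rewrite mulrBl.
  by rewrite RIB ?subrK//; exact: sM.
apply: (@weakly_null_L1 _ _ F (C + C) mF FC setT _ g (@openT _) sg) => [|x []//].
move=> zeta tz; have lz := test_lbm tz; have bz := test_bounded_support tz.
have [r r0 zr] := bounded_support_lt bz; have [c zc] := test_bounded tz.
have c0 : 0 <= c := le_trans (normr_ge0 _) (zc 0).
(* All mollifier radii are at most 1, so this ball contains the supports of all mollifications of
   [zeta]. *)
pose B := [set x : V | `|x| <= r + 1].
have sB : L1fun (\1_B : V -> R) by apply: L1fun_indic (fun x Bx => Bx); exact: measurable_norm_le.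
have C0 : 0 <= C := le_trans (normr_ge0 _) (fC 0).
have zB k x : `|convol zeta (mollifier k) x| <= c * \1_B x.
  rewrite indicE; case: (boolP (x \in B)) => [_|/negP xB]; rewrite ?mulr1 ?mulr0.
    exact: convol_bounded.
  rewrite -[convol _ _ _]subr0; apply: convol_close => // y xy.
  rewrite subr0 normr_le0; apply/eqP; apply: contrapT => /eqP /zr yr.
  apply: xB; rewrite inE /B /=; rewrite -[x](subrK y) addrC (le_trans (ler_normD _ _))// lerD//.
  by rewrite (le_trans (ltW xy))// invf_le1// ler1n.
have lcz k : lbm (convol zeta (mollifier k)) by apply: lbm_convol => //; exact: test_mollifier.
have szf k : L1fun (fun x => f x * convol zeta (mollifier k) x).
  apply: L1fun_lbm; first exact: lbmM.
  apply: bounded_supportMr; exists (r + 1) => x xz.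
  have := lt_le_trans _ (zB k x) => /(_ 0); rewrite normr_gt0 => /(_ xz); rewrite indicE; case: (boolP (x \in B)); first by rewrite inE.
  by rewrite mulr0 ltxx.
rewrite /weakly_null (_ : (fun k => _) = fun k => \int[mu]_x (f x * (convol zeta (mollifier k) x - zeta x))).
  have -> : (0 : R) = \int[mu]_x (cst 0 x) by rewrite Rintegral_cst// mul0r.
  apply: (RI_dominated (g := fun x => C * (c * \1_B x + `|zeta x|))).
  - by move=> k; have [] := lbmM lf (lbmB (lcz k) lz).
  - move=> x; rewrite -(mulr0 (f x)); apply: cvgMl_tmp.
    rewrite -(subrr (zeta x)); apply: cvgB; last exact: cvg_cst.
    by apply: convol_cvg => //; exact: test_continuous tz _.
  - apply: L1funZ; apply: L1funD; first exact: L1funZ.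
    by apply: L1fun_norm; exact: L1fun_lbm.
  - move=> k x; rewrite normrM ler_pM// (le_trans (ler_normB _ _))// lerD2r.
    exact: zB.
apply/funext => k; under [in RHS]eq_RI do rewrite mulrBr.
rewrite RIB//; last by apply: L1fun_lbm; [exact: lbmM|exact: bounded_supportMr].
rewrite -convol_self_adjoint// -RIB; last 2 first.
- by apply: L1fun_lbm; [exact: lbmM|exact: bounded_supportMr].
- by apply: L1fun_lbm; [exact: lbmM|exact: bounded_supportMr].
by apply: eq_RI => x; rewrite mulrBl.
Qed.

End mollification.

(** * Weak gradients and Lipschitz functions *)

Section euclidean.
Context {R : realType} {n : nat}.
Local Notation V := 'rV[R]_n.
Implicit Types x y z : V.

Lemma dotpC x y : dotp x y = dotp y x.
Proof. by apply: eq_bigr => i _; rewrite mulrC. Qed.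

Lemma dotpDl x y z : dotp (x + y) z = dotp x z + dotp y z.
Proof. by rewrite /dotp -big_split; apply: eq_bigr => i _; rewrite mxE mulrDl. Qed.

Lemma dotpZl (a : R) x y : dotp (a *: x) y = a * dotp x y.
Proof. by rewrite /dotp mulr_sumr; apply: eq_bigr => i _; rewrite mxE mulrA. Qed.

Lemma dotpNl x y : dotp (- x) y = - dotp x y.
Proof. by rewrite -scaleN1r dotpZl mulN1r. Qed.

Lemma dotpBl x y z : dotp (x - y) z = dotp x z - dotp y z.
Proof. by rewrite dotpDl dotpNl. Qed.

Lemma dotpDr x y z : dotp x (y + z) = dotp x y + dotp x z.
Proof. by rewrite dotpC dotpDl dotpC [dotp z x]dotpC. Qed.

Lemma dotpZr (a : R) x y : dotp x (a *: y) = a * dotp x y.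
Proof. by rewrite dotpC dotpZl dotpC. Qed.

Lemma dotpNr x y : dotp x (- y) = - dotp x y.
Proof. by rewrite dotpC dotpNl dotpC. Qed.

Lemma dotpBr x y z : dotp x (y - z) = dotp x y - dotp x z.
Proof. by rewrite dotpDr dotpNr. Qed.

Lemma dotp0l x : dotp 0 x = 0.
Proof. by rewrite /dotp big1// => i _; rewrite mxE mul0r. Qed.

Lemma dotp_ge0 x : 0 <= dotp x x.
Proof. by apply: sumr_ge0 => i _; rewrite -expr2 sqr_ge0. Qed.

Lemma enorm_ge0 x : 0 <= enorm x.
Proof. exact: sqrtr_ge0. Qed.

Lemma sqr_enorm x : enorm x ^+ 2 = dotp x x.
Proof. by rewrite sqr_sqrtr// dotp_ge0. Qed.

Lemma enormZ (a : R) x : enorm (a *: x) = `|a| * enorm x.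
Proof. by rewrite /enorm dotpZl dotpZr mulrA -expr2 sqrtrM ?sqr_ge0// sqrtr_sqr. Qed.

Lemma enormN x : enorm (- x) = enorm x.
Proof. by rewrite -scaleN1r enormZ normrN1 mul1r. Qed.

Lemma enormC x y : enorm (x - y) = enorm (y - x).
Proof. by rewrite -enormN opprB. Qed.

Lemma enorm0 : enorm (0 : V) = 0.
Proof. by rewrite /enorm dotp0l sqrtr0. Qed.

Lemma coord_le_enorm x i : `|x 0 i| <= enorm x.
Proof.
rewrite -sqrtr_sqr ler_wsqrtr// /dotp (bigD1 i)//= expr2 lerDl.
by apply: sumr_ge0 => j _; rewrite -expr2 sqr_ge0.
Qed.

Lemma norm_le_enorm x : `|x| <= enorm x.
Proof. by apply/norm_leP; [exact: enorm_ge0|exact: coord_le_enorm]. Qed.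

Lemma enorm_le_norm x : enorm x <= n%:R * `|x|.
Proof.
rewrite -[leRHS]ger0_norm; last by rewrite mulr_ge0.
rewrite -sqrtr_sqr ler_wsqrtr// exprMn.
apply: (@le_trans _ _ (\sum_(i < n) `|x| ^+ 2)).
  by apply: ler_sum => i _; rewrite -expr2 -real_normK ?num_real// lerXn2r ?nnegrE// coord_le_norm.
rewrite sumr_const card_ord -[leLHS]mulr_natl ler_wpM2r ?sqr_ge0//.
by rewrite -natrX ler_nat; case: n => // m; rewrite -mulnn leq_pmulr.
Qed.

Lemma enorm_eq0 x : (enorm x == 0) = (x == 0).
Proof.
apply/idP/eqP => [/eqP x0|->]; last by rewrite enorm0.
by apply/eqP; rewrite -normr_eq0 eq_le normr_ge0 andbT -x0 norm_le_enorm.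
Qed.

Lemma dotp_le x y : dotp x y <= enorm x * enorm y.
Proof.
have [->|y0] := eqVneq y 0; first by rewrite dotpC dotp0l enorm0 mulr0.
have ey : 0 < enorm y by rewrite lt_neqAle eq_sym enorm_eq0 y0 enorm_ge0.
have [->|x0] := eqVneq x 0; first by rewrite dotp0l enorm0 mul0r.
have ex : 0 < enorm x by rewrite lt_neqAle eq_sym enorm_eq0 x0 enorm_ge0.
have := dotp_ge0 (enorm y *: x - enorm x *: y).
rewrite !(dotpBl, dotpBr, dotpZl, dotpZr) -!sqr_enorm [dotp y x]dotpC => h.
have : 0 <= 2 * (enorm x * enorm y) * (enorm x * enorm y - dotp x y) by lra.
by rewrite pmulr_rge0 ?subr_ge0// !mulr_gt0.
Qed.

Lemma norm_dotp_le x y : `|dotp x y| <= enorm x * enorm y.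
Proof.
rewrite ler_norml dotp_le andbT lerNl -dotpNl.
by apply: (le_trans (dotp_le _ _)); rewrite enormN.
Qed.

Lemma enormD x y : enorm (x + y) <= enorm x + enorm y.
Proof.
rewrite -[leRHS]ger0_norm ?addr_ge0 ?enorm_ge0// -sqrtr_sqr ler_wsqrtr//.
rewrite sqrrD !sqr_enorm dotpDl !dotpDr [dotp y x]dotpC; have := dotp_le x y; lra.
Qed.

Lemma enormB_ge x y : enorm x - enorm y <= enorm (x - y).
Proof. by have := enormD (x - y) y; rewrite subrK lerBlDr. Qed.

Lemma enorm_le_dual x (K : R) : 0 <= K -> (forall y, dotp x y <= K * enorm y) -> enorm x <= K.
Proof.
move=> K0 xK; have [->|x0] := eqVneq x 0; first by rewrite enorm0.
have ex : 0 < enorm x by rewrite lt_neqAle eq_sym enorm_eq0 x0 enorm_ge0.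
by rewrite -(ler_pM2r ex); have := xK x; rewrite -sqr_enorm expr2.
Qed.

Lemma lipschitz_continuous_at (f : V -> R) (c r : R) x : 0 < r ->
  (forall y, `|x - y| < r -> `|f x - f y| <= c * `|x - y|) -> {for x, continuous f}.
Proof.
move=> r0 fc; apply/(@cvgrPdist_le _ _ _ (nbhs x) _ f (f x)) => e e0; apply/nbhs_ballP.
have c1 : 0 < `|c| + 1 by rewrite ltr_wpDl.
exists (Num.min r (e / (`|c| + 1))); first by rewrite /= lt_min r0 divr_gt0.
move=> y; rewrite -ball_normE /= lt_min => /andP[xyr]; rewrite ltr_pdivlMr// => xye.
apply: (le_trans (fc y xyr)); apply: le_trans (ltW xye).
by rewrite mulrC ler_wpM2l// (le_trans (ler_norm c))// lerDl.
Qed.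

Lemma continuous_enorm : continuous (@enorm R n).
Proof.
move=> x; apply: (@lipschitz_continuous_at _ n%:R 1) => // y _.
rewrite ler_norml; apply/andP; split.
  rewrite lerNl opprB; apply: le_trans (enormB_ge _ _) _.
  by rewrite enormC enorm_le_norm.
by apply: le_trans (enormB_ge _ _) _; exact: enorm_le_norm.
Qed.

End euclidean.

(** * Chaining local increments on the unit interval *)

Section line.
Context {R : realType}.

(** A continuous induction: the local bound looks forward only, and its range [d] depends on [t]
    without uniformity. The supremum of the times up to which the bound from 0 holds is itself such
    a time, by continuity, and would be exceeded if it were less than 1. *)
Lemma lipschitz_chaining (f : R -> R) (K : R) :
  (forall t, 0 <= t <= 1 -> {for t, continuous f}) ->
  (forall t, 0 <= t <= 1 -> exists2 d : R, 0 < d &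
     forall s, t <= s <= 1 -> s - t < d -> f s - f t <= K * (s - t)) ->
  f 1 - f 0 <= K.
Proof.
move=> cf fK.
pose E := [set t : R | 0 <= t <= 1 /\ f t - f 0 <= K * t].
have E0 : E 0 by split; [rewrite lexx ler01|rewrite subrr mulr0].
have uE : ubound E 1 by move=> t [/andP[]].
have sE : has_sup E by split; [exists 0|exists 1].
pose T := sup E.
have T0 : 0 <= T by apply: ub_le_sup => //; exists 1.
have T1 : T <= 1 by apply: ge_sup => //; exists 0.
have T01 : 0 <= T <= 1 by rewrite T0 T1.
have ET : f T - f 0 <= K * T.
  apply/ler_addgt0Pr => e e0.
  have [d /= d0 fd] : exists2 d : R, 0 < d & forall s, `|T - s| < d -> `|f T - f s| <= e / 2.
    have /cvgrPdist_le/(_ (e / 2)) := cf T T01; rewrite divr_gt0// => /(_ isT)/nbhs_ballP[d d0 h].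
    by exists d => // s sd; exact: h.
  (* Half of [e] is for the oscillation of [f] between [s] and [T], the other half for the change
     from [K * s] to [K * T]. *)
  pose d' := Num.min d (e / 2 / (`|K| + 1)).
  have d'0 : 0 < d' by rewrite lt_min d0/= !divr_gt0// ltr_wpDl.
  have [s [s01 Es] sT] := sup_adherent d'0 sE.
  have sleT : s <= T by apply: ub_le_sup; [exists 1|split].
  have Ts : T - s < d' by rewrite -/T in sT; lra.
  have := fd s; rewrite ger0_norm ?subr_ge0// (lt_le_trans Ts) ?ge_min ?lexx// => /(_ isT).
  rewrite ler_norml => /andP[_ h].
  have h2 : (`|K| + 1) * (T - s) <= e / 2.
    by rewrite mulrC -ler_pdivlMr ?ltr_wpDl// (le_trans (ltW Ts))// ge_min lexx orbT.
  have h3 : K * s <= K * T + `|K| * (T - s).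
    have : - K <= `|K| by rewrite -normrN ler_norm.
    by move=> /(ler_wpM2r (_ : 0 <= T - s)); rewrite subr_ge0 => /(_ sleT); lra.
  lra.
have [T1'|T1'] := ltP T 1; last first.
  have TE : T = 1 by apply/eqP; rewrite eq_le T1 T1'.
  by move: ET; rewrite TE mulr1.
have [d d0 fd] := fK T T01.
pose s := Num.min 1 (T + d / 2).
have sT : T < s by rewrite lt_min T1' /= ltrDl divr_gt0.
have s01 : 0 <= s <= 1 by rewrite (le_trans T0 (ltW sT)) ge_min lexx.
have : E s.
  split=> //; have := fd s; rewrite (ltW sT) ge_min lexx => /(_ isT).
  have -> : s - T < d.
    by rewrite ltrBlDl; apply: (@le_lt_trans _ _ (T + d / 2)); rewrite ?ge_min ?lexx ?orbT//; lra.
  by move=> /(_ isT); lra.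
move=> /(ub_le_sup (ex_intro _ 1 uE)); rewrite -/T leNgt sT; exact.
Qed.

End line.

Section weak_gradients.
Context {R : realType} {n : nat}.
Local Notation V := 'rV[R]_n.
Local Notation mu := (@lebesgue_rV R n).
Implicit Types (f g u v zeta : V -> R) (D : V -> V) (x y h : V) (Omega O : set V).

(* The integrals of [weak_gradient] run over [Omega], but test functions vanish
   elsewhere: see [weak_gradientP]. *)
Definition wgrad Omega u D := forall zeta, test_function Omega zeta -> forall i,
  \int[mu]_x (u x * partial i zeta x) = - \int[mu]_x (D x 0 i * zeta x).

Definition lbmv D := forall i, lbm (fun x => D x 0 i).

Lemma test_mollifier_ball k : test_function [set z : V | `|z| <= k.+1%:R^-1] (mollifier k).
Proof.
pose d : V := const_mx k.+1%:R^-1.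
apply: (@test_affine R n _ (closed_box (- d) d) _ _ 1 0 (oner_neq0 R)) => [|z zb].
  exact: test_box_bump.
apply/norm_leP => // i; have := zb i; rewrite !mxE => /andP[].
by rewrite add0r mul1r ler_norml => -> ->.
Qed.

(** The reflected mollifier centred at [x] is a test function of [O] as soon as its supporting ball
    lies in [O]. Inserted into the definition of the weak gradient it gives the formula; the
    reflection supplies the sign. *)
Lemma partial_convol_wgrad O u D k x i : lbm u -> lbmv D -> wgrad O u D ->
  (forall y, `|x - y| <= k.+1%:R^-1 -> O y) ->
  partial i (convol u (mollifier k)) x = convol (fun x => D x 0 i) (mollifier k) x.
Proof.
move=> lu lD wD xO; have tm := test_mollifier_ball k.
have tr : test_function O (fun y => 1 * mollifier k (x + (-1) *: y)).
  by apply: (@test_affine R n O _ _ 1 (-1) x _ tm) => [|y]; rewrite ?oppr_eq0 ?oner_neq0// scaleN1r; exact: xO.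
rewrite partial_convol//; last exact: test_mollifier.
have := wD _ tr i.
have -> : \int[mu]_y (u y * partial i (fun y => 1 * mollifier k (x + (-1) *: y)) y) =
    - \int[mu]_y (u y * partial i (mollifier k) (x - y)).
  have tp := @test_partial R n _ _ (test_mollifier k) i.
  rewrite -RIN; last first.
    by apply: convol_L1 => //; [exact: test_lbm tp|exact: test_bounded_support tp].
  apply: eq_RI => y; rewrite partial_affine; last exact: test_differentiable (test_mollifier k) _.
  by rewrite mul1r mulN1r scaleN1r mulrN.
move=> /oppr_inj; rewrite /convol => ->; apply: eq_RI => y.
by rewrite mul1r scaleN1r.
Qed.

(** Jensen's inequality for the Euclidean norm, by duality: each product with a fixed vector is an
    average of quantities at most [K] times its norm. *)
Lemma enorm_convol_le D k x (K : R) : lbmv D -> 0 <= K ->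
  (forall y, `|x - y| < k.+1%:R^-1 -> enorm (D y) <= K) ->
  enorm (\row_i convol (fun x => D x 0 i) (mollifier k) x) <= K.
Proof.
move=> lD K0 DK; apply: enorm_le_dual => // e.
have sD i : L1fun (fun y => D y 0 i * mollifier k (x - y)).
  by apply: convol_L1 => //; [exact: lbm_mollifier|exact: mollifier_bounded_support].
have -> : dotp (\row_i convol (fun x => D x 0 i) (mollifier k) x) e =
    \int[mu]_y (\sum_i e 0 i * (D y 0 i * mollifier k (x - y))).
  rewrite RIsum; last by move=> i; exact: L1funZ.
  by apply: eq_bigr => i _; rewrite mxE RIZ// mulrC.
have sm : L1fun (fun y => mollifier k (x - y)).
  apply: L1fun_lbm; first exact: lbm_reflection (lbm_mollifier k).
  exact: bounded_support_reflection (mollifier_bounded_support k).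
rewrite -[X in _ <= X]mulr1 -(RI_mollifier_reflection k x) -RIZ//.
apply: RI_le.
- by apply: L1fun_sum => i; exact: L1funZ.
- exact: L1funZ.
- move=> y; rewrite (_ : \sum_i _ = dotp (D y) e * mollifier k (x - y)); last first.
    by rewrite mulr_suml; apply: eq_bigr => i _; rewrite mulrCA mulrA mulrC -mulrA mulrC [_ * e 0 i]mulrC.
  have [->|/mollifier_support xy] := eqVneq (mollifier k (x - y)) 0; first by rewrite !mulr0.
  rewrite ler_wpM2r ?mollifier_ge0//.
  by rewrite (le_trans (dotp_le _ _))// ler_wpM2r ?enorm_ge0// DK.
Qed.

Lemma wgrad_ae O u D D' : lbmv D -> lbmv D' ->
  (\forall x \ae mu, O x -> D x = D' x) -> wgrad O u D -> wgrad O u D'.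
Proof.
move=> lD lD' DD' wD zeta tz i; rewrite wD//; congr (- _).
apply: RI_ae.
- by have [] := lbmM (lD i) (test_lbm tz).
- by have [] := lbmM (lD' i) (test_lbm tz).
- apply: filterS DD' => x h; have [/h -> //|Ox] := pselect (O x).
  by rewrite (test_eq0 tz Ox) !mulr0.
Qed.

Lemma measurable_dotp D D' : (forall i, measurable_fun setT (fun x => D x 0 i)) ->
  (forall i, measurable_fun setT (fun x => D' x 0 i)) ->
  measurable_fun setT (fun x => dotp (D x) (D' x)).
Proof. by move=> mD mD'; apply: measurable_sum => i; exact: measurable_funM. Qed.

Lemma measurable_enorm D : (forall i, measurable_fun setT (fun x => D x 0 i)) ->
  measurable_fun setT (fun x => enorm (D x)).
Proof.
move=> mD; apply: (measurableT_comp (f := @Num.sqrt R)); last exact: measurable_dotp.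
by apply: continuous_measurable_fun; exact: sqrt_continuous.
Qed.

Lemma measurable_enorm_le D (K : R) : (forall i, measurable_fun setT (fun x => D x 0 i)) ->
  measurable [set x | enorm (D x) <= K].
Proof.
move=> /measurable_enorm mD; rewrite -[X in measurable X]setTI.
rewrite (_ : [set x | _] = (fun x => enorm (D x)) @^-1` `]-oo, K]); last first.
  by apply/seteqP; split=> x; rewrite /= in_itv.
exact: mD.
Qed.

(** The mean value theorem applies to the mollification, whose gradient averages [D]. A point
    between [y] and [z] is within [r] of [x], and the mollifier reaches less than [r] further, which
    explains the ball of radius [2 * r]. The bound is uniform in [k]. *)
Lemma wgrad_lipschitz_ball O u D (K r : R) x : lbm u -> lbmv D -> wgrad O u D ->
  0 <= K -> (\forall x \ae mu, O x -> enorm (D x) <= K) ->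
  0 < r -> (forall y, `|x - y| < 2 * r -> O y) ->
  forall k, k.+1%:R^-1 < r -> forall y z, `|x - y| < r -> `|x - z| < r ->
  `|convol u (mollifier k) z - convol u (mollifier k) y| <= K * enorm (z - y).
Proof.
move=> lu lD wD K0 DK r0 xO k kr y z xy xz.
(* Averaging needs the bound at every point, so [D] is set to 0 where it exceeds [K]; inside [O]
   this changes it on a null set only. *)
pose A := [set x | enorm (D x) <= K].
have mA : measurable A by apply: measurable_enorm_le => i; have [] := lD i.
pose D' x := \1_A x *: D x.
have lD' : lbmv D'.
  move=> i; rewrite (_ : (fun _ => _) = fun x => \1_A x * D x 0 i).
    by apply: lbmM => //; exact: lbm_indic.
  by apply/funext => w; rewrite mxE.
have D'K w : enorm (D' w) <= K.
  rewrite /D' indicE; case: (boolP (w \in A)) => [|_]; last by rewrite scale0r enorm0.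
  by rewrite inE /A /= scale1r.
have wD' : wgrad O u D'.
  apply: wgrad_ae wD => //; apply: filterS DK => w h /h wA.
  by rewrite /D' indicE mem_set// scale1r.
have [w|c /andP[c0 c1] E] := @line_mvt R n (convol u (mollifier k)) y (z - y).
  by move=> _; have [] := convol_differentiable (y + w *: (z - y)) lu (test_mollifier k).
have {E} : convol u (mollifier k) z - convol u (mollifier k) y =
    dotp (z - y) (\row_i convol (fun x => D' x 0 i) (mollifier k) (y + c *: (z - y))).
  rewrite -[in LHS](subrK y z) [z - y + y]addrC E; apply: eq_bigr => i _.
  rewrite mxE (partial_convol_wgrad _ _ _ wD')// => w ww; apply: xO.
  have h : `|x - (y + c *: (z - y))| < r.
    rewrite (_ : x - _ = (1 - c) *: (x - y) + c *: (x - z)).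
      apply: (le_lt_trans (ler_normD _ _)); rewrite !normrZ !ger0_norm ?subr_ge0//.
      have [->|c0'] := eqVneq c 0; first by rewrite subr0 mul1r mul0r addr0.
      have cp : 0 < c by rewrite lt_neqAle eq_sym c0'.
      rewrite [ltRHS](_ : r = (1 - c) * r + c * r); last by rewrite -mulrDl subrK mul1r.
      by rewrite ler_ltD ?ltr_pM2l// ler_wpM2l ?subr_ge0// ltW.
    by apply/rowP => i'; rewrite !mxE; ring.
  rewrite -[x - w](subrKA (y + c *: (z - y))).
  by rewrite (le_lt_trans (ler_normD _ _))// mulr_natl mulr2n ltrD// (le_lt_trans ww).
move=> ->; apply: (le_trans (norm_dotp_le _ _)); rewrite mulrC ler_wpM2r ?enorm_ge0//.
by apply: enorm_convol_le.
Qed.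

Lemma nbhs_norm_ball O x : open O -> O x ->
  exists2 r : R, 0 < r & forall y, `|x - y| < 2 * r -> O y.
Proof.
move=> oO Ox; have /nbhs_ballP[e /= e0 xeO] : nbhs x O by exact: open_nbhs_nbhs.
exists (e / 2) => [|y xy]; first by rewrite divr_gt0.
by apply: xeO; rewrite -ball_normE /=; lra.
Qed.

Lemma cvg_harmonic_lt (r : R) : 0 < r -> \forall k \near \oo, k.+1%:R^-1 < r.
Proof.
move=> r0; have /cvgrPdist_lt/(_ r r0) := @cvg_harmonic_inv R; apply: filterS => k.
by rewrite sub0r normrN ger0_norm.
Qed.

Lemma wgrad_lipschitz_local O u D (K : R) x : open O -> lbm u -> lbmv D -> wgrad O u D ->
  0 <= K -> (\forall x \ae mu, O x -> enorm (D x) <= K) ->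
  (forall y, O y -> {for y, continuous u}) -> O x ->
  exists2 r : R, 0 < r & forall y z, `|x - y| < r -> `|x - z| < r ->
    `|u z - u y| <= K * enorm (z - y).
Proof.
move=> oO lu lD wD K0 DK cu Ox; have [r r0 xO] := nbhs_norm_ball oO Ox.
exists r => // y z xy xz.
have r2 : r < 2 * r by rewrite mulr_natl mulr2n ltrDl.
have Oy : O y by apply: xO; exact: lt_trans r2.
have Oz : O z by apply: xO; exact: lt_trans r2.
have h : `|convol u (mollifier k) z - convol u (mollifier k) y| @[k --> \oo] --> `|u z - u y|.
  by apply: cvg_norm; apply: cvgB; apply: convol_cvg => //; exact: cu.
apply: (ler_cvg_to h (cvg_cst (K * enorm (z - y)))).
near=> k; apply: (wgrad_lipschitz_ball lu lD wD K0 DK r0 xO) => //.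
by near: k; exact: cvg_harmonic_lt.
Unshelve. all: by end_near.
Qed.

Definition segment_in O x y := forall t : R, 0 <= t <= 1 -> O (x + t *: (y - x)).

(** [O] need not be convex: the local estimates in small balls are chained along the one segment
    that is assumed to stay inside, without loss in the constant. *)
Lemma wgrad_lipschitz O u D (K : R) x y : open O -> lbm u -> lbmv D -> wgrad O u D ->
  0 <= K -> (\forall x \ae mu, O x -> enorm (D x) <= K) ->
  (forall y, O y -> {for y, continuous u}) -> segment_in O x y ->
  u y - u x <= K * enorm (y - x).
Proof.
move=> oO lu lD wD K0 DK cu sO.
pose p (t : R) := x + t *: (y - x).
have cp : continuous p.
  move=> t; apply: (@cvgD R V); first exact: cvg_cst.
  by apply: (@cvgZr_tmp R V); exact: cvg_id.
have := @lipschitz_chaining R (u \o p) (K * enorm (y - x)).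
rewrite /p /= scale1r scale0r addr0 [x + _]addrC subrK => h; apply: h.
  move=> t t01; apply: continuous_comp; first exact: cp.
  by apply: cu; exact: sO.
move=> t t01; have [r r0 ur] := wgrad_lipschitz_local oO lu lD wD K0 DK cu (sO t t01).
have d0 : 0 < r / (`|y - x| + 1) by rewrite divr_gt0// ltr_wpDl.
exists (r / (`|y - x| + 1)) => // s /andP[ts _] st.
apply: (le_trans (ler_norm _)).
have E : p s - p t = (s - t) *: (y - x) by rewrite /p scalerBl opprD addrACA subrr add0r.
apply: (le_trans (ur (p t) (p s) _ _)).
- by rewrite subrr normr0.
- rewrite -normrN opprB E normrZ ger0_norm ?subr_ge0//; move: st; rewrite ltr_pdivlMr ?ltr_wpDl//.
  by apply: le_lt_trans; rewrite ler_wpM2l ?subr_ge0// lerDl.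
- by rewrite E enormZ ger0_norm ?subr_ge0// mulrA mulrAC.
Qed.

End weak_gradients.

(** * Weak gradients and local Lipschitz constants *)

Section lipschitz.
Context {R : realType} {n : nat}.
Local Notation V := 'rV[R]_n.
Local Notation mu := (@lebesgue_rV R n).
Implicit Types (f g u v zeta : V -> R) (D : V -> V) (x y h : V) (Omega O : set V).

(** The representative is the pointwise limit of the mollifications. That they converge at every
    point of [Omega] follows from their common local Lipschitz constant together with weak
    convergence; the limit inherits the constant. *)
Lemma wgrad_continuous_representative Omega u D (C K : R) : open Omega ->
  measurable_fun setT u -> (forall x, `|u x| <= C) -> lbmv D -> wgrad Omega u D ->
  0 <= K -> (\forall x \ae mu, Omega x -> enorm (D x) <= K) ->
  exists v, [/\ measurable_fun setT v, forall x, `|v x| <= C,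
    forall x, ~ Omega x -> v x = 0,
    forall x, Omega x -> exists2 r : R, 0 < r & forall y z, `|x - y| < r -> `|x - z| < r ->
      `|v z - v y| <= K * enorm (z - y)
    & \forall x \ae mu, Omega x -> u x = v x].
Proof.
move=> oO mu_ uC lD wD K0 DK.
have lu : lbm u by split=> // r; exists C.
have C0 : 0 <= C := le_trans (normr_ge0 _) (uC 0).
pose U k := convol u (mollifier k).
have lU k : lbm (U k) by apply: lbm_convol => //; exact: test_mollifier.
have UC k x : `|U k x| <= C by exact: convol_bounded.
have Ulip x : Omega x -> exists2 r : R, 0 < r & (forall y, `|x - y| < r -> Omega y) /\
    forall k, k.+1%:R^-1 < r -> forall y z, `|x - y| < r -> `|x - z| < r ->
    `|U k z - U k y| <= K * enorm (z - y).
  move=> Ox; have [r r0 xO] := nbhs_norm_ball oO Ox; exists r => //; split.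
    by move=> y xy; apply: xO; rewrite (lt_trans xy)// mulr_natl mulr2n ltrDl.
  exact: (wgrad_lipschitz_ball lu lD wD K0 DK r0 xO).
have Ucvg x : Omega x -> cvgn (U ^~ x).
  move=> Ox; have [r r0 [_ Ur]] := Ulip x Ox.
  apply/cauchy_cvgP/cauchy_ballP => e e0.
  (* At scale [d] an equi-Lipschitz function differs from its average by at most e/4. The factor
     [n%:R] passes from the sup norm of the mollifier's support to the Euclidean norm. *)
  pose d := Num.min r (e / 4 / (K * n%:R + 1)).
  have K1 : 0 < K * n%:R + 1 by rewrite ltr_wpDl// mulr_ge0.
  have d0 : 0 < d by rewrite lt_min r0 !divr_gt0.
  have [m _ /(_ m (leqnn m)) /= md] := cvg_harmonic_lt d0.
  have mr : m.+1%:R^-1 < r by apply: lt_le_trans md _; rewrite ge_min lexx.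
  have close k : k.+1%:R^-1 < r -> `|convol (U k) (mollifier m) x - U k x| <= e / 4.
    move=> kr; apply: convol_close => // y xy.
    apply: (le_trans (Ur k kr x y _ _)); first by rewrite subrr normr0.
      exact: lt_trans xy mr.
    apply: (@le_trans _ _ (K * n%:R * `|x - y|)).
      by rewrite -mulrA ler_wpM2l// enormC enorm_le_norm.
    have : `|x - y| <= e / 4 / (K * n%:R + 1).
      by rewrite (le_trans (ltW xy))// (le_trans (ltW md))// ge_min lexx orbT.
    rewrite ler_pdivlMr//; apply: le_trans.
    by rewrite mulrC ler_wpM2l// lerDl.
  (* Mollifying once more at the fixed scale [m] turns weak convergence of [U k] into convergence of
     numbers, while equi-continuity keeps [U k x] near that average. Hence the sequence is
     Cauchy. *)
  have wk : convol (U k) (mollifier m) x @[k --> \oo] --> U m x.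
    apply: (convol_weak (C := C)) => //; apply: L1fun_lbm.
      exact: lbm_reflection (lbm_mollifier m).
    exact: bounded_support_reflection (mollifier_bounded_support m).
  have near_m : \forall k \near \oo, `|U m x - U k x| < e / 2.
    near=> k; rewrite -(subrKA (convol (U k) (mollifier m) x)).
    apply: (le_lt_trans (ler_normD _ _)).
    have -> : e / 2 = e / 4 + e / 4 by field.
    rewrite ltr_leD//.
      near: k; have /cvgrPdist_lt/(_ (e / 4)) := wk; apply.
      by rewrite divr_gt0.
    by apply: close; near: k; exact: cvg_harmonic_lt.
  exists (ball (U m x) (e / 2), ball (U m x) (e / 2)) => /=.
    by split; exact: near_m.
  move=> [a b] /= [] /= ha hb; rewrite /ball /= in ha hb *.
  rewrite -(subrKA (U m x)) (le_lt_trans (ler_normD _ _))// (splitr e) ltrD//.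
  by rewrite distrC.
pose v x := if pselect (Omega x) then lim (U k x @[k --> \oo]) else 0.
have vE x : Omega x -> U k x @[k --> \oo] --> v x.
  move=> Ox; have -> : v x = lim (U k x @[k --> \oo]) by rewrite /v; case: pselect.
  exact: Ucvg.
have v0 x : ~ Omega x -> v x = 0 by rewrite /v; case: pselect.
have vC x : `|v x| <= C.
  have [Ox|Ox] := pselect (Omega x); last by rewrite v0// normr0.
  apply: (ler_cvg_to (cvg_norm (vE x Ox)) (cvg_cst C)).
  by apply: nearW => k; exact: UC.
have mv : measurable_fun setT v.
  apply: (@measurable_fun_cvg _ _ _ setT (fun k x => \1_Omega x * U k x)).
    move=> k; apply: measurable_funM; last by have [] := lU k.
    by apply: measurable_indic; exact: open_measurable_rV.
  move=> x _; have [Ox|Ox] := pselect (Omega x).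
    by rewrite indicE mem_set//; under eq_cvg do rewrite mul1r; exact: vE.
  by rewrite indicE memNset// v0//; under eq_cvg do rewrite mul0r; exact: cvg_cst.
exists v; split=> //.
  move=> x Ox; have [r r0 [rO Ur]] := Ulip x Ox; exists r => // y z xy xz.
  have h : `|U k z - U k y| @[k --> \oo] --> `|v z - v y|.
    by apply: cvg_norm; apply: cvgB; apply: vE; exact: rO.
  apply: (ler_cvg_to h (cvg_cst (K * enorm (z - y)))).
  by near=> k; apply: Ur => //; near: k; exact: cvg_harmonic_lt.
(* Against a test function the mollifications converge both to [u], weakly, and to [v], by dominated
   convergence; the fundamental lemma compares the limits. *)
have : \forall x \ae mu, Omega x -> u x - v x = 0.
  apply: (@fundamental_lemma R n Omega _ (C + C) oO).
  - exact: measurable_funB.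
  - by move=> x; rewrite (le_trans (ler_normB _ _))// lerD.
  move=> zeta tz; have lz := test_lbm tz; have bz := test_bounded_support tz.
  have sz : L1fun zeta by exact: L1fun_lbm.
  have lv : lbm v by split=> // r; exists C.
  have h1 : \int[mu]_x (U k x * zeta x) @[k --> \oo] --> \int[mu]_x (u x * zeta x).
    exact: (convol_weak (C := C)).
  have h2 : \int[mu]_x (U k x * zeta x) @[k --> \oo] --> \int[mu]_x (v x * zeta x).
    apply: (RI_dominated (g := fun x => C * `|zeta x|)).
    - by move=> k; have [] := lbmM (lU k) lz.
    - move=> x; have [Ox|Ox] := pselect (Omega x); first by apply: cvgMr_tmp; exact: vE.
      rewrite (test_eq0 tz Ox) mulr0; under eq_cvg do rewrite mulr0; exact: cvg_cst.
    - by apply: L1funZ; exact: L1fun_norm.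
    - by move=> k x; rewrite normrM ler_wpM2r.
  under eq_RI do rewrite mulrBl; rewrite RIB; last 2 first.
  - by apply: (test_L1fun tz).
  - by apply: (test_L1fun tz).
  by rewrite (cvg_unique _ h1 h2)// subrr.
by apply: filterS => x h /h /eqP; rewrite subr_eq0 => /eqP.
Unshelve. all: by end_near.
Qed.

Lemma is_derive_le (g : R -> R) (d L e : R) : is_derive (0 : R) 1 g d -> 0 < e ->
  (forall t : R, 0 < t < e -> g t - g 0 <= L * t) -> d <= L.
Proof.
move=> dg e0 gL; have [cg <-] := dg; apply/ler_addgt0Pr => a a0.
have : (fun h : R => h^-1 *: ((g \o shift 0) (h *: 1) - g 0)) @ 0^' --> 'D_1 g 0 by exact: cg.
move=> /cvgrPdist_le/(_ a a0); move=> [r /= r0 h].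
pose t := Num.min (r / 2) (e / 2).
have t0 : 0 < t by rewrite lt_min !divr_gt0.
have tr : t < r by rewrite (@le_lt_trans _ _ (r / 2)) ?ge_min ?lexx//; lra.
have te : t < e by rewrite (@le_lt_trans _ _ (e / 2)) ?ge_min ?lexx ?orbT//; lra.
have := h t; rewrite /= sub0r normrN gtr0_norm// gt_eqF// => /(_ tr isT).
rewrite addr0 [t *: 1]mulr1 ler_norml => /andP[_].
rewrite lerBlDr => /le_trans; apply; rewrite addrC lerD2r.
by rewrite [_ *: _]/(_ * _) ler_pdivrMl// mulrC gL// t0.
Qed.

(** A difference quotient of the mollification is an average of difference quotients of [u], each
    controlled by the Lipschitz constant. The radius is split evenly between the mollifier and the
    increment [t *: e]. *)
Lemma enorm_convol_lipschitz O u D (K r : R) x k : lbm u -> lbmv D -> wgrad O u D -> 0 <= K ->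
  0 < r -> (forall y, `|x - y| < r -> O y) ->
  (forall y z, `|x - y| < r -> `|x - z| < r -> `|u z - u y| <= K * enorm (z - y)) ->
  k.+1%:R^-1 < r / 2 ->
  enorm (\row_i convol (fun x => D x 0 i) (mollifier k) x) <= K.
Proof.
move=> lu lD wD K0 r0 rO uK kr; apply: enorm_le_dual => // e.
have r2 : r / 2 < r by lra.
have -> : dotp (\row_i convol (fun x => D x 0 i) (mollifier k) x) e =
    \sum_i e 0 i * partial i (convol u (mollifier k)) (x + (0 : R) *: e).
  apply: eq_bigr => i _; rewrite mxE scale0r addr0 mulrC (partial_convol_wgrad _ lu lD wD)//.
  by move=> y xy; apply: rO; apply: le_lt_trans xy _; exact: lt_trans kr r2.
have tm := @test_mollifier R n k.
have d0 : 0 < r / 2 / (`|e| + 1) by rewrite !divr_gt0// ltr_wpDl.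
apply: (is_derive_le (is_derive_line _) d0).
  by have [] := convol_differentiable (x + (0 : R) *: e) lu tm.
move=> t /andP[t0 te]; rewrite scale0r addr0 !(convolE _ lu (lbm_mollifier k)).
have sc y : L1fun (fun z => u (y - z) * mollifier k z).
  apply: L1fun_lbm; first by apply: lbmM; [exact: lbm_reflection|exact: lbm_mollifier].
  by apply: bounded_supportMr; exact: mollifier_bounded_support.
rewrite -RIB// -[X in _ <= X]mulr1 -(@RI_mollifier R n k) -RIZ; last exact: L1fun_mollifier.
apply: RI_le.
- exact: L1funB.
- by apply: L1funZ; exact: L1fun_mollifier.
move=> z; rewrite -mulrBl.
have [->|/mollifier_support zk] := eqVneq (mollifier k z) 0; first by rewrite !mulr0.
rewrite ler_wpM2r ?mollifier_ge0// (le_trans (ler_norm _))//.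
have zr : `|z| < r / 2 := lt_trans zk kr.
apply: (le_trans (uK _ _ _ _)).
- by rewrite opprB addrC subrK (lt_trans zr).
- rewrite (_ : x - _ = z - t *: e); last by apply/rowP => j; rewrite !mxE; ring.
  apply: (le_lt_trans (ler_normB _ _)); rewrite (splitr r) ltrD// normrZ gtr0_norm//.
  move: te; rewrite ltr_pdivlMr ?ltr_wpDl//; apply: le_lt_trans.
  by rewrite ler_wpM2l ?lerDl// ltW.
- rewrite (_ : _ - _ = t *: e); last by apply/rowP => j; rewrite !mxE; ring.
  by rewrite enormZ gtr0_norm// mulrA mulrAC.
Qed.

(** On a bounded piece [A] of the set |D| > K, the mollified gradients converge weakly to [D] and
    are eventually at most [K] in norm at each point. Tested against [D] itself on [A], this makes
    the integral of |D|^2 at most that of K |D|, so [A] is null. *)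
Lemma lipschitz_wgrad_le O u D (K C : R) : open O -> lbm u -> lbmv D ->
  (forall i x, `|D x 0 i| <= C) -> wgrad O u D -> 0 <= K ->
  (forall x, O x -> exists2 r : R, 0 < r & (forall y, `|x - y| < r -> O y) /\
    (forall y z, `|x - y| < r -> `|x - z| < r -> `|u z - u y| <= K * enorm (z - y))) ->
  \forall x \ae mu, O x -> enorm (D x) <= K.
Proof.
move=> oO lu lD DC wD K0 uK.
have mD i : measurable_fun setT (fun x => D x 0 i) by have [] := lD i.
suff h (m : nat) : \forall x \ae mu, O x -> `|x| <= m%:R -> enorm (D x) <= K.
  have : \forall x \ae mu, forall m : nat, O x -> `|x| <= m%:R -> enorm (D x) <= K.
    exact: ae_foralln.
  apply: filterS => x hx Ox; apply: (hx (Num.truncn `|x|).+1 Ox).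
  by rewrite ltW// truncnS_gt.
pose A := O `&` [set x | `|x| <= m%:R] `&` ~` [set x | enorm (D x) <= K].
have mA : measurable A.
  apply: measurableI; last by apply: measurableC; exact: measurable_enorm_le.
  by apply: measurableI; [exact: open_measurable_rV|exact: measurable_norm_le].
have bA : bounded_support (\1_A : V -> R) by apply: (bounded_support_indic (r := m%:R)) => x [[]].
have lA : lbm (\1_A : V -> R) by exact: lbm_indic.
have lE : lbm (fun x => enorm (D x)).
  split; first exact: measurable_enorm.
  move=> r; exists (n%:R * `|C|) => x _; rewrite ger0_norm ?enorm_ge0//.
  rewrite (le_trans (enorm_le_norm _))// ler_wpM2l//; apply/norm_leP => // i.
  by rewrite (le_trans (DC i x))// ler_norm.
pose W k x : V := \row_i convol (fun x => D x 0 i) (mollifier k) x.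
pose s k x := dotp (W k x) (D x) * \1_A x.
have sE k x : s k x = \sum_i convol (fun x => D x 0 i) (mollifier k) x * (D x 0 i * \1_A x).
  by rewrite /s mulr_suml; apply: eq_bigr => i _; rewrite mxE mulrA.
have lDA i : lbm (fun x => D x 0 i * \1_A x) by exact: lbmM.
have bDA i : bounded_support (fun x => D x 0 i * \1_A x) by exact: bounded_supportMr.
have sDA i : L1fun (fun x => D x 0 i * \1_A x) by exact: L1fun_lbm.
have lW k i : lbm (fun x => convol (fun x => D x 0 i) (mollifier k) x).
  by apply: lbm_convol => //; exact: test_mollifier.
have ls k : lbm (s k).
  rewrite (_ : s k = fun x => \sum_i convol (fun x => D x 0 i) (mollifier k) x * (D x 0 i * \1_A x)).
    by apply: lbm_sum => i; exact: lbmM.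
  exact/funext/sE.
have bs k : bounded_support (s k) by exact: bounded_supportMr.
have cvs : \int[mu]_x s k x @[k --> \oo] --> \int[mu]_x (dotp (D x) (D x) * \1_A x).
  rewrite (_ : \int[mu]_x _ = \sum_i \int[mu]_x (D x 0 i * (D x 0 i * \1_A x))); last first.
    rewrite -RIsum => [|i]; last by apply: L1fun_lbm; [exact: lbmM|exact: bounded_supportMr].
    by apply: eq_RI => x; rewrite mulr_suml; apply: eq_bigr => i _; rewrite mulrA.
  rewrite (_ : (fun k => _) = fun k => \sum_i \int[mu]_x
      (convol (fun x => D x 0 i) (mollifier k) x * (D x 0 i * \1_A x))); last first.
    apply/funext => k; rewrite -RIsum => [|i]; last first.
      by apply: L1fun_lbm; [exact: lbmM|exact: bounded_supportMr].
    by apply: eq_RI => x; exact: sE.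
  by apply: cvg_sumr => i; apply: (convol_weak (C := C)).
pose q x := K * enorm (D x) * \1_A x.
have lq : lbm q by apply: lbmM => //; apply: lbmZ.
have bq : bounded_support q by exact: bounded_supportMr.
(* The index from which the bound holds depends on the point, so the excess over [q] is removed by
   dominated convergence: at each point it is eventually 0. *)
pose p k x := Num.max (s k x - q x) 0.
have sW k x : `|s k x| <= n%:R * `|C| * (n%:R * `|C|) * \1_A x.
  rewrite normrM [X in _ * X]ger0_norm ?indic_ge0// ler_wpM2r ?indic_ge0//.
  apply: (le_trans (norm_dotp_le _ _)); rewrite ler_pM ?enorm_ge0//.
    rewrite (le_trans (enorm_le_norm _))// ler_wpM2l//; apply/norm_leP => // i; rewrite mxE.
    by apply: convol_bounded => // y; rewrite (le_trans (DC i y))// ler_norm.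
  rewrite (le_trans (enorm_le_norm _))// ler_wpM2l//; apply/norm_leP => // i.
  by rewrite (le_trans (DC i x))// ler_norm.
have mp k : measurable_fun setT (p k).
  by apply: measurable_maxr => //; have [] := lbmB (ls k) lq.
have cvp : \int[mu]_x p k x @[k --> \oo] --> (0 : R).
  have -> : (0 : R) = \int[mu]_x (cst 0 x) by rewrite Rintegral_cst// mul0r.
  apply: (RI_dominated (g := fun x => n%:R * `|C| * (n%:R * `|C|) * \1_A x + `|q x|)) => //.
  - move=> x; have [xA|xA] := boolP (x \in A); last first.
      rewrite (_ : p ^~ x = cst 0); first exact: cvg_cst.
      by apply/funext => k; rewrite /p /s /q indicE (negbTE xA) !mulr0 subrr maxxx.
    move: (xA); rewrite inE => -[[Ox _] _]; have [r r0 [rO ur]] := uK x Ox.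
    have r20 : 0 < r / 2 by rewrite divr_gt0.
    apply: cvg_near_cst; near=> k.
    apply/eqP; rewrite /p eq_le le_max lexx orbT ge_max lexx !andbT subr_le0 /s /q.
    rewrite ler_wpM2r ?indic_ge0// (le_trans (dotp_le _ _))// ler_wpM2r ?enorm_ge0//.
    apply: (enorm_convol_lipschitz lu lD wD K0 r0 rO ur).
    by near: k; exact: cvg_harmonic_lt.
  - apply: L1funD; first by apply: L1funZ; exact: L1fun_lbm.
    by apply: L1fun_norm; exact: L1fun_lbm.
  - move=> k x; rewrite ger0_norm ?le_max ?lexx ?orbT// ge_max; apply/andP; split.
      rewrite (le_trans (ler_norm _))// (le_trans (ler_normB _ _))// lerD2r.
      exact: sW.
    by rewrite addr_ge0// ?mulr_ge0 ?indic_ge0.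
have le1 : \int[mu]_x (dotp (D x) (D x) * \1_A x) <= \int[mu]_x q x.
  have cvpq : \int[mu]_x p k x + \int[mu]_x q x @[k --> \oo] --> \int[mu]_x q x.
    by rewrite -[X in _ --> X]add0r; apply: cvgD => //; exact: cvg_cst.
  apply: (ler_cvg_to cvs cvpq); near=> k.
  have sp : L1fun (p k).
    apply: (@L1fun_le _ _ _ (fun x => `|s k x - q x|)) => //.
      by apply: L1fun_norm; apply: L1funB; exact: L1fun_lbm.
    by move=> x; rewrite ger0_norm ?le_max ?lexx ?orbT// ge_max ler_norm normr_ge0.
  rewrite -RID//; last exact: L1fun_lbm.
  apply: RI_le; first exact: L1fun_lbm.
    by apply: L1funD => //; exact: L1fun_lbm.
  by move=> x; rewrite -lerBlDr le_max lexx.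
pose F x := (dotp (D x) (D x) - K * enorm (D x)) * \1_A x.
have lF : lbm F.
  by apply: lbmM => //; apply: lbmB; [apply: lbm_sum => i; exact: lbmM|exact: lbmZ].
have FA x : A x -> 0 < dotp (D x) (D x) - K * enorm (D x).
  move=> [_ /negP]; rewrite -ltNge => KD; rewrite -sqr_enorm expr2 -mulrBl.
  by rewrite mulr_gt0 ?subr_gt0// (le_lt_trans K0).
have F0 x : 0 <= F x.
  rewrite /F indicE; case: (boolP (x \in A)) => [|_]; last by rewrite mulr0.
  by rewrite inE => /FA h; rewrite mulr1 ltW.
have sF : L1fun F by apply: L1fun_lbm => //; exact: bounded_supportMr.
have : \int[mu]_x F x = 0.
  apply/eqP; rewrite eq_le RI_ge0// andbT.
  rewrite (_ : \int[mu]_x F x = \int[mu]_x (dotp (D x) (D x) * \1_A x) - \int[mu]_x q x).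
    by rewrite subr_le0.
  rewrite -RIB; last exact: L1fun_lbm.
    by apply: eq_RI => x; rewrite -mulrBl.
  apply: L1fun_lbm; last exact: bounded_supportMr.
  by apply: lbmM => //; apply: lbm_sum => i; exact: lbmM.
move=> /(RI_eq0_ae sF F0); apply: filterS => x Fx Ox xm.
rewrite leNgt; apply/negP => KD.
have Ax : A x by split=> //; apply/negP; rewrite -ltNge.
by have := FA x Ax; move: Fx; rewrite /F indicE mem_set// mulr1 => ->; rewrite ltxx.
Unshelve. all: by end_near.
Qed.

End lipschitz.

(** * Lipschitz functions with compact support *)

Section truncation.
Context {R : realType} {n : nat}.
Local Notation V := 'rV[R]_n.
Local Notation mu := (@lebesgue_rV R n).
Implicit Types (f g u v phi zeta : V -> R) (D : V -> V) (x y h : V) (Omega O : set V).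

Lemma RI_test Omega f zeta : test_function Omega zeta ->
  \int[mu]_(x in Omega) (f x * zeta x) = \int[mu]_x (f x * zeta x).
Proof.
move=> tz; rewrite RI_mkcond; apply: eq_RI => x.
have [Ox|Ox] := pselect (Omega x); first by rewrite indicE mem_set// mul1r.
by rewrite (test_eq0 tz Ox) !mulr0.
Qed.

Lemma weak_gradientP Omega u D : weak_gradient Omega u D <-> wgrad Omega u D.
Proof.
split=> wD zeta tz i; have := wD zeta tz i.
  by rewrite (RI_test _ (test_partial tz i)) (RI_test (fun x => D x 0 i) tz).
by rewrite (RI_test _ (test_partial tz i)) (RI_test (fun x => D x 0 i) tz).
Qed.

Lemma lebesgue_setT_gt0 : (0 < mu [set: V])%E.
Proof. by apply: lebesgue_open_gt0; [exact: openT|exists 0]. Qed.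

(** The norm with exponent infinity unfolds to an essential supremum once the whole space is known
    to have positive measure. *)
Lemma Linfty_normE (A : set V) f :
  Linfty_norm A f = ess_sup mu (fun x => `|(f \_ A) x|%:E)%E.
Proof. by rewrite /Linfty_norm unlock /= lebesgue_setT_gt0. Qed.

Lemma Linfty_norm_ae (A : set V) f :
  \forall x \ae mu, A x -> (`|f x|%:E <= Linfty_norm A f)%E.
Proof.
rewrite Linfty_normE; have := ess_sup_ge mu (fun x => `|(f \_ A) x|%:E)%E.
by apply: filterS => x + Ax; rewrite patchT ?inE.
Qed.

Lemma Linfty_norm_le (A : set V) f (c : R) : 0 <= c ->
  (\forall x \ae mu, A x -> `|f x| <= c) -> (Linfty_norm A f <= c%:E)%E.
Proof.
move=> c0 fc; rewrite Linfty_normE; apply/ess_supP; apply: filterS fc => x h.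
rewrite lee_fin /patch; case: ifPn => [|_]; last by rewrite normr0.
by rewrite inE => /h.
Qed.

Lemma Linfty_norm_ge0 (A : set V) f : (0 <= Linfty_norm A f)%E.
Proof. exact: Lnorm_ge0. Qed.

Lemma cvg_addn_subseq (G : nat -> R) (l : R) k0 : G k @[k --> \oo] --> l ->
  G (k + k0)%N @[k --> \oo] --> l.
Proof. by move=> Gl; apply: cvg_comp Gl; exact: cvg_addnr. Qed.

Definition difference_quotient f (i : 'I_n) (s : R) x : R :=
  s^-1 * (f (x + s *: delta_mx 0 i) - f x).

Lemma norm_delta_mx_le (i : 'I_n) : `|delta_mx 0 i : V| <= 1.
Proof.
by apply/norm_leP => // j; rewrite mxE; case: (_ && _); rewrite ?normr1// normr0.
Qed.

Lemma lbm_difference_quotient phi i s : lbm phi -> lbm (difference_quotient phi i s).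
Proof. by move=> lphi; apply: lbmZ; apply: lbmB => //; exact: lbm_translation. Qed.

Lemma difference_quotient_ibp phi i s zeta : lbm phi -> test_function setT zeta ->
  \int[mu]_x (difference_quotient phi i s x * zeta x) =
  - \int[mu]_x (phi x * difference_quotient zeta i (- s) x).
Proof.
move=> lphi tz; have lz := test_lbm tz; have bz := test_bounded_support tz.
pose e : V := s *: delta_mx 0 i.
have s1 : L1fun (fun x => phi (x + e) * zeta x).
  by apply: (test_L1fun tz); exact: lbm_translation.
have s2 : L1fun (fun x => phi x * zeta x) by apply: (test_L1fun tz).
have l3 : lbm (fun x => phi x * zeta (x - e)) by apply: lbmM => //; exact: lbm_translation.
have s3 : L1fun (fun x => phi x * zeta (x - e)).
  by apply: L1fun_lbm => //; apply: bounded_supportMr; exact: bounded_support_translation.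
have E : \int[mu]_x (phi (x + e) * zeta x) = \int[mu]_x (phi x * zeta (x - e)).
  rewrite -(Rintegral_translation e (f := fun x => phi x * zeta (x - e))).
    by apply: eq_RI => x; rewrite addrK.
  by have [] := l3.
transitivity (s^-1 * (\int[mu]_x (phi (x + e) * zeta x) - \int[mu]_x (phi x * zeta x))).
  rewrite -RIB// -RIZ; last exact: L1funB.
  by apply: eq_RI => x; rewrite /difference_quotient -mulrA mulrBl.
rewrite E -RIB// -RIZ; last exact: L1funB.
rewrite -RIN.
  apply: eq_RI => x; rewrite /difference_quotient scaleNr -/e invrN.
  by ring.
rewrite (_ : (fun x => _) = fun x => (- s)^-1 * (phi x * zeta (x - e) - phi x * zeta x)).
  by apply: L1funZ; exact: L1funB.
by apply/funext => x; rewrite /difference_quotient scaleNr -/e mulrCA mulrBr.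
Qed.

(** Translation invariance moves the quotient to [zeta], with the opposite step; there the Taylor
    remainder makes it converge uniformly on a fixed ball. No regularity of [phi] enters. *)
Lemma cvg_difference_quotient phi i (s : nat -> R) zeta : lbm phi -> test_function setT zeta ->
  (forall k, s k != 0) -> s k @[k --> \oo] --> (0 : R) ->
  \int[mu]_x (difference_quotient phi i (s k) x * zeta x) @[k --> \oo] -->
    - \int[mu]_x (phi x * partial i zeta x).
Proof.
move=> lphi tz sn0 s0; have [c c0 zc] := test_taylor tz.
have lz := test_lbm tz; have bz := test_bounded_support tz.
under eq_cvg do rewrite difference_quotient_ibp//; apply: cvgN.
have s1 k : L1fun (fun x => phi x * difference_quotient zeta i (- s k) x).
  apply: L1fun_lbm.
    by apply: lbmM => //; exact: lbm_difference_quotient.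
  apply: bounded_supportMr; apply: bounded_supportMr; apply: bounded_supportB => //.
  exact: bounded_support_translation.
have tp := test_partial tz i.
have s2 : L1fun (fun x => phi x * partial i zeta x) by apply: (test_L1fun tp).
have [r r0 zr] := bounded_support_lt bz; have [r' r'0 pr] := bounded_support_lt (test_bounded_support tp).
pose B := [set x : V | `|x| <= r + r' + 1].
have mB : measurable B by exact: measurable_norm_le.
have sB : L1fun (fun x => phi x * \1_B x).
  apply: L1fun_lbm; first by apply: lbmM => //; exact: lbm_indic.
  by apply: bounded_supportMr; exact: bounded_support_indic (fun x Bx => Bx).
apply/cvgrPdist_le => e e0.
pose M := c * \int[mu]_x `|phi x * \1_B x| + 1.
have M0 : 0 < M by rewrite ltr_wpDl// mulr_ge0// RI_ge0.
near=> k; rewrite -RIB//.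
have sk : `|s k| <= e / M.
  near: k; have /cvgrPdist_le/(_ (e / M)) := s0; rewrite divr_gt0// => /(_ isT).
  by apply: filterS => k; rewrite sub0r normrN.
have sk1 : `|s k| <= 1.
  near: k; have /cvgrPdist_le/(_ 1 ltr01) := s0.
  by apply: filterS => k; rewrite sub0r normrN.
apply: (@le_trans _ _ (`|s k| * (c * \int[mu]_x `|phi x * \1_B x|))); last first.
  move: sk; rewrite ler_pdivlMr//; apply: le_trans.
  by rewrite ler_wpM2l// lerDl.
rewrite mulrA -RIZ; last exact: L1fun_norm.
apply: RI_norm_le; first exact: L1funB.
  by apply: L1funZ; exact: L1fun_norm.
move=> x; rewrite -mulrBr.
have [xB|xB] := boolP (x \in B); last first.
  have rx : r + r' + 1 < `|x| by rewrite ltNge; apply: contra xB => ?; rewrite inE.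
  have -> : partial i zeta x = 0.
    apply/eqP; apply: contraTT (rx) => /pr xr'; rewrite -leNgt (le_trans xr')//.
    by rewrite addrAC lerDr addr_ge0// ltW.
  have zx : zeta x = 0.
    apply/eqP; apply: contraTT (rx) => /zr xr; rewrite -leNgt (le_trans xr)//.
    by rewrite -addrA lerDl addr_ge0// ltW.
  have -> : difference_quotient zeta i (- s k) x = 0.
    rewrite /difference_quotient zx subr0.
    suff -> : zeta (x + - s k *: delta_mx 0 i) = 0 by rewrite mulr0.
    apply/eqP; apply: contraTT (rx) => /zr xr; rewrite -leNgt.
    rewrite -[x](addrK (- s k *: delta_mx 0 i)) (le_trans (ler_normB _ _))//.
    rewrite -addrA lerD// (@le_trans _ _ 1)// ?lerDr ?(ltW r'0)// normrZ normrN.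
    by rewrite mulr_ile1 ?norm_delta_mx_le.
  by rewrite subrr mulr0 normr0 !mulr_ge0.
rewrite indicE xB mulr1 normrM mulrC ler_wpM2r//.
have := zc x (- s k *: delta_mx 0 i).
have -> : \sum_j (- s k *: delta_mx 0 i : V) 0 j * partial j zeta x = - s k * partial i zeta x.
  rewrite (bigD1 i)//= big1 ?addr0 => [|j ji]; rewrite !mxE !eqxx /=; first by rewrite mulr1.
  by rewrite (negbTE ji) mulr0 mul0r.
rewrite normrZ normrN exprMn => zx.
have : `|zeta (x + - s k *: delta_mx 0 i) - zeta x - - s k * partial i zeta x| <= c * `|s k| ^+ 2.
  apply: (le_trans zx); rewrite ler_wpM2l// ler_piMr ?sqr_ge0// expr_le1//.
  exact: norm_delta_mx_le.
rewrite /difference_quotient; set a := zeta _ - zeta x => ha.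
rewrite (_ : partial i zeta x - _ = (s k)^-1 * (a - - s k * partial i zeta x)); last first.
  by rewrite invrN; field; exact: sn0.
rewrite normrM normfV ler_pdivrMl ?normr_gt0//.
by rewrite [leRHS]mulrA -expr2 [leRHS]mulrC.
Unshelve. all: by end_near.
Qed.

Section lipschitz_compact_support.
Variables (phi : V -> R) (L : R).
Hypothesis philip : forall x y, `|phi x - phi y| <= L * `|x - y|.
Hypothesis phib : bounded_support phi.

Lemma lipschitz_lbm : lbm phi.
Proof.
apply: lbm_continuous => x; apply: (@lipschitz_continuous_at _ _ phi L 1) => //.
Qed.

Let lphi : lbm phi := lipschitz_lbm.
Let sphi : L1fun phi := L1fun_lbm lphi phib.

Lemma difference_quotient_bounded i s x : 0 <= L -> `|difference_quotient phi i s x| <= L.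
Proof.
move=> L0; have [->|s0] := eqVneq s 0.
  by rewrite /difference_quotient invr0 mul0r normr0.
rewrite normrM normfV ler_pdivrMl ?normr_gt0// mulrC.
apply: (le_trans (philip _ _)); rewrite addrAC subrr add0r normrZ.
by rewrite ler_wpM2l// ler_piMr// norm_delta_mx_le.
Qed.

(* Forward and backward difference quotients have the same weak limit, but where
   phi = 0 <= phi their signs are opposite, so that this limit is 0 there. *)
Lemma wgrad_indic D (C : R) : 0 <= L -> (forall x, 0 <= phi x) -> lbmv D ->
  (forall i x, `|D x 0 i| <= C) -> let O := [set x | phi x != 0] in
  open O -> wgrad O phi D -> wgrad setT phi (fun x => \1_O x *: D x).
Proof.
move=> L0 phi0 lD DC O oO wD zeta tz i.
have mO : measurable O by exact: open_measurable_rV.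
have lz := test_lbm tz; have bz := test_bounded_support tz.
have sz : L1fun zeta by exact: L1fun_lbm.
have [r zr] := bz.
pose s k : R := k.+1%:R^-1.
have s0 k : 0 < s k by rewrite invr_gt0.
have cs : s k @[k --> \oo] --> (0 : R) by exact: cvg_harmonic_inv.
have csN : - s k @[k --> \oo] --> (0 : R) by rewrite -oppr0; exact: cvgN.
pose P k := difference_quotient phi i (s k).
pose N k := difference_quotient phi i (- s k).
have lP k : lbm (P k) by exact: lbm_difference_quotient.
have lN k : lbm (N k) by exact: lbm_difference_quotient.
have cP xi : test_function setT xi ->
    \int[mu]_x (P k x * xi x) @[k --> \oo] --> - \int[mu]_x (phi x * partial i xi x).
  by move=> tx; apply: cvg_difference_quotient => // k; rewrite gt_eqF.
have cN xi : test_function setT xi ->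
    \int[mu]_x (N k x * xi x) @[k --> \oo] --> - \int[mu]_x (phi x * partial i xi x).
  by move=> tx; apply: cvg_difference_quotient => // k; rewrite oppr_eq0 gt_eqF.
pose H k x := P k x - N k x.
have mH k : measurable_fun setT (H k) by have [] := lbmB (lP k) (lN k).
have HL k x : `|H k x| <= L + L.
  by rewrite (le_trans (ler_normB _ _))// lerD// difference_quotient_bounded.
pose B := ~` O `&` [set x | `|x| <= r].
have mB : measurable B by apply: measurableI; [exact: measurableC|exact: measurable_norm_le].
have sB : L1fun (\1_B : V -> R) by apply: (@L1fun_indic _ _ _ r) => // x [].
have wH : weakly_null H \1_B.
  apply: (@weakly_null_L1 _ _ H (L + L) mH HL setT _ _ (@openT _) sB) => [|x []//].
  move=> xi tx; rewrite /weakly_null.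
  rewrite (_ : (fun k => _) = fun k => \int[mu]_x (P k x * xi x) - \int[mu]_x (N k x * xi x)).
    by rewrite -(subrr (- \int[mu]_x (phi x * partial i xi x))); apply: cvgB; [exact: cP|exact: cN].
  apply/funext => k; rewrite -RIB; [|exact: (test_L1fun tx)|exact: (test_L1fun tx)].
  by apply: eq_RI => x; rewrite -mulrBl.
have [c zc] := test_bounded tz.
have c0 : 0 <= c := le_trans (normr_ge0 _) (zc 0).
have c1 : 0 < c + 1 by rewrite ltr_wpDl.
have sPO k : L1fun (fun x => P k x * (\1_O x * zeta x)).
  apply: L1fun_lbm; first by apply: lbmM => //; apply: lbmM => //; exact: lbm_indic.
  by apply: bounded_supportMr; exact: bounded_supportMr.
have sPC k : L1fun (fun x => P k x * (\1_(~` O) x * zeta x)).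
  apply: L1fun_lbm.
    by apply: lbmM => //; apply: lbmM => //; apply: lbm_indic; exact: measurableC.
  by apply: bounded_supportMr; exact: bounded_supportMr.
(* Where [phi] vanishes, [P k] is nonnegative and [N k] nonpositive, so [H k] dominates [P k]. [B]
   is the part of the complement of [O] in a ball containing the support of [zeta], and [c] bounds
   [zeta]. *)
have cC : \int[mu]_x (P k x * (\1_(~` O) x * zeta x)) @[k --> \oo] --> (0 : R).
  apply/cvgrPdist_le => e e0; near=> k; rewrite sub0r normrN.
  have sHB : L1fun (fun x => H k x * \1_B x).
    apply: L1fun_lbm; first by apply: lbmM; [exact: lbmB|exact: lbm_indic].
    by apply: bounded_supportMr; apply: (@bounded_support_indic _ _ _ r) => x [].
  apply: (@le_trans _ _ (c * \int[mu]_x (H k x * \1_B x))).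
    rewrite -RIZ//; apply: RI_norm_le => //; first exact: L1funZ.
    move=> x; rewrite !normrM [`|\1_ _ _|]ger0_norm ?indic_ge0//.
    have [Ox|Ox] := pselect (O x).
      rewrite !indicE memNset; last by move=> /(_ Ox).
      by rewrite memNset ?mul0r ?mulr0// => -[/(_ Ox)].
    have fx : phi x = 0 by apply/eqP; apply: contrapT => /negP.
    rewrite indicE mem_set// mul1r.
    have [->|/zr xr] := eqVneq (zeta x) 0.
      rewrite normr0 mulr0; apply: mulr_ge0 => //; apply: mulr_ge0; last exact: indic_ge0.
      by rewrite /H /P /N /difference_quotient fx !subr0 invrN mulNr opprK addr_ge0// mulr_ge0// invr_ge0 ltW.
    rewrite indicE mem_set// mulr1 mulrC ler_pM//.
    rewrite /H /P /N /difference_quotient fx !subr0 invrN mulNr opprK.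
    rewrite !ger0_norm ?phi0 ?invr_ge0 ?(ltW (s0 k))//.
    by rewrite lerDl mulr_ge0 ?phi0 ?invr_ge0 ?(ltW (s0 k)).
  have h : `|\int[mu]_x (H k x * \1_B x)| <= e / (c + 1).
    near: k; have /cvgrPdist_le/(_ (e / (c + 1))) := wH; rewrite divr_gt0// => /(_ isT).
    by apply: filterS => k; rewrite sub0r normrN.
  apply: (@le_trans _ _ (c * (e / (c + 1)))).
    by rewrite ler_wpM2l// (le_trans (ler_norm _)).
  by rewrite mulrCA ler_piMr ?(ltW e0)// ler_pdivrMr// mul1r lerDl.
(* Inside [O] the limit of [P k] is given against test functions of [O], and [\1_O x * zeta x] need
   not be one. It is integrable and vanishes off [O], so [weakly_null_L1] covers it. *)
pose F k x := \1_O x * (P k x - D x 0 i).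
have mF k : measurable_fun setT (F k).
  by have [] := lbmM (lbm_indic mO) (lbmB (lP k) (lD i)).
have FC k x : `|F k x| <= L + C.
  rewrite normrM [`|\1_ _ _|]ger0_norm ?indic_ge0// -[leRHS]mul1r.
  rewrite ler_pM ?indic_ge0 ?indic_le1// (le_trans (ler_normB _ _))// lerD//.
  exact: difference_quotient_bounded.
have sOz : L1fun (fun x => \1_O x * zeta x).
  by apply: L1fun_lbm; [apply: lbmM => //; exact: lbm_indic|exact: bounded_supportMr].
have sDz : L1fun (fun x => D x 0 i * (\1_O x * zeta x)).
  apply: L1fun_lbm; first by apply: lbmM => //; apply: lbmM => //; exact: lbm_indic.
  by apply: bounded_supportMr; exact: bounded_supportMr.
have wF : weakly_null F (fun x => \1_O x * zeta x).
  apply: (@weakly_null_L1 _ _ F (L + C) mF FC O _ _ oO sOz); last first.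
    by move=> x Ox; rewrite indicE memNset// mul0r.
  move=> xi tx; have tx' : test_function setT xi by apply: test_sub tx.
  rewrite /weakly_null.
  rewrite (_ : (fun k => _) = fun k => \int[mu]_x (P k x * xi x) - \int[mu]_x (D x 0 i * xi x)).
    rewrite -(subrr (\int[mu]_x (D x 0 i * xi x))); apply: cvgB; last exact: cvg_cst.
    by have := cP xi tx'; rewrite (wD xi tx) opprK.
  apply/funext => k; rewrite -RIB; [|exact: (test_L1fun tx')|exact: (test_L1fun tx')].
  apply: eq_RI => x; have [Ox|Ox] := pselect (O x).
    by rewrite /F indicE mem_set// mul1r mulrBl.
  by rewrite (test_eq0 tx Ox) !mulr0 subrr.
have cO : \int[mu]_x (P k x * (\1_O x * zeta x)) @[k --> \oo] -->
    \int[mu]_x (D x 0 i * (\1_O x * zeta x)).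
  rewrite -[X in _ --> X]add0r.
  rewrite (_ : (fun k => _) = fun k => \int[mu]_x (F k x * (\1_O x * zeta x)) +
      \int[mu]_x (D x 0 i * (\1_O x * zeta x))).
    by apply: cvgD; [exact: wF|exact: cvg_cst].
  apply/funext => k; rewrite -RID//.
    apply: eq_RI => x; rewrite /F indicE; case: (x \in O); rewrite ?mul0r ?mulr0 ?addr0//.
    by rewrite !mul1r -mulrDl subrK.
  rewrite (_ : (fun x => _) = fun x => P k x * (\1_O x * zeta x) - D x 0 i * (\1_O x * zeta x)).
    exact: L1funB.
  apply/funext => x; rewrite /F indicE; case: (x \in O); rewrite ?mul0r ?mulr0 ?subr0//.
  by rewrite !mul1r mulrBl.
have lim1 := cP zeta tz.
have lim2 : \int[mu]_x (P k x * zeta x) @[k --> \oo] --> \int[mu]_x (D x 0 i * (\1_O x * zeta x)).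
  rewrite -[X in _ --> X]addr0.
  rewrite (_ : (fun k => _) = fun k => \int[mu]_x (P k x * (\1_O x * zeta x)) +
      \int[mu]_x (P k x * (\1_(~` O) x * zeta x))).
    exact: cvgD.
  apply/funext => k; rewrite -RID//; apply: eq_RI => x.
  rewrite -mulrDr -mulrDl !indicE in_setC; case: (x \in O) => /=.
    by rewrite addr0 mul1r.
  by rewrite add0r mul1r.
have -> : \int[mu]_x ((\1_O x *: D x) 0 i * zeta x) = \int[mu]_x (D x 0 i * (\1_O x * zeta x)).
  by apply: eq_RI => x; rewrite mxE mulrAC mulrC mulrA.
by rewrite -(cvg_unique _ lim1 lim2)// opprK.
Unshelve. all: by end_near.
Qed.

(** The approximating test functions are mollifications: uniformly close by the Lipschitz bound,
    with gradients that are mollifications of [D'] and hence converge weakly* by [convol_weak]. *)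
Lemma W1infty0_wgrad Omega D' (C rho rho' : R) (x0 : V) : 0 <= L ->
  lbmv D' -> (forall i x, `|D' x 0 i| <= C) -> rho < rho' ->
  (forall x, `|x0 - x| <= rho' -> Omega x) -> (forall x, phi x != 0 -> `|x0 - x| <= rho) ->
  open Omega -> wgrad setT phi D' -> W1infty0 Omega phi D'.
Proof.
move=> L0 lD' D'C rr' xO phix oOm wT.
have mOm : measurable Omega by exact: open_measurable_rV.
have [c0 phic] : exists c, forall x, `|phi x| <= c.
  have [r pr] := phib; have [c pc] := lphi.2 r; exists (`|c|) => x.
  have [->|/pr/pc h] := eqVneq (phi x) 0; first by rewrite normr0.
  exact: le_trans h (ler_norm c).
have c00 : 0 <= c0 := le_trans (normr_ge0 _) (phic 0).
split.
  split.
  - split; first by apply: measurable_funTS; have [] := lphi.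
    apply: le_lt_trans (ltry c0); apply: Linfty_norm_le => //.
    by apply: aeW => x _; exact: phic.
  - move=> i; split; first by apply: measurable_funTS; have [] := lD' i.
    apply: le_lt_trans (ltry `|C|); apply: Linfty_norm_le => //.
    by apply: aeW => x _; rewrite (le_trans (D'C i x))// ler_norm.
  - by apply/weak_gradientP => zeta tz; apply: wT; exact: test_sub tz.
(* Starting the sequence at [k0] keeps every support within the gap between [rho] and [rho'], hence
   inside [Omega]. *)
have [k0 k0d] : exists k0 : nat, k0.+1%:R^-1 < rho' - rho.
  have h : 0 < rho' - rho by rewrite subr_gt0.
  by have [m _ /(_ m (leqnn m))] := cvg_harmonic_lt h; exists m.
have kd k : (k + k0).+1%:R^-1 < rho' - rho.
  apply: le_lt_trans k0d; rewrite lef_pV2 ?posrE// ler_nat ltnS.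
  exact: leq_addl.
exists (fun k => convol phi (mollifier (k + k0))); split.
- move=> k; pose B := [set x : V | `|x0 - x| <= rho'].
  apply: (@test_functionP _ _ _ _ B (`|x0| + rho')).
  + by move=> j; apply: Ck_convol => //; exact: test_mollifier.
  + have /continuous_closedP h := @continuous_affine R n (-1) x0.
    have := h [set y | `|y| <= rho'].
    rewrite (_ : _ @^-1` _ = B); last by apply/seteqP; split=> x; rewrite /B /= scaleN1r.
    apply; have /continuous_closedP := @norm_continuous R V.
    exact: (fun p => p _ (@closed_le R rho')).
  + by move=> x; exact: xO.
  + move=> x xB; rewrite -(subKr x0 x) (le_trans (ler_normB _ _))// lerD2l//.
  + move=> x; apply: contra_neqP => xB.
    apply/eqP; rewrite -normr_le0 -[convol _ _ _]subr0; apply: convol_close => // y xy.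
    rewrite subr0 normr_le0; apply/eqP; apply: contrapT => /eqP /phix yr; apply: xB.
    rewrite /B /= -(subrKA y) (le_trans (ler_normD _ _))//.
    have := lt_trans xy (kd k); rewrite distrC ltrBrDl => h.
    by rewrite ltW// (le_lt_trans _ h)// lerD2r.
- apply: (@squeeze_cvge nat \oo _ R (cst 0%E) _ (fun k => (L * k.+1%:R^-1)%:E)).
  + apply: nearW => k; rewrite Linfty_norm_ge0 /=; apply: Linfty_norm_le.
      by rewrite mulr_ge0.
    apply: aeW => x _ /=; apply: convol_close => // y xy.
    apply: (le_trans (philip _ _)); rewrite ler_wpM2l// distrC (le_trans (ltW xy))//.
    by rewrite lef_pV2 ?posrE// ler_nat ltnS leq_addr.
  + exact: cvg_cst.
  + apply: cvg_EFin; first exact: nearW.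
    by rewrite -(mulr0 L); apply: cvgMl_tmp; exact: cvg_harmonic_inv.
- move=> g gi; rewrite RI_mkcond.
  have sg i : L1fun (fun x => \1_Omega x * g x 0 i).
    have := gi i; rewrite integrable_mkcond// /L1fun; congr (_.-integrable _ _).
    apply/funext => x; rewrite /patch /= indicE.
    by case: (x \in Omega); rewrite ?mul1r ?mul0r.
  have E (W : V -> V) : (forall i, lbm (fun x => W x 0 i)) -> (forall i x, `|W x 0 i| <= C) ->
      \int[mu]_x (\1_Omega x * dotp (W x) (g x)) =
      \sum_i \int[mu]_x (W x 0 i * (\1_Omega x * g x 0 i)).
    move=> lW WC; rewrite -RIsum.
      by apply: eq_RI => x; rewrite mulr_sumr; apply: eq_bigr => i _; rewrite mulrCA.
    move=> i; apply: (@L1fun_le _ _ _ (fun x => C * `|\1_Omega x * g x 0 i|)).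
    + by apply: measurable_funM; [have [] := lW i|exact: L1fun_measurable].
    + by apply: L1funZ; exact: L1fun_norm.
    + by move=> x; rewrite normrM ler_wpM2r.
  rewrite E//.
  have gE k i : (fun x => grad (convol phi (mollifier (k + k0))) x 0 i) =
      convol (fun x => D' x 0 i) (mollifier (k + k0)).
    by apply/funext => x; rewrite mxE; apply: (partial_convol_wgrad _ lphi lD' wT).
  pose G i k := \int[mu]_x (convol (fun x => D' x 0 i) (mollifier k) x * (\1_Omega x * g x 0 i)).
  have cG i : G i k @[k --> \oo] --> \int[mu]_x (D' x 0 i * (\1_Omega x * g x 0 i)).
    exact: (convol_weak (lD' i).1 (D'C i) (sg i)).
  rewrite (_ : (fun k => _) = fun k => \sum_i G i (k + k0)%N).
    by apply: (@cvg_sumr R nat 'I_n \oo _ (fun i k => G i (k + k0)%N)) => i; apply: cvg_addn_subseq.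
  apply/funext => k; rewrite RI_mkcond E.
  + by apply: eq_bigr => i _; apply: eq_RI => x; rewrite -gE.
  + by move=> i; rewrite gE; apply: lbm_convol => //; exact: test_mollifier.
  + by move=> i x; have := gE k i => /(congr1 (fun f => f x)) ->; exact: convol_bounded.
Qed.

End lipschitz_compact_support.
End truncation.

(** * From the peak condition to cones *)

Section weak_gradient_calculus.
Context {R : realType} {n : nat}.
Local Notation V := 'rV[R]_n.
Local Notation mu := (@lebesgue_rV R n).
Implicit Types (f g u v phi zeta : V -> R) (D E : V -> V) (x y z h : V) (Omega O : set V).

Lemma wgrad_sub O O' u D : O' `<=` O -> wgrad O u D -> wgrad O' u D.
Proof. by move=> O'O wD zeta tz; apply: wD; apply: test_sub tz. Qed.

Lemma eq_wgrad O f g D : (forall x, O x -> f x = g x) -> wgrad O f D -> wgrad O g D.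
Proof.
move=> fg wD zeta tz i; rewrite -(wD zeta tz i); apply: eq_RI => x.
have [/fg ->//|Ox] := pselect (O x).
by rewrite (test_eq0 (test_partial tz i) Ox) !mulr0.
Qed.

Lemma wgrad_linear O u v D E (a : R) : lbm u -> lbm v -> lbmv D -> lbmv E ->
  wgrad O u D -> wgrad O v E ->
  wgrad O (fun x => u x + a * v x) (fun x => D x + a *: E x).
Proof.
move=> lu lv lD lE wD wE zeta tz i.
have tp := test_partial tz i.
have -> : \int[mu]_x ((u x + a * v x) * partial i zeta x) =
    \int[mu]_x (u x * partial i zeta x) + a * \int[mu]_x (v x * partial i zeta x).
  rewrite -RIZ; last by apply: (test_L1fun tp).
  rewrite -RID; [|by apply: (test_L1fun tp)|by apply: L1funZ; apply: (test_L1fun tp)].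
  by apply: eq_RI => x; rewrite mulrDl mulrA.
rewrite wD// wE// mulrN -opprD; congr (- _).
rewrite -RIZ; last by apply: (test_L1fun tz).
rewrite -RID; [|by apply: (test_L1fun tz)|by apply: L1funZ; apply: (test_L1fun tz)].
by apply: eq_RI => x; rewrite !mxE mulrDl mulrA.
Qed.

Lemma lbmvN D : lbmv D -> lbmv (fun x => - D x).
Proof. by move=> lD i; under eq_fun do rewrite mxE; exact: lbmN. Qed.

Lemma wgradZ O u D (a : R) : lbm u -> lbmv D -> wgrad O u D ->
  wgrad O (fun x => a * u x) (fun x => a *: D x).
Proof.
move=> lu lD wD zeta tz i; have tp := test_partial tz i.
transitivity (a * \int[mu]_x (u x * partial i zeta x)).
  rewrite -RIZ; last by apply: (test_L1fun tp).
  by apply: eq_RI => x; rewrite mulrA.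
rewrite wD// mulrN -RIZ; last by apply: (test_L1fun tz).
by congr (- _); apply: eq_RI => x; rewrite mxE mulrA.
Qed.

Lemma wgradN O u D : lbm u -> lbmv D -> wgrad O u D ->
  wgrad O (fun x => - u x) (fun x => - D x).
Proof.
move=> lu lD /(wgradZ (-1) lu lD).
by under eq_fun do rewrite mulN1r; under [X in wgrad _ _ X]eq_fun do rewrite scaleN1r.
Qed.

(** The Lipschitz constant dominates the quotients, so their pointwise limit is also their weak
    limit, which [cvg_difference_quotient] identifies. *)
Lemma wgrad_difference_quotient O f D (L : R) : lbm f -> lbmv D -> 0 <= L ->
  (forall x y, `|f x - f y| <= L * `|x - y|) ->
  (forall x i, O x -> difference_quotient f i k.+1%:R^-1 x @[k --> \oo] --> D x 0 i) ->
  wgrad O f D.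
Proof.
move=> lf lD L0 fL fD zeta tz i.
have tz' : test_function setT zeta by apply: test_sub tz.
have lz := test_lbm tz; have bz := test_bounded_support tz.
have sz : L1fun zeta by exact: L1fun_lbm.
have s0 k : (k.+1%:R^-1 : R) != 0 by rewrite invr_eq0.
have lim1 := @cvg_difference_quotient R n f i _ _ lf tz' s0 (@cvg_harmonic_inv R).
suff lim2 : \int[mu]_x (difference_quotient f i k.+1%:R^-1 x * zeta x) @[k --> \oo] -->
    \int[mu]_x (D x 0 i * zeta x).
  by rewrite -(cvg_unique _ lim1 lim2)// opprK.
apply: (@RI_dominated _ _ _ _ (fun x => L * `|zeta x|)).
- move=> k; have [] // := @lbmM _ _ (difference_quotient f i k.+1%:R^-1) zeta.
  exact: lbm_difference_quotient.
- move=> x; have [Ox|Ox] := pselect (O x).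
    by apply: cvgMr_tmp; exact: fD.
  by rewrite (test_eq0 tz Ox); under eq_cvg do rewrite mulr0; rewrite mulr0; exact: cvg_cst.
- by apply: L1funZ; exact: L1fun_norm.
- move=> k x; rewrite normrM ler_wpM2r//; exact: difference_quotient_bounded.
Qed.

Lemma enorm_lipschitz x y z : `|enorm (x - z) - enorm (y - z)| <= enorm (x - y).
Proof.
rewrite ler_norml lerBrDr addrC lerBlDr; apply/andP; split.
  have := enormD (y - x) (x - z); rewrite addrA subrK enormC; lra.
by have := enormD (x - y) (y - z); rewrite addrA subrK; lra.
Qed.

Lemma dotp_delta x i : dotp x (delta_mx 0 i) = x 0 i.
Proof.
rewrite /dotp (bigD1 i)//= big1 ?addr0 => [|j ji]; rewrite !mxE !eqxx /= ?mulr1//.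
by rewrite (negbTE ji) mulr0.
Qed.

Lemma enorm_delta i : enorm (delta_mx 0 i : V) = 1.
Proof. by rewrite /enorm dotp_delta mxE !eqxx sqrtr1. Qed.

(** The unit vector pointing away from the vertex [y]. At the vertex the inverse of 0 makes it 0, so
    the bounds by 1 hold everywhere. *)
Definition cone_grad y x : V := (enorm (x - y))^-1 *: (x - y).

Lemma cone_grad_le1 y x i : `|cone_grad y x 0 i| <= 1.
Proof.
have [xy|xy] := eqVneq (enorm (x - y)) 0.
  by rewrite /cone_grad xy invr0 scale0r mxE normr0.
have xy0 : 0 < enorm (x - y) by rewrite lt_neqAle eq_sym xy enorm_ge0.
rewrite !mxE normrM normfV [`|enorm _|]gtr0_norm// ler_pdivrMl// mulr1.
by have := coord_le_enorm (x - y) i; rewrite !mxE.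
Qed.

Lemma enorm_cone_grad y x : enorm (cone_grad y x) <= 1.
Proof.
rewrite /cone_grad enormZ ger0_norm ?invr_ge0 ?enorm_ge0//.
by have [->|xy] := eqVneq (enorm (x - y)) 0; rewrite ?mulr0// mulVf.
Qed.

Lemma measurable_inv : measurable_fun setT (@GRing.inv R).
Proof.
rewrite -(setvU [set (0 : R)]); apply/measurable_funU; [exact: measurableC|by []|split].
  apply: open_continuous_measurable_fun; first by apply: closed_openC; exact: closed_eq.
  move=> x; rewrite inE /= => /eqP x0.
  by apply: cvgV => //; exact: id.
exact: measurable_fun_set1.
Qed.

Lemma lbmv_cone_grad y : lbmv (cone_grad y).
Proof.
move=> i; split; last by move=> r; exists 1 => x _; exact: cone_grad_le1.
under eq_fun do rewrite mxE; apply: measurable_funM.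
  apply: (measurableT_comp measurable_inv); apply: measurable_enorm => j.
  by under eq_fun do rewrite mxE; apply: measurable_funD; [exact: measurable_coord|exact: measurable_cst].
by under eq_fun do rewrite mxE; apply: measurable_funD; [exact: measurable_coord|exact: measurable_cst].
Qed.

Lemma lbm_cone y (p c : R) : lbm (fun x => c + p * enorm (x - y)).
Proof.
apply: lbmD; first exact: lbm_cst.
apply: lbmZ; apply: lbm_continuous => x.
apply: (@continuous_comp _ _ _ (fun x => x - y) (@enorm R n)); last exact: continuous_enorm.
by apply: continuousB; [exact: id|exact: cst_continuous].
Qed.

Lemma wgrad_cone O y (p c : R) : (forall x, O x -> x != y) ->
  wgrad O (fun x => c + p * enorm (x - y)) (fun x => p *: cone_grad y x).
Proof.
move=> Oy; apply: (@wgrad_difference_quotient _ _ _ (`|p| * n%:R)).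
- exact: lbm_cone.
- by move=> i; under eq_fun do rewrite mxE; apply: lbmZ; exact: lbmv_cone_grad.
- by rewrite mulr_ge0.
- move=> x z; rewrite opprD addrACA subrr add0r -mulrBr normrM -mulrA ler_wpM2l//.
  by rewrite (le_trans (enorm_lipschitz _ _ _))// enorm_le_norm.
move=> x i /Oy xy; rewrite mxE.
set z := x - y; have z0 : 0 < enorm z.
  by rewrite lt_neqAle enorm_ge0 andbT eq_sym enorm_eq0 subr_eq0.
pose s k : R := k.+1%:R^-1.
have s0 k : 0 < s k by rewrite invr_gt0.
have cs : s k @[k --> \oo] --> (0 : R) by exact: cvg_harmonic_inv.
have cz : enorm (z + s k *: delta_mx 0 i) @[k --> \oo] --> enorm z.
  have -> : enorm z = enorm (z + (0 : R) *: delta_mx 0 i) by rewrite scale0r addr0.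
  apply: continuous_cvg; first exact: continuous_enorm.
  by apply: cvgD; [exact: cvg_cst|apply: cvgZr_tmp].
(* The difference of two norms is the difference of their squares over their sum; the squares differ
   by [s k * (2 * z 0 i + s k)], and the limit is then visible. *)
rewrite (_ : (fun k => _) = fun k => p * ((2 * z 0 i + s k) /
    (enorm (z + s k *: delta_mx 0 i) + enorm z))).
  rewrite (_ : cone_grad y x 0 i = (2 * z 0 i + 0) / (enorm z + enorm z)).
    apply: cvgMl_tmp; apply: cvgM; first by apply: cvgD; [exact: cvg_cst|exact: cs].
    apply: cvgV; first by rewrite gt_eqF// addr_gt0.
    by apply: cvgD; [exact: cz|exact: cvg_cst].
  by rewrite mxE -/z; field; rewrite !gt_eqF// addr_gt0.
apply/funext => k; rewrite /difference_quotient -/(s k).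
rewrite (_ : x + s k *: delta_mx 0 i - y = z + s k *: delta_mx 0 i); last by rewrite addrAC.
rewrite -/z; set a := enorm (z + _); set b := enorm z.
have ab : a ^+ 2 = b ^+ 2 + s k * (2 * z 0 i + s k).
  rewrite !sqr_enorm (dotpDl z) !(dotpDr _ z) [dotp (s k *: _) z]dotpC !dotpZr dotp_delta.
  by rewrite dotpZl -[dotp (delta_mx _ _) _]sqr_enorm enorm_delta; ring.
have ab0 : 0 < a + b by rewrite ltr_wpDl// enorm_ge0.
have -> : 2 * z 0 i + s k = (s k)^-1 * (a ^+ 2 - b ^+ 2).
  by rewrite ab [b ^+ 2 + _]addrC addrK mulKf// gt_eqF.
by field; rewrite !gt_eqF.
Qed.

End weak_gradient_calculus.

(** * The peak condition excludes strict contact with a cone *)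

Section cones.
Context {R : realType} {n : nat}.
Local Notation V := 'rV[R]_n.
Local Notation mu := (@lebesgue_rV R n).
Implicit Types (v phi : V -> R) (D : V -> V) (x y z : V) (Omega O : set V).

(* The inequality of the theorem, read contrapositively and for Lipschitz test
   functions only: where |D| is within the upper part of its range on
   [phi != 0], the product D . D' cannot be bounded away from 0 from below. *)
Definition peak_condition Omega D := forall phi D' (L C rho rho' p : R) x0,
  0 <= L -> (forall x y, `|phi x - phi y| <= L * `|x - y|) ->
  lbmv D' -> (forall i x, `|D' x 0 i| <= C) -> wgrad setT phi D' ->
  rho < rho' -> (forall x, `|x0 - x| <= rho' -> Omega x) ->
  (forall x, phi x != 0 -> `|x0 - x| <= rho) -> 0 <= p ->
  ~ (\forall x \ae mu, phi x != 0 -> enorm (D x) <= p) ->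
  exists2 q, p < q & forall eta : R, 0 < eta ->
    ~ (\forall x \ae mu, phi x != 0 -> q <= enorm (D x) -> dotp (D x) (D' x) <= - eta).

Lemma peak_conditionN Omega D : peak_condition Omega D -> peak_condition Omega (fun x => - D x).
Proof.
move=> pD phi D' L C rho rho' p x0 L0 philip lD' D'C wD' rr ballO supp p0 np.
have philb : bounded_support phi.
  by exists (rho + `|x0|) => x /supp h; rewrite -[x](subrK x0) (le_trans (ler_normD _ _))// distrC lerD.
have lphi := lipschitz_lbm philip.
have [||||||||||q pq qP] := pD (fun x => - phi x) (fun x => - D' x) L C rho rho' p x0 => //.
- by move=> x y; rewrite -opprD normrN.
- exact: lbmvN.
- by move=> i x; rewrite mxE normrN.
- exact: wgradN.
- by move=> x; rewrite oppr_eq0; exact: supp.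
- by apply: contra_not np; apply: filterS => x h px; rewrite enormN; apply: h; rewrite oppr_eq0.
exists q => // eta e0; apply: contra_not (qP eta e0); apply: filterS => x h px qx.
by rewrite -[dotp _ _]opprK -dotpNr opprK -dotpNl h// ?enormN// -oppr_eq0.
Qed.

Lemma compact_annulus x0 (a b : R) : compact [set x : V | a <= `|x0 - x| <= b].
Proof.
apply: bounded_closed_compact.
  exists (`|x0| + b); split; first exact: num_real.
  move=> M hM x /= /andP[_ xb]; apply: ltW; apply: le_lt_trans hM.
  by rewrite -[x](subKr x0) (le_trans (ler_normB _ _))// lerD2l.
have c : continuous (fun x : V => `|x0 - x|).
  move=> x; apply: (@continuous_comp _ _ _ (fun x => x0 - x) (@Num.norm R V)); last exact: norm_continuous.
  by apply: continuousB; [exact: cst_continuous|exact: id].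
rewrite (_ : [set x | _] = [set x | a <= `|x0 - x|] `&` [set x | `|x0 - x| <= b]).
  apply: closedI; have /continuous_closedP cc := c.
    exact: (cc _ (@closed_ge R a)).
  exact: (cc _ (@closed_le R b)).
by apply/seteqP; split=> x /= /andP.
Qed.

Lemma positive_min (f : V -> R) x0 (a b : R) :
  (forall x, a <= `|x0 - x| <= b -> {for x, continuous f}) ->
  (forall x, a <= `|x0 - x| <= b -> 0 < f x) ->
  exists2 m : R, 0 < m & forall x, a <= `|x0 - x| <= b -> m <= f x.
Proof.
move=> cf f0; pose A := [set x : V | a <= `|x0 - x| <= b].
have [[z Az]|nA] := pselect (A !=set0); last first.
  by exists 1 => // x Ax; exfalso; apply: nA; exists x.
have [|||c cA cmin] := @EVT_min_rV R n f A; first by exists z.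
- exact: compact_annulus.
- by rewrite continuous_subspace_in => x; rewrite inE => Ax; apply: continuous_subspaceT_for => //; exact: cf.
by exists (f c); [apply: f0; rewrite inE in cA|move=> x Ax; apply: cmin; rewrite inE].
Qed.

(* Otherwise the positive part phi of v - cone + m / 2, for a small m > 0, is a
   compactly supported Lipschitz function, and the peak condition for - phi
   forces |D| <= p on its support: v cannot drop faster than the cone along the
   ray towards the vertex, on which phi would thus never vanish. *)
Lemma peak_condition_no_cone Omega v D x0 y (p r rho L C : R) :
  open Omega -> lbm v -> lbmv D -> (forall i x, `|D x 0 i| <= C) -> wgrad Omega v D ->
  peak_condition Omega D -> 0 < p -> 0 < r -> r < rho ->
  (forall x, `|x0 - x| <= rho -> Omega x) -> r < `|x0 - y| -> 0 <= L ->
  (forall x z, `|x0 - x| < rho -> `|x0 - z| < rho -> `|v x - v z| <= L * `|x - z|) ->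
  (forall x, 0 < `|x0 - x| <= r -> v x < v x0 + p * (enorm (x - y) - enorm (x0 - y))) ->
  False.
Proof.
move=> oO lv lD DC wD pD p0 r0 rrho ballO ry L0 vL vcone.
have cv x : `|x0 - x| <= r -> {for x, continuous v}.
  move=> xr; apply: (@lipschitz_continuous_at _ _ _ L (rho - r)); first by rewrite subr_gt0.
  move=> z xz; apply: vL; first exact: le_lt_trans rrho.
  by rewrite -(subrK x x0) -addrA (le_lt_trans (ler_normD _ _))// -(subrKC r rho) ler_ltD.
have cc (k a : R) x : {for x, continuous (fun x => k + a * enorm (x - y))}.
  apply: continuousD; first exact: cst_continuous.
  apply: continuousM; first exact: cst_continuous.
  apply: (@continuous_comp _ _ _ (fun x => x - y) (@enorm R n)); last exact: continuous_enorm.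
  by apply: continuousB; [exact: id|exact: cst_continuous].
have [m m0 mP] : exists2 m : R, 0 < m & forall x, r / 2 <= `|x0 - x| <= r ->
    m <= ((v x0 - p * enorm (x0 - y)) + p * enorm (x - y)) - v x.
  apply: positive_min => x /andP[xr1 xr2].
    by apply: continuousB; [exact: cc|exact: cv].
  rewrite subr_gt0; have := vcone x; rewrite xr2 andbT (lt_le_trans _ xr1) ?divr_gt0// => /(_ isT).
  lra.
(* Lowering the cone by half of the gap [m] leaves [g] equal to [m / 2] at [x0] and at most
   [- (m / 2)] on the whole shell, so the cap stays inside the ball of radius [r / 2]. *)
pose k := v x0 - m / 2 - p * enorm (x0 - y).
pose g x := v x + -1 * (k + p * enorm (x - y)).
have gx0 : g x0 = m / 2 by rewrite /g /k; ring.
have g_le x : `|x0 - x| <= r -> g x <= m / 2.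
  have [->|xx0] := eqVneq x x0; first by rewrite gx0.
  move=> xr; have := vcone x; rewrite xr andbT normr_gt0 subr_eq0 eq_sym xx0 => /(_ isT).
  rewrite /g /k; lra.
have gneg x : r / 2 <= `|x0 - x| <= r -> g x <= - (m / 2).
  move=> /mP; rewrite /g /k; lra.
pose L' := L + p * n%:R.
have L'0 : 0 <= L' by rewrite addr_ge0// mulr_ge0// ltW.
have gL x z : `|x0 - x| <= r -> `|x0 - z| <= r -> g x - g z <= L' * `|x - z|.
  move=> xr zr; have := vL x z (le_lt_trans xr rrho) (le_lt_trans zr rrho).
  rewrite ler_norml => /andP[_ h1].
  have := enorm_lipschitz x z y; rewrite ler_norml => /andP[h2 _].
  have h3 := enorm_le_norm (x - z).
  have : p * (enorm (z - y) - enorm (x - y)) <= p * (n%:R * `|x - z|).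
    by rewrite ler_wpM2l ?(ltW p0)//; apply: le_trans h3; lra.
  rewrite /g /L'; lra.
pose phi x := if `|x0 - x| <= r then Num.max (g x) 0 else 0.
have phi0 x : 0 <= phi x by rewrite /phi; case: ifP => // _; rewrite le_max lexx orbT.
have phi_neq0 x : phi x != 0 -> [/\ `|x0 - x| < r / 2, phi x = g x & 0 < g x].
  rewrite /phi; case: ifP => [xr|_]; last by rewrite eqxx.
  have [g0|g0] := leP (g x) 0; first by rewrite eqxx.
  move=> _; split => //; rewrite ltNge; apply/negP => xr2.
  by have := gneg x; rewrite xr xr2 => /(_ isT); rewrite leNgt (lt_trans _ g0)// oppr_lt0 divr_gt0.
have ge_phi x : `|x0 - x| <= r -> g x <= phi x by rewrite /phi => ->; rewrite le_max lexx.
(* Between a point of the cap and a point outside the ball the distance is at least [r / 2], while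
   [phi] changes by at most [m / 2]; this is the slope [m / r]. *)
pose K := L' + m / r.
have K0 : 0 <= K by rewrite addr_ge0// divr_ge0// ltW.
have phiK x z : phi x - phi z <= K * `|x - z|.
  have [->|/phi_neq0[xr -> _]] := eqVneq (phi x) 0.
    by rewrite (@le_trans _ _ 0)// ?subr_le0// mulr_ge0.
  have xr' : `|x0 - x| <= r by apply: ltW; apply: (lt_trans xr); lra.
  have [zr|zr] := leP `|x0 - z| r.
    apply: (@le_trans _ _ (L' * `|x - z|)); last by rewrite ler_wpM2r// lerDl divr_ge0// ltW.
    by apply: le_trans (gL _ _ xr' zr); rewrite lerD2l lerN2 ge_phi.
  have xz : r / 2 <= `|x - z|.
    have : `|x0 - z| <= `|x0 - x| + `|x - z| by exact: ler_distD.
    lra.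
  apply: (@le_trans _ _ (m / r * `|x - z|)); last by rewrite ler_wpM2r// lerDr.
  apply: (@le_trans _ _ (m / 2)); first by have := g_le x xr'; have := phi0 z; lra.
  have -> : m / 2 = m / r * (r / 2) by field; rewrite gt_eqF.
  by rewrite ler_wpM2l// divr_ge0// ltW.
have philip x z : `|phi x - phi z| <= K * `|x - z|.
  by rewrite ler_norml phiK andbT lerNl opprB distrC phiK.
have cphi : continuous phi.
  by move=> x; apply: (@lipschitz_continuous_at _ _ _ K 1) => // z _; exact: philip.
pose O := [set x | phi x != 0].
have oO' : open O.
  have -> : O = ~` (phi @^-1` [set 0]).
    by apply/seteqP; split=> x /= /eqP.
  apply: closed_openC; have /continuous_closedP h := cphi; apply: h.
  exact: closed_eq.
have Or x : O x -> `|x0 - x| <= r.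
  by move=> /phi_neq0[h _ _]; apply: ltW; apply: (lt_trans h); lra.
have OO x : O x -> Omega x by move=> /Or h; apply: ballO; exact: le_trans (ltW rrho).
pose E x := D x + -1 *: (p *: cone_grad y x).
have lG : lbmv (fun x => p *: cone_grad y x).
  by move=> i; under eq_fun do rewrite mxE; apply: lbmZ; exact: lbmv_cone_grad.
have wE : wgrad O phi E.
  apply: (@eq_wgrad _ _ _ g); first by move=> x /phi_neq0[].
  apply: wgrad_linear => //; first exact: lbm_cone.
    exact: wgrad_sub wD.
  by apply: wgrad_cone => x /Or xr; apply: contraTneq xr => ->; rewrite -ltNge.
have lE : lbmv E.
  move=> i; rewrite /E; under eq_fun do rewrite mxE [X in _ + X]mxE.
  by apply: lbmD => //; apply: lbmZ.
have EC i x : `|E x 0 i| <= C + p.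
  rewrite /E 3!mxE (le_trans (ler_normD _ _))// lerD// mulN1r normrN normrM gtr0_norm//.
  by rewrite ler_piMr ?(ltW p0)// cone_grad_le1.
have w1 := wgrad_indic philip K0 phi0 lE EC oO' wE.
have mO : measurable O by exact: open_measurable_rV.
have l1 : lbmv (fun x => \1_O x *: E x).
  by move=> i; under eq_fun do rewrite mxE; apply: lbmM => //; exact: lbm_indic.
have lphi := lipschitz_lbm philip.
have Dp : \forall x \ae mu, O x -> enorm (D x) <= p.
  apply: contrapT => nDp.
  have [||||||||||q pq] := pD (fun x => - phi x) (fun x => - (\1_O x *: E x)) K (C + p) r rho p x0 => //.
  - by move=> x z; rewrite -opprD normrN.
  - exact: lbmvN.
  - move=> i x; rewrite 2!mxE normrN normrM ger0_norm ?indic_ge0//.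
    rewrite (le_trans _ (EC i x))// -[leRHS]mul1r ler_wpM2r// indic_le1.
  - exact: wgradN.
  - by move=> x; rewrite oppr_eq0; exact: Or.
  - exact: ltW.
  - by apply: contra_not nDp; apply: filterS => x h Ox; apply: h; rewrite oppr_eq0.
  have q0 : 0 < q := lt_trans p0 pq.
  (* On the cap D . E >= |D|^2 - p |D|, because [cone_grad] has norm at most 1; where |D| >= q > p
     this is at least [q * (q - p)]. *)
  move=> /(_ (q * (q - p))); apply; first by rewrite mulr_gt0// subr_gt0.
  apply: aeW => x; rewrite oppr_eq0 => Ox qD.
  rewrite dotpNr lerN2 indicE mem_set// scale1r /E scaleN1r dotpDr dotpNr dotpZr -sqr_enorm.
  have h1 : dotp (D x) (cone_grad y x) <= enorm (D x).
    by rewrite (le_trans (dotp_le _ _))// ler_piMr ?enorm_ge0// enorm_cone_grad.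
  have h2 : p * dotp (D x) (cone_grad y x) <= p * enorm (D x) by rewrite ler_wpM2l ?(ltW p0).
  have h3 : q * (q - p) <= enorm (D x) * (enorm (D x) - p).
    by rewrite ler_pM ?(ltW q0) ?subr_ge0 ?(ltW pq)// lerD2r.
  by apply: (le_trans h3); rewrite expr2 mulrBr [enorm _ * p]mulrC lerD2l lerN2.
have vp a b : segment_in O a b -> v b - v a <= p * enorm (b - a).
  move=> Oab; apply: (wgrad_lipschitz oO' lv lD) => //; first exact: wgrad_sub wD.
  - exact: ltW.
  - by move=> x /Or; exact: cv.
(* [phi] cannot decrease from [x0] towards [y]: where it is 0 it is minimal, and on the cap [v]
   drops at rate at most [p], which is exactly the rate of the cone on this ray. Yet it is [m / 2]
   at [x0] and 0 at [y]. *)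
pose f (s : R) := - phi (x0 + s *: (y - x0)).
have : f 1 - f 0 <= 0.
  apply: lipschitz_chaining => t t01.
    apply: continuousN; apply: (@continuous_comp _ _ _ (fun s : R => x0 + s *: (y - x0)) phi).
      apply: continuousD; first exact: cst_continuous.
      by apply: continuousZr_tmp; exact: id.
    exact: cphi.
  pose z := x0 + t *: (y - x0).
  have [z0|Oz] := eqVneq (phi z) 0.
    by exists 1 => // s _ _; rewrite mul0r /f -/z z0 oppr0 subr0 oppr_le0.
  have [d d0 dO] := nbhs_norm_ball oO' Oz.
  have yx0 : 0 < `|y - x0| + 1 by rewrite ltr_wpDl.
  exists (d / (`|y - x0| + 1)); first by rewrite divr_gt0.
  move=> s /andP[ts s1] std; rewrite mul0r /f -/z.
  set w := x0 + s *: (y - x0).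
  have wz : w - z = (s - t) *: (y - x0) by rewrite /w /z opprD addrACA subrr add0r scalerBl.
  have wzd : `|w - z| < d.
    rewrite wz normrZ ger0_norm ?subr_ge0//.
    move: std; rewrite ltr_pdivlMr//; apply: le_lt_trans.
    by rewrite ler_wpM2l ?subr_ge0// lerDl.
  have Owz : segment_in O w z.
    move=> a /andP[a0 a1]; apply: dO.
    rewrite (_ : z - _ = (1 - a) *: (z - w)); last first.
      by apply/rowP => i; rewrite !mxE; ring.
    rewrite normrZ [`|z - w|]distrC ger0_norm ?subr_ge0// (@le_lt_trans _ _ `|w - z|)//.
      by rewrite ler_piMl// lerBlDr lerDl.
    by apply: (lt_trans wzd); lra.
  have [_ gz _] := phi_neq0 _ Oz.
  have Ow : O w by have := Owz 0; rewrite lexx ler01 scale0r addr0; apply.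
  have [_ gw _] := phi_neq0 _ Ow.
  rewrite gz gw /g.
  have := vp w z Owz.
  have -> : enorm (z - w) = enorm (z - y) - enorm (w - y).
    have -> : z - y = (1 - t) *: (x0 - y) by apply/rowP => i; rewrite /z !mxE; ring.
    have -> : w - y = (1 - s) *: (x0 - y) by apply/rowP => i; rewrite /w !mxE; ring.
    rewrite enormC wz !enormZ !ger0_norm ?subr_ge0//; last by case/andP: t01.
    by rewrite [enorm (y - x0)]enormC; ring.
  lra.
rewrite /f scale1r scale0r addr0 addrCA subrr addr0.
have -> : phi y = 0 by rewrite /phi leNgt ry.
have -> : phi x0 = m / 2.
  by rewrite /phi subrr normr0 (ltW r0) gx0; apply/max_idPl; rewrite divr_ge0// ltW.
lra.
Qed.

End cones.

(** * From cones to test functions *)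

Section second_order.
Context {R : realType} {n : nat}.
Local Notation V := 'rV[R]_n.
Implicit Types (f v psi : V -> R) (x y z h a b : V) (Omega : set V) (H : 'I_n -> 'I_n -> R).

Lemma differentiable_taylor1 f x (e : R) : differentiable f x -> 0 < e ->
  exists2 d : R, 0 < d & forall h, `|h| < d ->
    `|f (x + h) - f x - \sum_i h 0 i * partial i f x| <= e * `|h|.
Proof.
move=> df e0; have /diff_locallyP[_ /eqaddoP/(_ e e0)] := df.
move=> /nbhs_ballP[d /= d0 dP].
exists d => // h hd; have := dP h; rewrite -ball_normE /= sub0r normrN => /(_ hd).
by rewrite /cst/= !fctE /= -derive_partial// -deriveE// opprD addrA [h + x]addrC.
Qed.

Definition bilin H a b : R := \sum_j \sum_i a 0 j * b 0 i * H i j.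

Definition hessian f x (i j : 'I_n) : R := partial i (partial j f) x.

Lemma bilinDl H a b c : bilin H (a + b) c = bilin H a c + bilin H b c.
Proof.
rewrite /bilin -big_split; apply: eq_bigr => j _; rewrite -big_split /=.
by apply: eq_bigr => i _; rewrite mxE !mulrDl.
Qed.

Lemma bilinDr H a b c : bilin H a (b + c) = bilin H a b + bilin H a c.
Proof.
rewrite /bilin -big_split; apply: eq_bigr => j _; rewrite -big_split /=.
by apply: eq_bigr => i _; rewrite mxE mulrDr !mulrDl.
Qed.

Lemma bilinZl H (k : R) a b : bilin H (k *: a) b = k * bilin H a b.
Proof.
rewrite /bilin mulr_sumr; apply: eq_bigr => j _; rewrite mulr_sumr.
by apply: eq_bigr => i _; rewrite mxE !mulrA.
Qed.

Lemma bilinZr H (k : R) a b : bilin H a (k *: b) = k * bilin H a b.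
Proof.
rewrite /bilin mulr_sumr; apply: eq_bigr => j _; rewrite mulr_sumr.
by apply: eq_bigr => i _; rewrite mxE; ring.
Qed.

Lemma bilin_bounded H : exists2 C : R, 0 <= C &
  forall a b, `|bilin H a b| <= C * (enorm a * enorm b).
Proof.
exists (\sum_j \sum_i `|H i j|); first by apply: sumr_ge0 => j _; apply: sumr_ge0.
move=> a b; rewrite mulr_suml (le_trans (ler_norm_sum _ _ _))//; apply: ler_sum => j _.
rewrite mulr_suml (le_trans (ler_norm_sum _ _ _))//; apply: ler_sum => i _.
by rewrite !normrM mulrC ler_wpM2l// ler_pM// coord_le_enorm.
Qed.

Lemma infty_laplacianE f x : infty_laplacian f x = bilin (hessian f x) (grad f x) (grad f x).
Proof.
rewrite /infty_laplacian /bilin [RHS]exchange_big /=.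
by apply: eq_bigr => i _; apply: eq_bigr => j _; rewrite !mxE [in RHS](mulrC (partial j f x)).
Qed.

(** The mean value theorem, applied on the segment to [f] minus its quadratic model, leaves
    first-order remainders of the partial derivatives. Hence it suffices that these are
    differentiable at the single point [x]. *)
Lemma taylor2 f x (e d0 : R) : 0 < d0 -> (forall h, `|h| < d0 -> differentiable f (x + h)) ->
  (forall i, differentiable (partial i f) x) -> 0 < e ->
  exists2 d : R, 0 < d & forall h, `|h| < d ->
    `|f (x + h) - f x - dotp (grad f x) h - bilin (hessian f x) h h / 2| <= e * `|h| ^+ 2.
Proof.
move=> d00 df dp e0; have n0 : 0 < n%:R + 1 :> R by rewrite ltr_wpDl.
have e1 : 0 < e / (n%:R + 1) by rewrite divr_gt0.
have [d d1 dP] : exists2 d : R, 0 < d & forall i h, `|h| < d ->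
    `|partial i f (x + h) - partial i f x - \sum_j h 0 j * partial j (partial i f) x| <=
    e / (n%:R + 1) * `|h|.
  have /choice[d dP] i : exists d : R, 0 < d /\ forall h, `|h| < d ->
    `|partial i f (x + h) - partial i f x - \sum_j h 0 j * partial j (partial i f) x| <=
    e / (n%:R + 1) * `|h|.
    by have [d] := differentiable_taylor1 (dp i) e1; exists d.
  exists (\big[Num.min/1]_i d i).
    by apply: lt_bigmin => // i _; have [] := dP i.
  move=> i h hd; have [_] := dP i; apply; apply: (lt_le_trans hd).
  exact: bigmin_le_cond.
exists (Num.min d d0); first by rewrite lt_min d1.
move=> h; rewrite lt_min => /andP[hd hd0].
have th (t : R) : 0 <= t <= 1 -> `|t *: h| <= `|h|.
  by move=> /andP[t0 t1]; rewrite normrZ ger0_norm// ler_piMl.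
pose A := dotp (grad f x) h; pose B := bilin (hessian f x) h h.
pose F (t : R) := f (x + t *: h) - (A * t + B / 2 * (t * t)).
pose F' (t : R) := \sum_i h 0 i * partial i f (x + t *: h) - (A + B * t).
have dF (t : R) : 0 <= t <= 1 -> is_derive t 1 F (F' t).
  move=> t01; apply: is_deriveB.
    by apply: is_derive_line; apply: df; exact: le_lt_trans (th t t01) hd0.
  have dt : is_derive t (1 : R) (@id R) 1 := is_derive_id _ _.
  have h1 : is_derive t (1 : R) (A *: @id R) (A *: 1) by apply: is_deriveZ.
  have h2 : is_derive t (1 : R) (@id R * @id R) (t *: 1 + t *: 1) by apply: is_deriveM.
  have h3 : is_derive t (1 : R) ((B / 2) *: (@id R * @id R)) ((B / 2) *: (t *: 1 + t *: 1)).
    by apply: is_deriveZ.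
  apply: (is_derive_eq (is_deriveD h1 h3)).
  by rewrite /GRing.scale /=; field.
have [| |c c01] := @MVT_segment R F F' 0 1 ler01.
- by move=> t; rewrite in_itv/= => /andP[t0 t1]; apply: dF; rewrite !ltW.
- apply: derivable_within_continuous => s; rewrite in_itv/= => t01.
  exact: (@ex_derive _ _ _ _ _ _ _ (dF s t01)).
rewrite in_itv /= in c01.
rewrite /F scale1r scale0r addr0 subr0 !mulr1 !mulr0 addr0 subr0 => E.
have -> : f (x + h) - f x - dotp (grad f x) h - bilin (hessian f x) h h / 2 = F' c.
  by rewrite -E -/A -/B; ring.
have -> : F' c = \sum_i h 0 i * (partial i f (x + c *: h) - partial i f x -
    \sum_j (c *: h) 0 j * partial j (partial i f) x).
  rewrite /F' /A /B /dotp /bilin mulr_suml opprD addrA -!sumrB; apply: eq_bigr => i _.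
  rewrite !mulrBr [grad _ _ _ _]mxE [partial i f x * _]mulrC; congr (_ - _).
  rewrite mulr_suml mulr_sumr; apply: eq_bigr => j _; rewrite mxE /hessian; ring.
apply: (le_trans (@sumr_coord_le _ _ h (e / (n%:R + 1) * `|h|) _ _)).
  move=> i; apply: (le_trans (dP i (c *: h) (le_lt_trans (th c c01) hd))).
  by rewrite ler_wpM2l ?th// ltW.
rewrite expr2 !mulrA ler_wpM2r// ler_wpM2r//.
by rewrite ler_pdivrMr// mulrC ler_wpM2l ?(ltW e0)// lerDl.
Qed.

(* With alpha, w the components of h along a and orthogonal to it, the quadratic
   form is at most - k alpha^2 + C |w|^2, whereas a cone with a vertex at a small
   distance lam behind x0 exceeds its tangent by |w|^2 / (6 lam). *)
Lemma touching_cone v x0 a H :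
  bilin H a a < 0 ->
  (forall e : R, 0 < e -> exists2 d : R, 0 < d & forall h, `|h| < d ->
     v (x0 + h) - v x0 <= dotp a h + bilin H h h / 2 + e * `|h| ^+ 2) ->
  forall rho : R, 0 < rho -> exists p y (r : R), [/\ 0 < p, 0 < r, r < rho, r < `|x0 - y| &
    forall x, 0 < `|x0 - x| <= r -> v x < v x0 + p * (enorm (x - y) - enorm (x0 - y))].
Proof.
move=> Haa vH rho rho0.
have a0 : a != 0.
  apply: contraTneq Haa => ->; rewrite -leNgt.
  by rewrite -[X in bilin _ X _](scale0r 0) bilinZl mul0r.
pose p := enorm a; have p0 : 0 < p by rewrite lt_neqAle enorm_ge0 andbT eq_sym enorm_eq0.
pose u := p^-1 *: a.
have uu : dotp u u = 1.
  by rewrite /u dotpZl dotpZr -sqr_enorm -/p; field; rewrite gt_eqF.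
have aE : a = p *: u by rewrite /u scalerA divff ?scale1r// gt_eqF.
have eu : enorm u = 1 by rewrite /enorm uu sqrtr1.
pose k := - bilin H u u.
have k0 : 0 < k by rewrite oppr_gt0 /u bilinZl bilinZr !pmulr_rlt0// invr_gt0.
clearbody u.
have [C C0 HC] := bilin_bounded H.
(* Young's inequality for the mixed terms costs [2 * C ^+ 2 / k] and half of the negative term. [C2]
   then collects half of [C1], the Taylor error [k / 8] and a reserve of 1 for strictness; [lam]
   makes [p * (b / (6 * lam))] equal to [C2 * b]. *)
pose C1 := C + 2 * C ^+ 2 / k.
have C10 : 0 <= C1 by rewrite addr_ge0// divr_ge0 ?(ltW k0)// mulr_ge0// sqr_ge0.
pose C2 := C1 / 2 + k / 8 + 1.
have C20 : 0 < C2 by rewrite ltr_wpDl// addr_ge0// divr_ge0// ltW.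
pose lam := p / (6 * C2).
have lam0 : 0 < lam by rewrite divr_gt0// mulr_gt0.
have [d d0 dP] := vH (k / 8) ltac:(by rewrite divr_gt0).
pose y := x0 - lam *: u.
have x0y : 0 < `|x0 - y|.
  rewrite /y opprB addrC subrK normrZ gtr0_norm// mulr_gt0// normr_gt0.
  by rewrite -enorm_eq0 eu oner_eq0.
have n1 : 0 < n%:R + 1 :> R by rewrite ltr_wpDl.
(* The four bounds keep the ball inside [rho], the vertex outside the ball, the increment in the
   range of the expansion, and its Euclidean norm at most [lam / 2]. *)
pose r := Num.min (Num.min (rho / 2) (`|x0 - y| / 2)) (Num.min (d / 2) (lam / 2 / (n%:R + 1))).
have r0 : 0 < r.
  by rewrite /r !lt_min; apply/andP; split; apply/andP; split; rewrite divr_gt0// divr_gt0.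
have [r1 r2 r3 r4] : [/\ r <= rho / 2, r <= `|x0 - y| / 2, r <= d / 2 & r <= lam / 2 / (n%:R + 1)].
  by split; rewrite /r !ge_min lexx ?orbT.
clearbody r.
exists p, y, r; split => //.
- by apply: le_lt_trans r1 _; lra.
- by apply: le_lt_trans r2 _; lra.
move=> x /andP[xx0 xr].
pose h := x - x0; pose al := dotp u h; pose w := h - al *: u.
have xE : x = x0 + h by rewrite /h addrC subrK.
have hn : `|h| <= r by rewrite /h distrC.
have he : enorm h <= lam / 2.
  rewrite (le_trans (enorm_le_norm h))// (@le_trans _ _ ((n%:R + 1) * r))//.
    by rewrite ler_pM// lerDl.
  by rewrite mulrC -ler_pdivlMr.
have uw : dotp u w = 0 by rewrite /w dotpBr dotpZr uu mulr1 subrr.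
have hE : h = al *: u + w by rewrite /w addrC subrK.
clearbody w.
have h2 : dotp h h = al ^+ 2 + dotp w w.
  by rewrite hE dotpDl !dotpDr !dotpZl !dotpZr uu uw [dotp w u]dotpC uw; ring.
have w0 := dotp_ge0 w; set b := dotp w w in h2 w0.
have hh : dotp h h <= (lam / 2) ^+ 2.
  by rewrite -sqr_enorm lerXn2r ?nnegrE ?enorm_ge0// divr_ge0// ltW.
have h_gt0 : 0 < dotp h h.
  by rewrite -sqr_enorm exprn_gt0// lt_neqAle enorm_ge0 andbT eq_sym enorm_eq0 -normr_eq0 gt_eqF// /h distrC.
have al_le : - (lam / 2) <= al <= lam / 2.
  by rewrite -ler_norml (le_trans (norm_dotp_le _ _))// eu mul1r.
have Bh : bilin H h h <= - (k / 2) * al ^+ 2 + C1 * b.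
  have -> : bilin H h h = - k * al ^+ 2 + al * (bilin H u w + bilin H w u) + bilin H w w.
    by rewrite hE !bilinDl !bilinDr !bilinZl !bilinZr /k; ring.
  have wE : enorm w ^+ 2 = b by rewrite sqr_enorm.
  have := HC u w; rewrite eu mul1r ler_norml => /andP[g1 g2].
  have := HC w u; rewrite eu mulr1 ler_norml => /andP[g3 g4].
  have := HC w w; rewrite -expr2 wE ler_norml => /andP[_ g5].
  set W := enorm w in wE g1 g2 g3 g4.
  have g6 : al * (bilin H u w + bilin H w u) <= `|al| * (2 * (C * W)).
    rewrite (le_trans (ler_norm _))// normrM ler_wpM2l// ler_norml; lra.
  have g7 : `|al| * (2 * (C * W)) <= k / 2 * al ^+ 2 + 2 * C ^+ 2 / k * b.
    rewrite -wE -[al ^+ 2]real_normK ?num_real// -subr_ge0.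
    rewrite (_ : _ - _ = k / 2 * (`|al| - 2 * C / k * W) ^+ 2).
      by rewrite mulr_ge0 ?sqr_ge0// divr_ge0// ltW.
    by field; rewrite gt_eqF.
  rewrite /C1; lra.
have v1 : v x - v x0 <= p * al - k / 8 * al ^+ 2 + (C2 - 1) * b.
  have hd : `|h| < d.
    by apply: (le_lt_trans hn); apply: (le_lt_trans r3); rewrite ltr_pdivrMr// ltr_pMr// ltr1n.
  have := dP h hd.
  rewrite -xE aE dotpZl -/al => h1.
  have h3 : k / 8 * `|h| ^+ 2 <= k / 8 * (al ^+ 2 + b).
    rewrite ler_wpM2l ?divr_ge0 ?(ltW k0)// -h2 -sqr_enorm lerXn2r ?nnegrE ?enorm_ge0//.
    exact: norm_le_enorm.
  rewrite /C2; lra.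
have e1 : al + b / (6 * lam) <= enorm (x - y) - enorm (x0 - y).
  have -> : x0 - y = lam *: u by rewrite /y opprB addrC subrK.
  have -> : x - y = h + lam *: u by rewrite /y opprB addrCA addrC /h.
  rewrite enormZ eu mulr1 gtr0_norm// lerBrDr.
  have s0 : 0 <= al + b / (6 * lam) + lam.
    have : 0 <= b / (6 * lam) by rewrite divr_ge0// mulr_ge0// ltW.
    lra.
  rewrite -(ger0_norm s0) -sqrtr_sqr /enorm ler_wsqrtr//.
  rewrite (dotpDl h) !(dotpDr _ h) h2 !dotpZl !dotpZr uu [dotp h u]dotpC -/al mulr1.
  (* The last factor is nonnegative because [al] is at most [lam / 2] and [b] at most its square;
     this fixes how far from [x0] the cone beats its tangent. *)
  rewrite -subr_ge0 (_ : _ - _ = b / (36 * lam ^+ 2) * (12 * lam * (2 * lam - al) - b)).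
    rewrite mulr_ge0//; first by rewrite divr_ge0// mulr_ge0// sqr_ge0.
    have : b <= (lam / 2) ^+ 2 by apply: le_trans hh; rewrite h2 lerDr sqr_ge0.
    have : 0 <= lam * (lam / 2 - al) by rewrite mulr_ge0 ?(ltW lam0)//; lra.
    have := sqr_ge0 lam; rewrite !expr2; lra.
  by field; rewrite gt_eqF.
have e2 : p * (al + b / (6 * lam)) <= p * (enorm (x - y) - enorm (x0 - y)) by rewrite ler_wpM2l// ltW.
have e3 : p * (b / (6 * lam)) = C2 * b by rewrite /lam; field; rewrite !gt_eqF.
have : 0 < k / 8 * al ^+ 2 + b.
  have := sqr_ge0 al; rewrite le_eqVlt => /predU1P[al0|al0].
    by rewrite -al0 mulr0 add0r; rewrite h2 -al0 add0r in h_gt0.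
  by rewrite ltr_wpDr// mulr_gt0// divr_gt0.
lra.
Qed.

End second_order.

(** * Comparison with cones *)

Section radial_functions.
Context {R : realType} {n : nat}.
Local Notation V := 'rV[R]_n.
Implicit Types (v : V -> R) (x y z h : V) (Omega A : set V) (f : R -> R).

(** Unlike the distance it is smooth at [y] too, so functions of it are C^2 test functions on all of
    [Omega]. *)
Definition sqdist y x : R := dotp (x - y) (x - y).

Lemma sqdist_diff y x : differentiable (sqdist y) x /\
  forall i, partial i (sqdist y) x = 2 * (x - y) 0 i.
Proof.
have [|d p] := @differentiable_remainder R n (sqdist y) x (2 *: (x - y)) (n%:R ^+ 2).
  move=> h _.
  have -> : sqdist y (x + h) - sqdist y x - \sum_i h 0 i * (2 *: (x - y)) 0 i = dotp h h.
    rewrite -/(dotp h (2 *: (x - y))) /sqdist -[x + h - y]addrAC dotpZr.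
    by move: (x - y) => z; rewrite (dotpDl z) !(dotpDr _ z) [dotp z h]dotpC; ring.
  rewrite -sqr_enorm ger0_norm ?sqr_ge0// -exprMn lerXn2r ?nnegrE ?enorm_ge0 ?mulr_ge0//.
  exact: enorm_le_norm.
by split=> // i; rewrite p mxE.
Qed.

Lemma coordB_diff y x i : differentiable (fun x => (x - y) 0 i) x /\
  forall j, partial j (fun x => (x - y) 0 i) x = (j == i)%:R.
Proof.
have [|d p] := @differentiable_remainder R n (fun x => (x - y) 0 i) x (delta_mx 0 i) 0.
  move=> h _; rewrite -/(dotp h (delta_mx 0 i)) dotp_delta !mxE mul0r.
  by rewrite normr_le0; apply/eqP; ring.
by split=> // j; rewrite p mxE eqxx.
Qed.

Lemma partial_comp f (l : R) (s : V -> R) x : differentiable s x ->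
  is_derive (s x) 1 f l -> differentiable (fun x => f (s x)) x /\
  forall i, partial i (fun x => f (s x)) x = l * partial i s x.
Proof.
move=> ds [df fl]; have df' : differentiable f (s x) by apply/derivable1_diffP.
have dc : differentiable (fun x => f (s x)) x by exact: (differentiable_comp ds df').
split=> // i; rewrite /partial !deriveE//.
rewrite (_ : 'd (fun x => f (s x)) x = 'd f (s x) \o 'd s x :> (V -> R)); last exact: diff_comp.
by rewrite /= diff1E// derive1E fl mulrC.
Qed.

Lemma partialM (f g : V -> R) x i : differentiable f x -> differentiable g x ->
  partial i (fun x => f x * g x) x = f x * partial i g x + g x * partial i f x.
Proof. by move=> df dg; rewrite /partial (deriveM (derivable_partial (i := i) df) (derivable_partial (i := i) dg)). Qed.

Section radial.
Variables (y : V) (f f1 f2 : R -> R).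
Hypothesis df : forall t : R, is_derive t 1 f (f1 t).
Hypothesis df1 : forall t : R, is_derive t 1 f1 (f2 t).
Hypothesis cf2 : continuous f2.

Let psi x := f (sqdist y x).

Let dpsi x : differentiable psi x.
Proof. by have [] := partial_comp (sqdist_diff y x).1 (df (sqdist y x)). Qed.

Lemma partial_radial i : partial i psi = fun x => f1 (sqdist y x) * (2 * (x - y) 0 i).
Proof.
apply/funext => x; have [_ ->] := partial_comp (sqdist_diff y x).1 (df (sqdist y x)).
by rewrite (sqdist_diff y x).2.
Qed.

Let dc i x : differentiable (fun x => 2 * (x - y) 0 i) x.
Proof. by apply: differentiableM; [exact: differentiable_cst|exact: (coordB_diff y x i).1]. Qed.

Let pc i j x : partial j (fun x => 2 * (x - y) 0 i) x = 2 * (j == i)%:R.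
Proof.
rewrite (@partialM (cst 2)); [|exact: differentiable_cst|exact: (coordB_diff y x i).1].
by rewrite (coordB_diff y x i).2 /partial derive_cst mulr0 addr0.
Qed.

Lemma partial2_radial i j : partial j (partial i psi) = fun x =>
  2 * f1 (sqdist y x) * (j == i)%:R + 4 * f2 (sqdist y x) * (x - y) 0 i * (x - y) 0 j.
Proof.
rewrite partial_radial; apply/funext => x.
have [d1 p1] := partial_comp (sqdist_diff y x).1 (df1 (sqdist y x)).
by rewrite partialM// p1 (sqdist_diff y x).2 pc; ring.
Qed.

Lemma Ck_radial A : Ck 2 A psi.
Proof.
split=> [x _|i /=]; first exact: dpsi.
split=> [x _|j x _].
  rewrite partial_radial; apply: differentiableM; last exact: dc.
  by have [] := partial_comp (sqdist_diff y x).1 (df1 (sqdist y x)).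
rewrite partial2_radial.
have cs : {for x, continuous (sqdist y)} by apply: differentiable_continuous; exact: (sqdist_diff y x).1.
have cz k : {for x, continuous (fun x => (x - y) 0 k)}.
  by apply: differentiable_continuous; exact: (coordB_diff y x k).1.
have cf1 : {for sqdist y x, continuous f1}.
  by apply: differentiable_continuous; apply/derivable1_diffP; exact: (@ex_derive _ _ _ _ _ _ _ (df1 _)).
have c1 : {for x, continuous (fun x => f1 (sqdist y x))} by apply: continuous_comp.
have c2 : {for x, continuous (fun x => f2 (sqdist y x))}.
  by apply: continuous_comp => //; exact: cf2.
apply: continuousD.
  by apply: continuousM; [apply: continuousM => //|]; exact: cst_continuous.
apply: continuousM => //; apply: continuousM => //; apply: continuousM => //.
exact: cst_continuous.
Qed.

(** With z = x - y the gradient is 2 f1 z and the Hessian is 2 f1 times the identity plus 4 f2 times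
    the tensor square of z, so only |z|^2 survives. *)
Lemma infty_laplacian_radial x : infty_laplacian psi x =
  4 * f1 (sqdist y x) ^+ 2 * sqdist y x *
  (2 * f1 (sqdist y x) + 4 * f2 (sqdist y x) * sqdist y x).
Proof.
rewrite /infty_laplacian; set s := sqdist y x; set a := f1 s; set b := f2 s.
pose z i := (x - y) 0 i.
have sE : s = \sum_i z i * z i by [].
under eq_bigr => i _.
  under eq_bigr => j _.
    rewrite partial2_radial !partial_radial -/s -/a -/b -/(z i) -/(z j).
    rewrite (_ : _ * _ = 8 * a ^+ 3 * (z i * z j * (i == j)%:R) + 16 * a ^+ 2 * b * (z i * z i) * (z j * z j)).
      over.
    by ring.
  rewrite big_split /= -!mulr_sumr -sE (bigD1 i)//= big1 ?addr0 => [|j ji]; last first.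
    by rewrite eq_sym (negbTE ji) mulr0.
  rewrite eqxx mulr1; over.
by rewrite big_split /= -!mulr_sumr -mulr_suml -mulr_sumr -sE; ring.
Qed.

End radial.

(* [v] is a viscosity subsolution as far as radial test functions can tell. *)
Definition radial_subsolution Omega v := forall y (f f1 f2 : R -> R),
  (forall t : R, is_derive t 1 f (f1 t)) -> (forall t : R, is_derive t 1 f1 (f2 t)) ->
  continuous f2 -> forall x, Omega x ->
  (\forall z \near x, v z - f (sqdist y z) <= v x - f (sqdist y x)) ->
  0 <= f1 (sqdist y x) ^+ 2 * sqdist y x *
    (2 * f1 (sqdist y x) + 4 * f2 (sqdist y x) * sqdist y x).

(** The operator is odd, so a test of [- v] from above by [f] is a test of [v] from below by
    [- f]. *)
Lemma viscosity_radial_subsolution Omega v : viscosity_solution Omega v ->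
  radial_subsolution Omega v /\ radial_subsolution Omega (fun x => - v x).
Proof.
move=> [_ sub sup]; split=> y f f1 f2 df df1 cf2 x Ox vx.
  have := sub _ (Ck_radial y df df1 cf2 Omega) x Ox vx.
  by rewrite (infty_laplacian_radial _ df df1) -!mulrA pmulr_rge0// !mulrA.
have dfN (t : R) : is_derive t 1 (fun t => - f t) (- f1 t) by exact: is_deriveN.
have df1N (t : R) : is_derive t 1 (fun t => - f1 t) (- f2 t) by exact: is_deriveN.
have cf2N : continuous (fun t => - f2 t) by move=> t; apply: continuousN; exact: cf2.
have := sup _ (Ck_radial y dfN df1N cf2N Omega) x Ox.
rewrite (infty_laplacian_radial _ dfN df1N).
have vx' : \forall z \near x, v x - - f (sqdist y x) <= v z - - f (sqdist y z).
  by apply: filterS vx => z; lra.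
move=> /(_ vx'); set a := f1 _; set s := sqdist y x; set b := f2 _; lra.
Qed.

End radial_functions.

(** * Comparison with cones from above *)

Section cone_comparison.
Context {R : realType} {n : nat}.
Local Notation V := 'rV[R]_n.
Implicit Types (v : V -> R) (x y z h : V) (Omega A : set V).

(** The derivative is again of this form, with last coefficient 0, so one lemma supplies both
    derivatives. *)
Definition cubic (c0 c1 c2 c3 t : R) : R := c0 + c1 * t + c2 * (t * t) + c3 * (t * t * t).

Lemma is_derive_cubic (c0 c1 c2 c3 t : R) :
  is_derive t 1 (cubic c0 c1 c2 c3) (cubic c1 (2 * c2) (3 * c3) 0 t).
Proof.
have d0 : is_derive t (1 : R) (cst c0) 0 := is_derive_cst _ _ _.
have d1 : is_derive t (1 : R) (@id R) 1 := is_derive_id _ _.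
have d2 : is_derive t (1 : R) (@id R * @id R) (t *: 1 + t *: 1) by apply: is_deriveM.
have d3 : is_derive t (1 : R) (@id R * @id R * @id R) ((t * t) *: 1 + t *: (t *: 1 + t *: 1)).
  by apply: is_deriveM.
have e1 : is_derive t (1 : R) (c1 *: @id R) (c1 *: 1) by apply: is_deriveZ.
have e2 : is_derive t (1 : R) (c2 *: (@id R * @id R)) (c2 *: (t *: 1 + t *: 1)).
  by apply: is_deriveZ.
have e3 : is_derive t (1 : R) (c3 *: (@id R * @id R * @id R))
    (c3 *: ((t * t) *: 1 + t *: (t *: 1 + t *: 1))) by apply: is_deriveZ.
apply: (is_derive_eq (is_deriveD (is_deriveD (is_deriveD d0 e1) e2) e3)).
by rewrite /GRing.scale /= /cubic; ring.
Qed.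

Lemma continuous_cubic (c0 c1 c2 c3 : R) : continuous (cubic c0 c1 c2 c3).
Proof.
move=> t; apply: differentiable_continuous; apply/derivable1_diffP.
exact: (@ex_derive _ _ _ _ _ _ _ (is_derive_cubic _ _ _ _ _)).
Qed.

Lemma continuous_enormB y : continuous (fun x => enorm (x - y)).
Proof.
move=> x; apply: (@continuous_comp _ _ _ (fun x => x - y) (@enorm R n)).
  by apply: continuousB; [exact: id|exact: cst_continuous].
exact: continuous_enorm.
Qed.

Lemma compact_eball y (r : R) : compact [set x : V | enorm (x - y) <= r].
Proof.
apply: bounded_closed_compact.
  exists (`|y| + r); split; first exact: num_real.
  move=> M hM x /= xr; apply: ltW; apply: le_lt_trans hM.
  rewrite -[x](subrK y) addrC (le_trans (ler_normD _ _))// lerD2l.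
  exact: le_trans (norm_le_enorm _) xr.
have /continuous_closedP cc := @continuous_enormB y.
exact: (cc _ (@closed_le R r)).
Qed.

(* The barrier a rho - c rho^2, with rho = |x - y|, is replaced near the
   contact point by a polynomial in rho^2: the cubic Taylor polynomial of the
   square root at s0, which dominates it on the half-line t >= 0. *)
Lemma sqrt_le_cubic (s0 t : R) : 0 < s0 -> 0 <= t ->
  Num.sqrt t <= Num.sqrt s0 / 16 * cubic 5 (15 / s0) (- 5 / s0 ^+ 2) (s0 ^- 3) t.
Proof.
move=> s00 t0; pose k := t / s0; have k0 : 0 <= k by rewrite divr_ge0// ltW.
have -> : cubic 5 (15 / s0) (- 5 / s0 ^+ 2) (s0 ^- 3) t = 5 + 15 * k - 5 * k ^+ 2 + k ^+ 3.
  by rewrite /cubic /k; field; rewrite gt_eqF.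
have P0 : 0 <= 5 + 15 * k - 5 * k ^+ 2 + k ^+ 3.
  have -> : 5 + 15 * k - 5 * k ^+ 2 + k ^+ 3 = 5 + k * ((k - 5 / 2) ^+ 2 + 35 / 4) by field.
  by rewrite addr_ge0// mulr_ge0// addr_ge0// sqr_ge0.
have -> : t = s0 * k by rewrite /k mulrCA divff ?mulr1// gt_eqF.
rewrite sqrtrM ?(ltW s00)// -mulrA ler_wpM2l ?sqrtr_ge0// ler_pdivlMl// mulrC.
have -> : Num.sqrt k * 16 = Num.sqrt (k * 256).
  have E16 : (256 : R) = 16 ^+ 2 by ring.
  by rewrite E16 (sqrtrM _ k0) sqrtr_sqr ger0_norm.
rewrite -(ger0_norm P0) -sqrtr_sqr ler_wsqrtr// -subr_ge0.
(* The fourfold zero at k = 1 reflects the contact of the cubic Taylor polynomial with the square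
   root; the other factor is positive. *)
rewrite (_ : _ - _ = (k - 1) ^+ 4 * ((k - 3) ^+ 2 + 16)); last by ring.
by rewrite mulr_ge0 ?exprn_even_ge0// addr_ge0// sqr_ge0.
Qed.

(** The cone is bent into a strictly concave radial barrier [g]. If [v - g] exceeded its value at
    [y], its maximum over the ball would lie off both [y] and the sphere, and a smooth function
    touching [v] from above there would have negative infinity-Laplacian. *)
Lemma cone_comparison Omega v y (r S : R) : radial_subsolution Omega v ->
  (forall x, Omega x -> {for x, continuous v}) -> 0 < r -> 0 <= S ->
  (forall x, enorm (x - y) <= r -> Omega x) ->
  (forall x, enorm (x - y) <= r -> v x <= v y + S * r) ->
  forall x, enorm (x - y) <= r -> v x <= v y + S * enorm (x - y).
Proof.
move=> subv cv r0 S0 ballO vS x1 x1r; apply/ler_addgt0Pr => e e0.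
(* With these constants [g] equals [(S + eta) * r] at radius [r], which beats the boundary bound,
   while inside the ball it exceeds the cone of slope [S] by at most [e]. *)
pose eta := e / (2 * r); have eta0 : 0 < eta by rewrite divr_gt0// mulr_gt0.
pose c := eta / (2 * r); have c0 : 0 < c by rewrite divr_gt0// mulr_gt0.
pose a := S + eta + c * r; have a0 : 0 < a.
  by apply: addr_gt0; [exact: ltr_wpDl|exact: mulr_gt0].
pose g (t : R) := a * t - c * t ^+ 2.
pose W x := v x - g (enorm (x - y)).
have cr : c * r = eta / 2 by rewrite /c; field; rewrite gt_eqF.
suff Wx1 : W x1 <= v y.
  have : v x1 <= v y + g (enorm (x1 - y)) by move: Wx1; rewrite /W lerBlDr.
  move=> h; apply: (le_trans h); rewrite -addrA lerD2l /g /a cr.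
  have h1 : 0 <= c * enorm (x1 - y) ^+ 2 by rewrite mulr_ge0 ?sqr_ge0// ltW.
  have h2 : (eta * 2) * enorm (x1 - y) <= (eta * 2) * r by rewrite ler_wpM2l// mulr_ge0// ltW.
  have h3 : (eta * 2) * r = e by rewrite /eta; field; rewrite gt_eqF.
  have h4 : 0 <= eta * enorm (x1 - y) by rewrite mulr_ge0 ?enorm_ge0// ltW.
  lra.
rewrite leNgt; apply/negP => Wx1.
have cW x : enorm (x - y) <= r -> {for x, continuous W}.
  move=> /ballO/cv cvx; apply: continuousB => //.
  apply: (@continuous_comp _ _ _ (fun x => enorm (x - y)) g); first exact: continuous_enormB.
  have -> : g = cubic 0 a (- c) 0 by apply/funext => t; rewrite /g /cubic; ring.
  exact: continuous_cubic.
have [|||z zr zmax] := @EVT_max_rV R n W [set x | enorm (x - y) <= r]; first by exists x1.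
- exact: compact_eball.
- by rewrite continuous_subspace_in => x; rewrite inE => xr; apply: continuous_subspaceT_for => //; exact: cW.
rewrite inE /= in zr.
have {}zmax x : enorm (x - y) <= r -> W x <= W z by move=> xr; apply: zmax; rewrite inE.
have Wz : v y < W z by apply: lt_le_trans (zmax x1 x1r).
pose rho := enorm (z - y).
have rho0 : 0 < rho.
  rewrite lt_neqAle enorm_ge0 andbT eq_sym; apply/eqP => z0.
  move: Wz; rewrite /W /g -/rho z0; have /eqP := z0; rewrite enorm_eq0 subr_eq0 => /eqP ->.
  by rewrite expr2 !mulr0 !subr0 ltxx.
have rhor : rho < r.
  rewrite lt_neqAle zr andbT; apply/eqP => zrE.
  move: Wz; rewrite /W /g -/rho zrE; have := vS z zr.
  rewrite /a expr2 mulrA cr.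
  have : 0 < eta * r by rewrite mulr_gt0.
  lra.
pose s0 := sqdist y z.
have s0E : s0 = rho ^+ 2 by rewrite /rho sqr_enorm.
have s00 : 0 < s0 by rewrite s0E exprn_gt0.
have rs0 : Num.sqrt s0 = rho by [].
pose A := a * rho / 16.
pose k0 := A * 5; pose k1 := A * (15 / s0) - c.
pose k2 := A * (- 5 / s0 ^+ 2); pose k3 := A * s0 ^- 3.
have fE t : cubic k0 k1 k2 k3 t =
    a * (rho / 16 * cubic 5 (15 / s0) (- 5 / s0 ^+ 2) (s0 ^- 3) t) - c * t.
  by rewrite /k0 /k1 /k2 /k3 /A /cubic; field; rewrite gt_eqF.
have fg x : g (enorm (x - y)) <= cubic k0 k1 k2 k3 (sqdist y x).
  rewrite fE /g sqr_enorm lerD2r ler_wpM2l ?(ltW a0)// -rs0 sqrt_le_cubic// dotp_ge0//.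
have fgz : cubic k0 k1 k2 k3 s0 = g rho.
  rewrite /k0 /k1 /k2 /k3 /A /cubic /g -s0E; field; rewrite gt_eqF//.
have := subv y _ _ _ (is_derive_cubic k0 k1 k2 k3) (is_derive_cubic _ _ _ _)
  (@continuous_cubic _ _ _ _) z (ballO z zr).
have near_z : \forall x \near z, v x - cubic k0 k1 k2 k3 (sqdist y x) <=
    v z - cubic k0 k1 k2 k3 (sqdist y z).
  have : \forall x \near z, enorm (x - y) < r.
    have /(_ z) := @continuous_enormB y; move/cvgrPdist_lt => /(_ (r - rho)).
    rewrite subr_gt0 => /(_ rhor); apply: filterS => x.
    rewrite -/rho distrC ltr_norml => /andP[_]; lra.
  apply: filterS => x /ltW xr; rewrite -/s0 fgz.
  by apply: le_trans (zmax x xr); rewrite /W lerD2l lerN2.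
move=> /(_ near_z); rewrite -/s0.
(* At [s0] the first two derivatives are those of the barrier. In the operator the terms with [a]
   cancel, as cones are infinity-harmonic off their vertex, and the bending leaves [- (2 * c)]. *)
have -> : cubic k1 (2 * k2) (3 * k3) 0 s0 = a / (2 * rho) - c.
  by rewrite /cubic /k1 /k2 /k3 /A s0E; field; rewrite gt_eqF.
have -> : cubic (2 * k2) (2 * (3 * k3)) (3 * 0) 0 s0 = - a / (4 * rho ^+ 3).
  by rewrite /cubic /k2 /k3 /A s0E; field; rewrite gt_eqF.
have -> : 2 * (a / (2 * rho) - c) + 4 * (- a / (4 * rho ^+ 3)) * s0 = - (2 * c).
  by rewrite s0E; field; rewrite gt_eqF.
rewrite mulrN oppr_ge0 leNgt => /negP; apply.
apply: mulr_gt0; last exact: mulr_gt0.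
apply: mulr_gt0 => //; rewrite exprn_even_gt0//= subr_eq0 gt_eqF//.
suff : c < a / (2 * rho) by [].
rewrite ltr_pdivlMr ?mulr_gt0// /a.
have : c * rho < c * r by rewrite ltr_pM2l.
have : c * r < eta by rewrite cr; lra.
lra.
Qed.

End cone_comparison.

(** * Steepest ascent *)

Section steepest_ascent.
Context {R : realType} {n : nat}.
Local Notation V := 'rV[R]_n.
Local Notation mu := (@lebesgue_rV R n).
Implicit Types (v h : V -> R) (D E : V -> V) (x y z : V) (Omega O : set V).

Definition cone_comparable Omega v := forall y (r S : R), 0 < r -> 0 <= S ->
  (forall x, enorm (x - y) <= r -> Omega x) ->
  (forall x, enorm (x - y) <= r -> v x <= v y + S * r) ->
  forall x, enorm (x - y) <= r -> v x <= v y + S * enorm (x - y).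

(** The slope must exceed [K] at every admissible radius, so its failure provides one ball with
    slope at most [K], all that cone comparison needs. *)
Definition steep O v (K : R) z := forall r : R, 0 < r ->
  (forall x, enorm (x - z) <= r -> O x) ->
  exists2 x, enorm (x - z) <= r & v z + K * r < v x.

Lemma eball_segment O z x (r : R) : (forall x, enorm (x - z) <= r -> O x) ->
  enorm (x - z) <= r -> segment_in O z x.
Proof.
move=> ballO xr t /andP[t0 t1]; apply: ballO; rewrite addrC addKr enormZ ger0_norm//.
by apply: le_trans xr; rewrite ler_piMl ?enorm_ge0.
Qed.

(** At a point that is not steep, comparison turns the bound on one ball into a cone of slope [K],
    which is the forward local bound required by [lipschitz_chaining]. *)
Lemma not_steep_lipschitz Omega O v (K : R) : 0 <= K -> cone_comparable Omega v ->
  (forall x, Omega x -> {for x, continuous v}) -> O `<=` Omega ->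
  (forall z, O z -> ~ steep O v K z) ->
  forall x y, segment_in O x y -> v y - v x <= K * enorm (y - x).
Proof.
move=> K0 ccv cv OO nsteep x y Oxy.
pose f (s : R) := v (x + s *: (y - x)).
have := @lipschitz_chaining R f (K * enorm (y - x)).
rewrite /f scale1r scale0r addr0 subrKC; apply => t t01; have Oz := Oxy t t01.
  apply: (@continuous_comp _ _ _ (fun s : R => x + s *: (y - x)) v); last exact/cv/OO.
  apply: continuousD; first exact: cst_continuous.
  by apply: continuousZr_tmp; exact: id.
set z := x + t *: (y - x) in Oz *.
have [r r0 [ballO vK]] : exists2 r : R, 0 < r & (forall a, enorm (a - z) <= r -> O a) /\
    forall a, enorm (a - z) <= r -> v a <= v z + K * r.
  have /existsNP[r /not_implyP[r0 /not_implyP[ballO nx]]] := nsteep z Oz.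
  exists r => //; split=> // a ar; rewrite leNgt; apply/negP => av.
  by apply: nx; exists a.
have e0 : 0 < enorm (y - x) + 1 by rewrite ltr_wpDl ?enorm_ge0.
exists (r / (enorm (y - x) + 1)); first by rewrite divr_gt0.
move=> s /andP[ts s1] str.
have wz : x + s *: (y - x) - z = (s - t) *: (y - x).
  by rewrite /z opprD addrACA subrr add0r scalerBl.
have wr : enorm (x + s *: (y - x) - z) <= r.
  rewrite wz enormZ ger0_norm ?subr_ge0//.
  move: str; rewrite ltr_pdivlMr// => /ltW; apply: le_trans.
  by rewrite ler_wpM2l ?subr_ge0// lerDl.
have := ccv z r K r0 K0 (fun a ar => OO _ (ballO a ar)) vK _ wr.
rewrite wz enormZ ger0_norm ?subr_ge0// lerBlDl => h; apply: (le_trans h).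
by rewrite lerD2l mulrA mulrAC.
Qed.

(* The maximum of v over a ball around a steep point is attained at a point
   that is steep again: seen from a point just before the maximizer, v has
   already the slope S > K. *)
Lemma steep_step Omega O v (K r : R) z : 0 <= K -> cone_comparable Omega v ->
  (forall x, Omega x -> {for x, continuous v}) -> O `<=` Omega -> steep O v K z ->
  0 < r -> (forall x, enorm (x - z) <= r -> O x) ->
  exists z1, [/\ enorm (z1 - z) <= r, v z + K * r < v z1 & steep O v K z1].
Proof.
move=> K0 ccv cv OO sz r0 ballO.
have ballW x : enorm (x - z) <= r -> Omega x by move=> /ballO/OO.
have zz : enorm (z - z) <= r by rewrite subrr enorm0 ltW.
have [|||z1 z1r zmax] := @EVT_max_rV R n v [set x | enorm (x - z) <= r]; first by exists z.
- exact: compact_eball.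
- rewrite continuous_subspace_in => x; rewrite inE => xr; apply: continuous_subspaceT_for => //.
  exact/cv/ballW.
rewrite inE /= in z1r.
have {}zmax x : enorm (x - z) <= r -> v x <= v z1 by move=> xr; apply: zmax; rewrite inE.
have [x0 x0r vx0] := sz r r0 ballO.
have vz1 : v z + K * r < v z1 := lt_le_trans vx0 (zmax _ x0r).
exists z1; split=> // s s0 balls.
pose S := (v z1 - v z) / r.
have SE : S * r = v z1 - v z by rewrite /S divfK// gt_eqF.
have KS : K < S by rewrite /S ltr_pdivlMr// ltrBrDl.
have S0 : 0 < S := le_lt_trans K0 KS.
clearbody S.
(* So small that stepping back by [sg] costs at most half of the surplus [s * (S - K)]; this is
   [key]. *)
pose sg := Num.min r (s * (S - K) / (4 * S)).
have sg0 : 0 < sg by rewrite lt_min r0 divr_gt0// mulr_gt0// subr_gt0.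
have sgr : sg <= r by rewrite ge_min lexx.
have sgS : S * (4 * sg) <= s * (S - K).
  have : sg <= s * (S - K) / (4 * S) by rewrite ge_min lexx orbT.
  by rewrite ler_pdivlMr ?mulr_gt0//; lra.
clearbody sg.
have sK : 0 <= s * K by rewrite mulr_ge0// ltW.
have sS : 0 < s * S by rewrite mulr_gt0.
have sgs : 2 * sg < s.
  have : S * (4 * sg) <= S * s by lra.
  by rewrite ler_pM2l//; lra.
have key : K * s < S * (s - 2 * sg).
  have : 0 < s * (S - K) by rewrite mulr_gt0// subr_gt0.
  lra.
(* Stepping back from [z1] towards [z] brings [x] strictly closer to [z]; comparison with the cone
   of slope [S] at [z] makes [v] lower there than at [z1] by at least [S * sg]. *)
pose x := z1 + (sg / r) *: (z - z1).
have q0 : 0 <= sg / r by rewrite divr_ge0// ltW.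
have q1 : sg / r <= 1 by rewrite ler_pdivrMr// mul1r.
have xz1 : enorm (x - z1) <= sg.
  rewrite /x [z1 + _]addrC addrK enormZ ger0_norm// enormC.
  by rewrite -[leRHS](divfK (lt0r_neq0 r0)) ler_wpM2l.
have xz : enorm (x - z) <= r - sg.
  rewrite (_ : x - z = (1 - sg / r) *: (z1 - z)); last first.
    by apply/rowP => i; rewrite /x !mxE; ring.
  rewrite enormZ ger0_norm ?subr_ge0//.
  rewrite (_ : r - sg = (1 - sg / r) * r); last by field; rewrite gt_eqF.
  by rewrite ler_wpM2l// subr_ge0.
have vx : v x <= v z1 - S * sg.
  have h := ccv z r S r0 (ltW S0) ballW.
  have xr : enorm (x - z) <= r by rewrite (le_trans xz)// gerBl ltW.
  have {}h H := h H x.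
  have : v x <= v z + S * enorm (x - z).
    by apply: h => // a ar; rewrite SE addrCA subrr addr0 zmax.
  have : S * enorm (x - z) <= S * (r - sg) by rewrite ler_wpM2l// ltW.
  lra.
apply: contrapT => nx.
have vs a : enorm (a - z1) <= s -> v a <= v z1 + K * s.
  by move=> az; rewrite leNgt; apply/negP => va; apply: nx; exists a.
pose rho := s - sg; have rho0 : 0 < rho by rewrite subr_gt0; lra.
have ballrho a : enorm (a - x) <= rho -> enorm (a - z1) <= s.
  move=> ax; rewrite -(subrK x a) -addrA (le_trans (enormD _ _))//.
  rewrite /rho in ax; lra.
(* If [z1] failed to be steep at radius [s], comparison around [x] with slope [Q] would bound
   [v z1 - v x] by [Q * sg]. Solved for that difference, this gives S (s - 2 sg) <= K s, against
   [key]. *)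
pose Q := (v z1 - v x + K * s) / rho.
have QE : Q * rho = v z1 - v x + K * s by rewrite /Q divfK// gt_eqF.
have d0 : 0 <= v z1 - v x.
  have : 0 < S * sg by rewrite mulr_gt0.
  lra.
have Q0 : 0 <= Q by rewrite divr_ge0 ?(ltW rho0)// addr_ge0// mulr_ge0// ltW.
have z1x : enorm (z1 - x) <= rho by rewrite enormC /rho; lra.
have := ccv x rho Q rho0 Q0 (fun a ar => OO _ (balls a (ballrho a ar))) _ z1 z1x.
have hQ a : enorm (a - x) <= rho -> v a <= v x + Q * rho.
  by move=> /ballrho/vs; rewrite QE; lra.
move=> /(_ hQ) h.
have h1 : v z1 - v x <= Q * sg.
  have : Q * enorm (z1 - x) <= Q * sg by rewrite ler_wpM2l// enormC.
  lra.
have h2 : (v z1 - v x) * rho <= sg * (v z1 - v x + K * s).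
  rewrite -QE (le_trans (ler_wpM2r (ltW rho0) h1))//; lra.
have h3 : (v z1 - v x) * (s - 2 * sg) <= sg * (K * s).
  by move: h2; rewrite /rho; lra.
have h4 : S * sg * (s - 2 * sg) <= (v z1 - v x) * (s - 2 * sg).
  by rewrite ler_wpM2r//; lra.
have : sg * (K * s) < sg * (S * (s - 2 * sg)) by rewrite ltr_pM2l.
lra.
Qed.

Lemma no_steep_point Omega v h (K L B : R) z : let O := [set x | h x < 0] in
  0 <= L -> L < K -> cone_comparable Omega v ->
  (forall x, Omega x -> {for x, continuous v}) -> O `<=` Omega ->
  (forall e : R, 0 < e -> exists2 d : R, 0 < d &
     forall x y, enorm (x - y) <= d -> `|h x - h y| < e) ->
  (forall x, - B <= h x) ->
  (forall x y, segment_in O x y -> v y + h y - (v x + h x) <= L * enorm (y - x)) ->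
  O z -> steep O v K z -> False.
Proof.
move=> O L0 LK ccv cv OO hu hB wL Oz sz.
have K0 : 0 <= K by apply: le_trans (ltW LK).
(* Since [h] never rises above [h z] along the path, the tolerance [- h z] keeps every later ball in
   the negativity set, so one radius serves all steps. *)
have [r r0 hr] := hu (- h z) ltac:(by rewrite oppr_gt0).
have step k : exists x, [/\ h x <= h z - k%:R * ((K - L) * r), h x <= h z & steep O v K x].
  elim: k => [|k [x [hx hxz sx]]]; first by exists z; split; rewrite ?mul0r ?subr0.
  have ballO y : enorm (y - x) <= r -> O y.
    move=> /hr; rewrite ltr_norml => /andP[_]; rewrite /O /=; lra.
  have [y [yr vy sy]] := steep_step K0 ccv cv OO sx r0 ballO.
  have := wL x y (eball_segment ballO yr).
  have : L * enorm (y - x) <= L * r by rewrite ler_wpM2l.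
  have : 0 < (K - L) * r by rewrite mulr_gt0// subr_gt0.
  rewrite -natr1; exists y; split => //; lra.
have KLr : 0 < (K - L) * r by rewrite mulr_gt0// subr_gt0.
have [x [hx _ _]] := step (Num.truncn ((h z + B) / ((K - L) * r))).+1.
have := truncnS_gt ((h z + B) / ((K - L) * r)); rewrite ltr_pdivrMr//.
have := hB x; lra.
Qed.

Lemma enorm_uniform_continuous h : (forall e : R, 0 < e -> exists2 d : R, 0 < d &
  forall x y, enorm (x - y) <= d -> `|h x - h y| < e) -> continuous h.
Proof.
move=> hu x; apply/(@cvgrPdist_lt _ _ _ (nbhs x) _ h (h x)) => e /hu[d d0 hd].
have n1 : 0 < n%:R + 1 :> R by rewrite ltr_wpDl.
have d1 : 0 < d / (n%:R + 1) by rewrite divr_gt0.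
apply/nbhs_ballP; exists (d / (n%:R + 1)) => //= y; rewrite -ball_normE /= => xy.
apply: hd; rewrite (le_trans (enorm_le_norm _))//.
move: (ltW xy); rewrite ler_pdivlMr//; apply: le_trans.
by rewrite mulrC ler_wpM2l// lerDl.
Qed.

Lemma norm_ball_segment x (r : R) y z : `|x - y| < r -> `|x - z| < r ->
  segment_in [set w | `|x - w| < r] y z.
Proof.
move=> xy xz t /andP[t0 t1] /=.
rewrite (_ : x - _ = (1 - t) *: (x - y) + t *: (x - z)); last first.
  by apply/rowP => i; rewrite !mxE; ring.
rewrite (le_lt_trans (ler_normD _ _))// !normrZ !ger0_norm ?subr_ge0//.
have h1 : (1 - t) * `|x - y| <= (1 - t) * Num.max `|x - y| `|x - z|.
  by rewrite ler_wpM2l ?subr_ge0// le_max lexx.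
have h2 : t * `|x - z| <= t * Num.max `|x - y| `|x - z|.
  by rewrite ler_wpM2l// le_max lexx orbT.
have : Num.max `|x - y| `|x - z| < r by rewrite gt_max xy.
lra.
Qed.

Section perturbation.
Variables (Omega : set V) (D : V -> V) (C K L : R).
Hypotheses (lD : lbmv D) (DC : forall i x, `|D x 0 i| <= C).
Hypotheses (L0 : 0 <= L) (LK : L < K).

(** The bound on the gradient of [v + h] bounds its increments, which rules out steep points; [v] is
    then locally [K]-Lipschitz, and [lipschitz_wgrad_le] returns to its gradient. *)
Lemma perturbed_gradient_lt0 v h E (B : R) : lbm v -> wgrad Omega v D ->
  (forall x, Omega x -> {for x, continuous v}) -> cone_comparable Omega v ->
  lbm h -> lbmv E -> (forall x, - B <= h x) ->
  (forall e : R, 0 < e -> exists2 d : R, 0 < d &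
     forall x y, enorm (x - y) <= d -> `|h x - h y| < e) ->
  [set x | h x < 0] `<=` Omega -> wgrad [set x | h x < 0] h E ->
  (\forall x \ae mu, h x < 0 -> enorm (D x + E x) <= L) ->
  \forall x \ae mu, h x < 0 -> enorm (D x) <= K.
Proof.
set O := [set x | h x < 0].
move=> lv wD cv ccv lh lE hB hu OO wE DEL.
have K0 : 0 <= K by apply: le_trans (ltW LK).
have ch := enorm_uniform_continuous hu.
have oO' : open O.
  by have /continuousP := ch; move=> /(_ _ (@open_lt R 0)).
have wL x y : segment_in O x y -> v y + h y - (v x + h x) <= L * enorm (y - x).
  move=> Oxy.
  have w1 : wgrad O (fun x => v x + 1 * h x) (fun x => D x + 1 *: E x).
    by apply: wgrad_linear => //; exact: wgrad_sub wD.
  have := wgrad_lipschitz oO' _ _ w1 L0 _ _ Oxy; rewrite !mul1r; apply.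
  - by apply: lbmD => //; apply: lbmZ.
  - by move=> i; under eq_fun do rewrite mxE [X in _ + X]mxE; apply: lbmD => //; exact: lbmZ.
  - by apply: filterS DEL => z; rewrite scale1r.
  - by move=> z Oz; apply: continuousD; [exact/cv/OO|apply: continuousM; [exact: cst_continuous|exact: ch]].
have nsteep z : O z -> ~ steep O v K z.
  by move=> Oz sz; exact: (no_steep_point L0 LK ccv cv OO hu hB wL Oz sz).
have vK := not_steep_lipschitz K0 ccv cv OO nsteep.
apply: (lipschitz_wgrad_le oO' lv lD DC (wgrad_sub OO wD) K0) => x Ox.
have [r r0 rO] := nbhs_norm_ball oO' Ox; exists r => //; split.
  by move=> y xy; apply: rO; apply: (lt_le_trans xy); rewrite ler_peMl ?(ltW r0)// ler1n.
have half y z : `|x - y| < r -> `|x - z| < r -> v z - v y <= K * enorm (z - y).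
  move=> xy xz; apply: vK => t t01; apply: rO.
  apply: (lt_le_trans (norm_ball_segment xy xz t01)).
  by rewrite ler_peMl ?(ltW r0)// ler1n.
move=> y z xy xz; rewrite ler_norml half// andbT.
by rewrite lerNl opprB enormC half.
Qed.

End perturbation.

Lemma perturbed_gradient Omega v D h E (C K L B : R) : lbmv D ->
  (forall i x, `|D x 0 i| <= C) -> 0 <= L -> L < K -> lbm v -> wgrad Omega v D ->
  (forall x, Omega x -> {for x, continuous v}) ->
  cone_comparable Omega v -> cone_comparable Omega (fun x => - v x) ->
  lbm h -> lbmv E -> (forall x, `|h x| <= B) ->
  (forall e : R, 0 < e -> exists2 d : R, 0 < d &
     forall x y, enorm (x - y) <= d -> `|h x - h y| < e) ->
  let O := [set x | h x != 0] in O `<=` Omega -> wgrad O h E ->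
  (\forall x \ae mu, O x -> enorm (D x + E x) <= L) ->
  \forall x \ae mu, O x -> enorm (D x) <= K.
Proof.
move=> lD DC L0 LK lv wD cv ccv ccvN lh lE hB hu O OO wE DEL.
have negO : [set x | h x < 0] `<=` O by move=> x /lt_eqF/negbT.
have posO : [set x | - h x < 0] `<=` O by move=> x /lt_eqF/negbT; rewrite /O /= oppr_eq0.
have hB' x : - B <= h x by have := hB x; rewrite ler_norml => /andP[].
have hB'' x : - B <= - h x by rewrite lerN2; have := hB x; rewrite ler_norml => /andP[].
have neg : \forall x \ae mu, h x < 0 -> enorm (D x) <= K.
  apply: (perturbed_gradient_lt0 lD DC L0 LK lv wD cv ccv lh lE hB' hu).
  - by move=> x /negO/OO.
  - exact: wgrad_sub wE.
  - by apply: filterS DEL => x h1 /negO.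
have pos : \forall x \ae mu, - h x < 0 -> enorm (- D x) <= K.
  apply: (perturbed_gradient_lt0 (lbmvN lD) _ L0 LK (lbmN lv) (wgradN lv lD wD) _ ccvN
    (lbmN lh) (lbmvN lE) hB'').
  - by move=> i x; rewrite mxE normrN; exact: DC.
  - by move=> x Ox; apply: continuousN; exact: cv.
  - by move=> e /hu[d d0 hd]; exists d => // x y /hd; rewrite -opprD normrN.
  - by move=> x /posO/OO.
  - by apply: wgrad_sub posO _; apply: wgradN.
  - by apply: filterS DEL => x h1 /posO/h1; rewrite -opprD enormN.
apply: filterS2 neg pos => x h1 h2 Ox.
have [hx|hx|hx] := ltgtP (h x) 0; first exact: h1.
  by rewrite -enormN; apply: h2; rewrite /= oppr_lt0.
by move: Ox; rewrite /O /= hx eqxx.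
Qed.

End steepest_ascent.

(** * The equivalence *)

Section representatives.
Context {R : realType} {n : nat}.
Local Notation V := 'rV[R]_n.
Local Notation mu := (@lebesgue_rV R n).
Implicit Types (f u v h phi psi : V -> R) (D E Du Dphi : V -> V) (x y z : V) (Omega O : set V).

Lemma ae_le_continuous f O (c : R) : open O -> (forall x, O x -> {for x, continuous f}) ->
  (\forall x \ae mu, O x -> f x <= c) -> forall x, O x -> f x <= c.
Proof.
move=> oO cf fc x Ox; rewrite leNgt; apply/negP => cx.
have : \forall y \near x, O y /\ c < f y.
  apply: filterI; first exact: open_nbhs_nbhs.
  by have := cf x Ox; move=> /cvgrPdist_lt/(_ (f x - c)); rewrite subr_gt0 => /(_ cx);
     apply: filterS => y; rewrite ltr_norml => /andP[_]; lra.
move=> /nbhs_ballP[e /= e0 AP]; pose A : set V := ball x e.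
have oA : open A by exact: ball_open.
have : (0 < mu A)%E by apply: lebesgue_open_gt0 => //; exists x; exact: ballxx.
suff -> : mu A = 0%E by rewrite ltxx.
have nA : mu.-negligible A.
  apply: negligibleS fc => y Ay /=; have [Oy cy] := AP y Ay.
  by move=> /(_ Oy); rewrite leNgt cy.
by apply/negligibleP => //; exact: open_measurable_rV.
Qed.

Lemma ae_eq_continuous v f Omega : open Omega ->
  (forall x, Omega x -> {for x, continuous v}) ->
  (forall x, Omega x -> {for x, continuous f}) ->
  (\forall x \ae mu, Omega x -> v x = f x) -> forall x, Omega x -> v x = f x.
Proof.
move=> oO cv cf vf x Ox; apply/eqP; rewrite eq_le -subr_le0 -[X in _ && X]subr_le0; apply/andP; split.
  apply: (@ae_le_continuous (fun x => v x - f x) Omega) => //.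
    by move=> y Oy; apply: continuousB; [exact: cv|exact: cf].
  by apply: filterS vf => y h /h ->; rewrite subrr.
apply: (@ae_le_continuous (fun x => f x - v x) Omega) => //.
  by move=> y Oy; apply: continuousB; [exact: cf|exact: cv].
by apply: filterS vf => y h /h ->; rewrite subrr.
Qed.

(** Values above the norm are replaced by 0 and [f] is extended by 0, so that measurability and the
    bound hold on the whole space. *)
Lemma Linfty_representative Omega f : open Omega -> Linfty Omega f ->
  exists (g : V -> R) (C : R), [/\ measurable_fun setT g, forall x, `|g x| <= C &
    \forall x \ae mu, Omega x -> f x = g x].
Proof.
move=> oO [mf fC]; have mO : measurable Omega by exact: open_measurable_rV.
have [C CE] : exists C : R, Linfty_norm Omega f = C%:E.
  have := Linfty_norm_ge0 Omega f; move: fC.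
  by case: (Linfty_norm Omega f) => // C _ _; exists C.
pose F := f \_ Omega.
have mF : measurable_fun setT F by apply/(measurable_restrictT f).
have C0 : 0 <= C by rewrite -lee_fin -CE Linfty_norm_ge0.
exists (fun x => if `|F x| <= C then F x else 0), C; split.
- apply: measurable_fun_if => //.
    by apply: measurable_fun_ler => //; exact: measurableT_comp.
  exact: measurable_funTS.
- by move=> x; case: ifP => // _; rewrite normr0.
- have := Linfty_norm_ae Omega f; apply: filterS => x h Ox.
  by have := h Ox; rewrite CE lee_fin /F patchT ?inE// => ->.
Qed.

Lemma W1infty_representative Omega u Du : open Omega -> W1infty Omega u Du ->
  exists (g : V -> R) (D : V -> V) (C : R), [/\ measurable_fun setT g /\ (forall x, `|g x| <= C),
    lbmv D, forall i x, `|D x 0 i| <= C, wgrad Omega g D &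
    \forall x \ae mu, Omega x -> u x = g x /\ Du x = D x].
Proof.
move=> oO [Lu LDu wDu]; have mO : measurable Omega by exact: open_measurable_rV.
have [g [C [mg gC ug]]] := Linfty_representative oO Lu.
have /choice[D_ D_P] i : exists p : (V -> R) * R, [/\ measurable_fun setT p.1,
    forall x, `|p.1 x| <= p.2 & \forall x \ae mu, Omega x -> Du x 0 i = p.1 x].
  by have [d [c [md dc dE]]] := Linfty_representative oO (LDu i); exists (d, c).
pose D x : V := \row_i (D_ i).1 x.
have DE i : (fun x => D x 0 i) = (D_ i).1 by apply/funext => x; rewrite mxE.
pose C' := Num.max C (\big[Num.max/0]_i (D_ i).2).
have DC i x : `|D x 0 i| <= C'.
  rewrite mxE; have [_ h _] := D_P i; rewrite (le_trans (h x))// le_max.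
  by rewrite (le_bigmax _ (fun j => (D_ j).2) i) orbT.
have lD : lbmv D.
  by move=> i; split; [rewrite DE; have [] := D_P i|move=> r; exists C' => x _; exact: DC].
have DuD : \forall x \ae mu, forall i, Omega x -> Du x 0 i = (D_ i).1 x.
  apply: filter_forall => i; by have [] := D_P i.
exists g, D, C'; split => //.
- by split=> // x; rewrite (le_trans (gC x))// le_max lexx.
- move=> zeta tz i; have tp := test_partial tz i.
  have := wDu zeta tz i.
  rewrite (RI_mkcond Omega (fun x => u x * _)) (RI_mkcond Omega (fun x => Du x 0 i * _)).
  have restrict f' f'' xi : measurable_fun Omega f' -> measurable_fun setT f'' ->
      test_function Omega xi -> (\forall x \ae mu, Omega x -> f' x = f'' x) ->
      \int[mu]_x (\1_Omega x * (f' x * xi x)) = \int[mu]_x (f'' x * xi x).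
    move=> mf' mf'' tx f'E; have mx := (test_lbm tx).1.
    have E x : \1_Omega x * (f' x * xi x) = (f' \_ Omega) x * xi x.
      by rewrite /patch indicE; case: (x \in Omega); rewrite ?mul1r ?mul0r.
    rewrite (eq_RI E); apply: RI_ae.
    + by apply: measurable_funM => //; apply/(measurable_restrictT f').
    + exact: measurable_funM.
    + apply: filterS f'E => x h; have [Ox|Ox] := pselect (Omega x).
        by rewrite patchT ?inE// h.
      by rewrite (test_eq0 tx Ox) !mulr0.
  rewrite (restrict u g)//; last exact: Lu.1.
  rewrite (restrict (fun x => Du x 0 i) (fun x => D x 0 i))//.
  + exact: (LDu i).1.
  + exact: (lD i).1.
  + by have [_ _] := D_P i; apply: filterS => x h /h ->; rewrite mxE.
- apply: filterS2 ug DuD => x h1 h2 Ox; split; first exact: h1.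
  by apply/rowP => i; rewrite h2// mxE.
Qed.

(** The approximating test functions are uniformly Cauchy at every point: the estimate in [Omega]
    passes from almost every point by continuity, and outside [Omega] they all vanish. Their limit
    is bounded, vanishes off [Omega] and is uniformly continuous, as each of them is Lipschitz. *)
Lemma W1infty0_representative Omega phi Dphi : open Omega -> W1infty0 Omega phi Dphi ->
  exists (h : V -> R) (B : R), [/\ forall x, `|h x| <= B,
    forall e : R, 0 < e -> exists2 d : R, 0 < d &
      forall x y, enorm (x - y) <= d -> `|h x - h y| < e,
    forall x, h x != 0 -> Omega x &
    \forall x \ae mu, Omega x -> phi x = h x].
Proof.
move=> oO [_ [F [tF cF _]]].
have tT j : test_function setT (F j) by apply: test_sub (tF j).
have small (e : R) : 0 < e -> exists N, forall j, (N <= j)%N ->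
    \forall x \ae mu, Omega x -> `|F j x - phi x| <= e.
  move=> e0; have : \forall j \near \oo, (Linfty_norm Omega ((F j \- phi)%R) < e%:E)%E.
    by apply: (cF [set y | (y < e%:E)%E]); apply: open_nbhs_nbhs; split;
      [exact: open_ereal_lt_ereal|rewrite /= lte_fin].
  move=> [N _ NP]; exists N => j Nj.
  have := Linfty_norm_ae Omega (F j \- phi); apply: filterS => x h Ox.
  by rewrite -lee_fin (le_trans (h Ox))// ltW// NP.
have unif (e : R) : 0 < e -> exists N, forall j k, (N <= j)%N -> (N <= k)%N ->
    forall x, `|F j x - F k x| <= e.
  move=> e0; have e20 : 0 < e / 2 by rewrite divr_gt0.
  have [N NP] := small _ e20; exists N => j k Nj Nk x.
  apply: (@ae_le_continuous (fun x => `|F j x - F k x|) setT) => //; first exact: openT.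
    move=> y _; apply: (@continuous_comp _ _ _ (fun x => F j x - F k x) Num.norm).
      by apply: continuousB; exact: test_continuous.
    exact: norm_continuous.
  apply: filterS2 (NP j Nj) (NP k Nk) => y h1 h2 _.
  have [Oy|Oy] := pselect (Omega y); last first.
    by rewrite !(test_eq0 (tF _) Oy) subrr normr0 ltW.
  rewrite -(subrKA (phi y)) (le_trans (ler_normD _ _))// (splitr e) lerD ?h1//.
  by rewrite distrC h2.
have cvgF x : cvgn (F ^~ x).
  apply/cauchy_cvgP/cauchy_ballP => e e0; have e40 : 0 < e / 4 by rewrite divr_gt0.
  have [N NP] := unif _ e40.
  exists ([set a | `|F N x - a| <= e / 4], [set a | `|F N x - a| <= e / 4]) => /=.
    by split; exists N => // k Nk; exact: NP.
  move=> [a b] /= [] /= ha hb; rewrite /ball /=.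
  rewrite -(subrKA (F N x)) (le_lt_trans (ler_normD _ _))// distrC; lra.
pose h x := lim (F j x @[j --> \oo]).
have Fh x : F j x @[j --> \oo] --> h x by exact: cvgF.
have close (e : R) : 0 < e -> exists N, forall j, (N <= j)%N -> forall x, `|F j x - h x| <= e.
  move=> e0; have [N NP] := unif e e0; exists N => j Nj x.
  have c : `|F j x - F k x| @[k --> \oo] --> `|F j x - h x|.
    by apply: cvg_norm; apply: cvgB; [exact: cvg_cst|exact: Fh].
  by apply: (ler_cvg_to c (cvg_cst e)); exists N => // k Nk; exact: NP.
have [N1 N1P] := close 1 ltr01; have [c Fc] := test_bounded (tT N1).
exists h, (c + 1); split.
- move=> x; rewrite -(subrK (F N1 x) (h x)) addrC (le_trans (ler_normD _ _))// lerD//.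
  by rewrite distrC N1P.
- move=> e e0; have e40 : 0 < e / 4 by rewrite divr_gt0.
  have [N NP] := close _ e40; have [k k0 Fk] := test_lipschitz (tT N).
  have k1 : 0 < k + 1 by rewrite ltr_wpDl.
  exists (e / 4 / (k + 1)); first by rewrite divr_gt0.
  move=> x y; rewrite ler_pdivlMr// => xy.
  have h1 := NP N (leqnn N) x; have h2 := NP N (leqnn N) y; rewrite distrC in h1.
  have h3 : `|F N x - F N y| <= e / 4.
    rewrite (le_trans (Fk x y))// (le_trans _ xy)// mulrC ler_pM//; last by rewrite lerDl.
    exact: norm_le_enorm.
  have := ler_normD (h x - F N x) (F N x - h y); rewrite subrKA.
  have := ler_normD (F N x - F N y) (F N y - h y); rewrite subrKA.
  lra.
- move=> x; apply: contra_neqP => Ox; rewrite /h.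
  rewrite (_ : (fun j => F j x) = fun=> 0); last by apply/funext => j; exact: (test_eq0 (tF j)).
  exact: lim_cst.
- have : \forall x \ae mu, forall k, Omega x -> `|phi x - h x| <= k.+1%:R^-1.
    apply/ae_foralln => k; have k0 : 0 < k.+1%:R^-1 / 2 :> R by rewrite divr_gt0.
    have [N NP] := small _ k0; have [N' N'P] := close _ k0.
    apply: filterS (NP (maxn N N') (leq_maxl _ _)) => x hx Ox.
    rewrite -(subrKA (F (maxn N N') x)) (le_trans (ler_normD _ _))// (splitr (_^-1)).
    by rewrite lerD//; [rewrite distrC hx|rewrite N'P// leq_maxr].
  apply: filterS => x hx Ox; apply/eqP; rewrite -subr_eq0 -normr_le0.
  apply: (ler_cvg_to (cvg_cst _) (@cvg_harmonic_inv R)).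
  by apply: nearW => k; exact: hx.
Qed.

End representatives.

Section equivalence.
Context {R : realType} {n : nat}.
Local Notation V := 'rV[R]_n.
Local Notation mu := (@lebesgue_rV R n).
Implicit Types (u v w phi psi : V -> R) (D E Du Dphi : V -> V) (a x y z h : V) (H : 'I_n -> 'I_n -> R) (Omega O : set V).

Definition locally_lipschitz Omega v (K : R) := forall x, Omega x ->
  exists2 r : R, 0 < r & forall y z, `|x - y| < r -> `|x - z| < r ->
    `|v z - v y| <= K * enorm (z - y).

Lemma locally_lipschitz_continuous Omega v (K : R) : 0 <= K -> locally_lipschitz Omega v K ->
  forall x, Omega x -> {for x, continuous v}.
Proof.
move=> K0 vK x /vK[r r0 h]; apply: (@lipschitz_continuous_at _ _ _ (K * n%:R) r) => // y xy.
rewrite (le_trans (h y x xy _))// ?subrr ?normr0// -mulrA ler_wpM2l// enorm_le_norm//.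
Qed.

Lemma W1infty_lipschitz_representative Omega u Du : open Omega -> W1infty Omega u Du ->
  exists (v : V -> R) (D : V -> V) (C K : R), [/\ lbm v, lbmv D,
    (forall i x, `|D x 0 i| <= C), wgrad Omega v D &
    [/\ 0 <= K, forall x, enorm (D x) <= K, locally_lipschitz Omega v K &
    \forall x \ae mu, Omega x -> u x = v x /\ Du x = D x]].
Proof.
move=> oO /(W1infty_representative oO)[g [D [C [[mg gC] lD DC wD uE]]]].
have C0 : 0 <= C := le_trans (normr_ge0 _) (gC 0).
have DK x : enorm (D x) <= n%:R * C.
  by rewrite (le_trans (enorm_le_norm _))// ler_wpM2l//; apply/norm_leP.
have K0 : 0 <= n%:R * C by rewrite mulr_ge0.
have [v [mv vC _ vK gv]] := wgrad_continuous_representative oO mg gC lD wD K0 (aeW _ (fun x _ => DK x)).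
exists v, D, C, (n%:R * C); split => //; first by split=> // r; exists C.
  move=> zeta tz i; rewrite -(wD zeta tz i); have tp := test_partial tz i.
  have mp := (test_lbm tp).1.
  apply: RI_ae; [exact: measurable_funM|exact: measurable_funM|].
  apply: filterS gv => x h; have [Ox|Ox] := pselect (Omega x); first by rewrite h.
  by rewrite (test_eq0 tp Ox) !mulr0.
by split=> //; apply: filterS2 uE gv => x h1 h2 Ox; have [-> ->] := h1 Ox; rewrite h2.
Qed.

Lemma eq_viscosity Omega v w : open Omega -> (forall x, Omega x -> {for x, continuous w}) ->
  (forall x, Omega x -> v x = w x) -> viscosity_solution Omega v -> viscosity_solution Omega w.
Proof.
move=> oO cw vw [_ sub sup]; split=> // psi Cpsi x Ox near_x.
  apply: (sub psi Cpsi x Ox); have : \forall y \near x, Omega y by exact: open_nbhs_nbhs.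
  by apply: filterS2 near_x => y h Oy; rewrite !vw.
apply: (sup psi Cpsi x Ox); have : \forall y \near x, Omega y by exact: open_nbhs_nbhs.
by apply: filterS2 near_x => y h Oy; rewrite !vw.
Qed.

(** Continuous functions that agree almost everywhere in an open set agree there, so the existential
    in [infty_harmonic] can only be met by [v]. *)
Lemma infty_harmonicE Omega u v : open Omega -> (forall x, Omega x -> {for x, continuous v}) ->
  (\forall x \ae mu, Omega x -> u x = v x) ->
  infty_harmonic Omega u <-> viscosity_solution Omega v.
Proof.
move=> oO cv uv; split=> [[w uw sw]|sv]; last by exists v.
apply: (eq_viscosity oO cv _ sw); apply: ae_eq_continuous => //; first by case: sw.
by apply: filterS2 uw uv => x h1 h2 Ox; rewrite -h1// h2.
Qed.

Lemma Ck2_taylor Omega psi x : open Omega -> Ck 2 Omega psi -> Omega x ->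
  forall e : R, 0 < e -> exists2 d : R, 0 < d & forall h, `|h| < d ->
    `|psi (x + h) - psi x - dotp (grad psi x) h - bilin (hessian psi x) h h / 2| <= e * `|h| ^+ 2.
Proof.
move=> oO [dpsi dp] Ox e e0; have [r r0 rO] := nbhs_norm_ball oO Ox.
apply: (taylor2 r0) => // [h hr|i]; last by have [dpi _] := dp i; exact: dpi.
by apply/dpsi/rO; rewrite opprD addNKr normrN; lra.
Qed.

(* By symmetry under (v, D, psi) |-> (-v, -D, -psi) one contact suffices. *)
Lemma peak_condition_contact Omega v D x a H (C K : R) : open Omega -> lbm v -> lbmv D ->
  (forall i x, `|D x 0 i| <= C) -> wgrad Omega v D -> 0 <= K -> locally_lipschitz Omega v K ->
  peak_condition Omega D -> Omega x ->
  (forall e : R, 0 < e -> exists2 d : R, 0 < d & forall h, `|h| < d ->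
     v (x + h) - v x <= dotp a h + bilin H h h / 2 + e * `|h| ^+ 2) ->
  0 <= bilin H a a.
Proof.
move=> oO lv lD DC wD K0 vK pD Ox vH; rewrite leNgt; apply/negP => Haa.
have [r1 r10 r1O] := nbhs_norm_ball oO Ox; have [r2 r20 r2v] := vK x Ox.
pose rho := Num.min r1 r2.
have rho0 : 0 < rho by rewrite lt_min r10.
have [p [y [r [p0 r0 rrho ry vcone]]]] := touching_cone Haa vH rho0.
apply: (@peak_condition_no_cone _ _ Omega v D x y p r rho (K * n%:R) C) => //.
- move=> z xz; apply: r1O; apply: (le_lt_trans xz).
  by rewrite (@le_lt_trans _ _ r1) ?ge_min ?lexx// ltr_pMl// ltr1n.
- by rewrite mulr_ge0.
- move=> z z1 xz xw; rewrite -mulrA (@le_trans _ _ (K * enorm (z - z1)))//.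
    by apply: r2v; [apply: (lt_le_trans xw)|apply: (lt_le_trans xz)]; rewrite ge_min lexx orbT.
  by rewrite ler_wpM2l// enorm_le_norm.
Qed.

Lemma peak_condition_viscosity Omega v D (C K : R) : open Omega -> lbm v -> lbmv D ->
  (forall i x, `|D x 0 i| <= C) -> wgrad Omega v D -> 0 <= K -> locally_lipschitz Omega v K ->
  peak_condition Omega D -> viscosity_solution Omega v.
Proof.
move=> oO lv lD DC wD K0 vK pD; split; first exact: locally_lipschitz_continuous vK.
  move=> psi Cpsi x Ox vx; rewrite infty_laplacianE.
  apply: (peak_condition_contact oO lv lD DC wD K0 vK pD Ox) => e e0.
  have [d1 d10 d1P] := Ck2_taylor oO Cpsi Ox e0.
  have /nbhs_ballP[d2 /= d20 d2P] := vx.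
  exists (Num.min d1 d2); first by rewrite lt_min d10.
  move=> h; rewrite lt_min => /andP[/d1P h1 h2].
  have := d2P (x + h); rewrite -ball_normE /= opprD addNKr normrN => /(_ h2).
  by move: h1; rewrite ler_norml => /andP[_]; lra.
move=> psi Cpsi x Ox vx; rewrite infty_laplacianE.
have lN : locally_lipschitz Omega (fun x => - v x) K.
  move=> y /vK[r r0 rv]; exists r => // z z1 xz xw.
  by rewrite -opprD normrN; exact: rv.
have DNC i y : `|(- D y) 0 i| <= C by rewrite mxE normrN.
have := @peak_condition_contact Omega (fun x => - v x) (fun x => - D x) x (- grad psi x)
  (fun i j => - hessian psi x i j) C K oO (lbmN lv) (lbmvN lD) DNC (wgradN lv lD wD) K0 lN
  (peak_conditionN pD) Ox.
have bN a b : bilin (fun i j => - hessian psi x i j) a b = - bilin (hessian psi x) a b.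
  rewrite /bilin -sumrN; apply: eq_bigr => j _; rewrite -sumrN; apply: eq_bigr => i _.
  by rewrite mulrN.
have -> : bilin (fun i j => - hessian psi x i j) (- grad psi x) (- grad psi x) =
    - bilin (hessian psi x) (grad psi x) (grad psi x).
  by rewrite bN -(scaleN1r (grad psi x)) bilinZl bilinZr !mulN1r opprK.
rewrite oppr_ge0; apply => e e0.
have [d1 d10 d1P] := Ck2_taylor oO Cpsi Ox e0.
have /nbhs_ballP[d2 /= d20 d2P] := vx.
exists (Num.min d1 d2); first by rewrite lt_min d10.
move=> h; rewrite lt_min => /andP[/d1P h1 h2]; rewrite bN dotpNl.
have := d2P (x + h); rewrite -ball_normE /= opprD addNKr normrN => /(_ h2).
by move: h1; rewrite ler_norml => /andP[+ _]; lra.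
Qed.

Lemma viscosity_cone_comparable Omega v : viscosity_solution Omega v ->
  cone_comparable Omega v /\ cone_comparable Omega (fun x => - v x).
Proof.
move=> sv; have [cv _ _] := sv; have [s1 s2] := viscosity_radial_subsolution sv.
split=> y r S r0 S0 ballO vS; first exact: cone_comparison s1 cv r0 S0 ballO vS.
apply: (cone_comparison s2) => // x Ox; apply: continuousN; exact: cv.
Qed.

(** Turns failure of the inequality into a uniform gap [c]. When the essential supremum is -oo, as
    on a null set, any gap works and 1 is taken. *)
Lemma ess_sup_on_lt0P (A : set V) (f : V -> R) :
  (ess_sup_on A (fun x => (f x)%:E) < 0)%E <->
  exists2 c : R, 0 < c & \forall x \ae mu, A x -> f x <= - c.
Proof.
rewrite /ess_sup_on; split=> [|[c c0 fc]].
  have := ess_sup_ge mu (patch (cst -oo%E) A (fun x => (f x)%:E)).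
  case: ess_sup => [r||] // h r0.
    exists (- r); first by rewrite oppr_gt0 -lte_fin.
    by rewrite opprK; apply: filterS h => x + Ax; rewrite patchT ?inE.
  exists 1 => //; apply: filterS h => x + Ax; rewrite patchT ?inE//.
apply: (@le_lt_trans _ _ (- c)%:E); last by rewrite lte_fin oppr_lt0.
apply/ess_supP; apply: filterS fc => x h; rewrite /patch; case: ifPn => [|_]; last exact: leNye.
by rewrite inE lee_fin => /h.
Qed.

Definition sup_condition Omega Du := forall phi Dphi (eps : R),
  W1infty0 Omega phi Dphi -> ~ (phi = cst 0 %[ae mu in Omega]) -> 0 < eps ->
  let S := Omega `&` [set x | phi x != 0] in
  let M := Linfty_norm S (enorm \o Du) in
  (0 <= ess_sup_on ([set x | M - eps%:E <= (enorm (Du x))%:E] `&` S)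
          (fun x => (dotp (Du x) (Dphi x))%:E))%E.

Lemma Linfty_norm_finite (A : set V) D (K : R) : 0 <= K ->
  (\forall x \ae mu, A x -> enorm (D x) <= K) ->
  exists m : R, [/\ Linfty_norm A (enorm \o D) = m%:E, 0 <= m,
    \forall x \ae mu, A x -> enorm (D x) <= m &
    forall c : R, 0 <= c -> (\forall x \ae mu, A x -> enorm (D x) <= c) -> m <= c].
Proof.
have le c : 0 <= c -> (\forall x \ae mu, A x -> enorm (D x) <= c) ->
    (Linfty_norm A (enorm \o D) <= c%:E)%E.
  move=> c0 Dc; apply: Linfty_norm_le => //.
  by apply: filterS Dc => x h Ax; rewrite /= ger0_norm ?enorm_ge0// h.
move=> K0 /(le _ K0) MK; have M0 := Linfty_norm_ge0 A (enorm \o D).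
have Mae := Linfty_norm_ae A (enorm \o D).
move: MK M0 Mae le; case: (Linfty_norm _ _) => // m _ m0 Mae le; exists m; split => //.
by apply: filterS Mae => x h Ax; have := h Ax; rewrite lee_fin /= ger0_norm ?enorm_ge0.
Qed.

Lemma sup_condition_peak Omega Du D (K : R) : open Omega -> 0 <= K ->
  (forall x, enorm (D x) <= K) -> (\forall x \ae mu, Omega x -> Du x = D x) ->
  sup_condition Omega Du -> peak_condition Omega D.
Proof.
move=> oO K0 DK DuD sup phi D' L C rho rho' p x0 L0 philip lD' D'C wD' rr ballO supp p0 np.
have OO x : phi x != 0 -> Omega x by move=> /supp h; apply: ballO; exact: le_trans (ltW rr).
pose S := Omega `&` [set x | phi x != 0].
have DuK : \forall x \ae mu, S x -> enorm (Du x) <= K.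
  by apply: filterS DuD => x h [/h -> _].
have [m [ME m0 Dum mle]] := Linfty_norm_finite K0 DuK.
have pm : p < m.
  rewrite ltNge; apply/negP => mp; apply: np.
  apply: filterS2 Dum DuD => x h1 h2 px; have Ox := OO x px.
  by rewrite -h2// (le_trans (h1 _)).
have phib : bounded_support phi.
  by exists (rho + `|x0|) => x /supp h; rewrite -[x](subrK x0) (le_trans (ler_normD _ _))// distrC lerD.
have W := W1infty0_wgrad philip phib L0 lD' D'C rr ballO supp oO wD'.
(* Half of the distance from [p] to the essential supremum [m], so that the threshold [m - eps]
   still exceeds [p]. *)
have eps0 : 0 < (m - p) / 2 by rewrite divr_gt0// subr_gt0.
exists (m - (m - p) / 2); first lra.
move=> eta eta0 Deta.
have np0 : ~ (phi = cst 0 %[ae mu in Omega]).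
  apply: contra_not np; apply: filterS => x h px; move: (px).
  by rewrite h ?eqxx//; exact: OO.
have := sup phi D' _ W np0 eps0; rewrite /= -/S ME leNgt => /negP; apply.
apply/ess_sup_on_lt0P; exists eta => //.
apply: filterS2 Deta DuD => x h1 h2 [/= + [Ox px]].
by rewrite -EFinB lee_fin h2//; exact: h1.
Qed.

Lemma cone_comparable_sup_condition Omega v D Du (C K : R) : open Omega -> lbm v -> lbmv D ->
  (forall i x, `|D x 0 i| <= C) -> wgrad Omega v D -> 0 <= K ->
  (forall x, enorm (D x) <= K) -> (\forall x \ae mu, Omega x -> Du x = D x) ->
  (forall x, Omega x -> {for x, continuous v}) ->
  cone_comparable Omega v -> cone_comparable Omega (fun x => - v x) ->
  sup_condition Omega Du.
Proof.
move=> oO lv lD DC wD K0 DK DuD cv ccv ccvN phi Dphi eps W phin0 eps0 /=.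
set S := Omega `&` _; set M := Linfty_norm S _.
rewrite leNgt; apply/negP => /ess_sup_on_lt0P[c c0 Dc].
have DuK : \forall x \ae mu, S x -> enorm (Du x) <= K.
  by apply: filterS DuD => x h [/h -> _].
have [m [ME m0 Dum mle]] := Linfty_norm_finite K0 DuK.
(* Two representatives of [phi] are combined: [h] is uniformly continuous, and [g] carries the
   bounded weak gradient [E]. They agree almost everywhere, so [E] is also a weak gradient of
   [h]. *)
have [h [B [hB hu hO phih]]] := W1infty0_representative oO W.
have [g [E [CE [[mg gC] lE EC wE gE]]]] := W1infty_representative oO W.1.
have ch := enorm_uniform_continuous hu.
have lh : lbm h by exact: lbm_continuous.
pose O := [set x | h x != 0].
have OO : O `<=` Omega by move=> x; exact: hO.
have oO' : open O.
  have -> : O = ~` (h @^-1` [set 0]) by apply/seteqP; split=> x /= /eqP.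
  by apply: closed_openC; have /continuous_closedP H := ch; apply: H; exact: closed_eq.
have wh : wgrad O h E.
  apply: (wgrad_sub OO) => zeta tz i; rewrite -(wE zeta tz i); have tp := test_partial tz i.
  have mp := (test_lbm tp).1.
  apply: RI_ae; [by apply: measurable_funM => //; exact: lh.1|exact: measurable_funM|].
  apply: filterS2 phih gE => x h1 h2; have [Ox|Ox] := pselect (Omega x).
    by rewrite -h1// (h2 Ox).1.
  by rewrite (test_eq0 tp Ox) !mulr0.
have OS : \forall x \ae mu, O x -> [/\ S x, Du x = D x & Dphi x = E x].
  apply: filterS3 phih gE DuD => x h1 h2 h3 Ox; have Omx := OO x Ox.
  by split; [split=> //=; rewrite h1|exact: h3|exact: (h2 Omx).2].
have SO : \forall x \ae mu, S x -> O x.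
  by apply: filterS phih => x h1 [Omx px]; rewrite /O /= -h1.
have Dm : \forall x \ae mu, O x -> enorm (D x) <= m.
  by apply: filterS2 OS Dum => x h1 h2 /h1[Sx <- _]; exact: h2.
have key : \forall x \ae mu, O x -> m - eps <= enorm (D x) -> dotp (D x) (E x) <= - c.
  apply: filterS2 OS Dc => x h1 h2 /h1[Sx <- <-] me; apply: h2; split => //=.
  by rewrite /M ME -EFinB lee_fin.
(* For m = 0 no nonnegative [L] lies below [m]. But then [D] vanishes almost everywhere on [O], its
   product with [E] is 0 rather than at most [- c], and so [O] is null and [phi] trivial. *)
have [m_0|m_gt0] : m = 0 \/ 0 < m by move: m0; rewrite le_eqVlt => /predU1P[<-|]; [left|right].
  apply: phin0; apply: filterS3 key Dm phih => x h1 h2 h3 Omx; rewrite h3//.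
  apply/eqP; apply/negP => /negP Ox; have := h2 Ox; rewrite m_0 => D0.
  have {}D0 : enorm (D x) = 0 by apply/le_anti; rewrite D0 enorm_ge0.
  have := h1 Ox; rewrite D0 m_0 sub0r oppr_le0 => /(_ (ltW eps0)).
  have /eqP := D0; rewrite enorm_eq0 => /eqP ->; rewrite dotp0l; lra.
have CE0 : 0 <= CE := le_trans (normr_ge0 _) (gC 0).
pose e := n%:R * CE; have e0 : 0 <= e by rewrite mulr_ge0.
have Ee x : enorm (E x) <= e.
  by rewrite (le_trans (enorm_le_norm _))// ler_wpM2l//; apply/norm_leP.
(* The first bound gives [t * e <= eps / 2], the second [t * e ^+ 2 <= c]; adding 1 avoids dividing
   by 0. *)
pose t := Num.min (eps / (2 * (e + 1))) (c / (e ^+ 2 + 1)).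
have e1 : 0 < e + 1 by rewrite ltr_wpDl.
have e2 : 0 < e ^+ 2 + 1 by rewrite ltr_wpDl// sqr_ge0.
have t0 : 0 < t by rewrite lt_min !divr_gt0// mulr_gt0.
have te : t * e <= eps / 2.
  have : t <= eps / (2 * (e + 1)) by rewrite ge_min lexx.
  by rewrite ler_pdivlMr ?mulr_gt0//; lra.
have tc : t * e ^+ 2 <= c.
  have : t <= c / (e ^+ 2 + 1) by rewrite ge_min lexx orbT.
  by rewrite ler_pdivlMr//; lra.
clearbody t.
(* The first term bounds |D + t E| where |D| >= m - eps, the second elsewhere; 0 makes [L]
   nonnegative. Each of the three is below [m]. *)
pose L := Num.max (Num.sqrt (m ^+ 2 - t * c)) (Num.max (m - eps / 2) 0).
have L0 : 0 <= L by rewrite !le_max lexx !orbT.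
have Lm : L < m.
  rewrite !gt_max m_gt0 andbT; apply/andP; split; last by lra.
  rewrite -[ltRHS](ger0_norm m0) -sqrtr_sqr ltr_sqrt ?exprn_gt0//.
  by rewrite gtrBl mulr_gt0.
pose h' x := t * h x; pose E' x := t *: E x.
have OE : [set x | h' x != 0] = O.
  by apply/seteqP; split=> x; rewrite /h' /O /= mulf_eq0 (gt_eqF t0).
have DEL : \forall x \ae mu, O x -> enorm (D x + E' x) <= L.
  apply: filterS2 key Dm => x h1 h2 Ox; have {}h1 := h1 Ox; have {}h2 := h2 Ox.
  have tE : t * enorm (E x) <= t * e by rewrite ler_wpM2l// ltW.
  have [mD|mD] := leP (m - eps) (enorm (D x)); last first.
    rewrite (le_trans (enormD _ _))// /E' enormZ gtr0_norm// !le_max; apply/orP; right.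
    by apply/orP; left; lra.
  rewrite le_max; apply/orP; left; rewrite ler_wsqrtr//.
  rewrite dotpDl !dotpDr !dotpZl !dotpZr [dotp (E x) _]dotpC -!sqr_enorm.
  have h3 : enorm (D x) ^+ 2 <= m ^+ 2 by rewrite lerXn2r ?nnegrE ?enorm_ge0.
  have h4 : t * (t * enorm (E x) ^+ 2) <= t * c.
    rewrite ler_wpM2l ?(ltW t0)// (le_trans _ tc)// ler_wpM2l ?(ltW t0)//.
    by rewrite lerXn2r ?nnegrE ?enorm_ge0.
  have h5 : t * dotp (D x) (E x) <= t * - c by rewrite ler_wpM2l ?(ltW t0)// h1.
  lra.
(* Any slope strictly between [L] and [m] would do: a bound of |D| by it contradicts that [m] is the
   least essential bound. *)
have LK : L < (L + m) / 2 by lra.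
have lh' : lbm h' by exact: lbmZ.
have lE' : lbmv E' by move=> i; rewrite /E'; under eq_fun do rewrite mxE; exact: lbmZ.
have h'B x : `|h' x| <= t * B by rewrite normrM gtr0_norm// ler_wpM2l// ltW.
have h'u (a : R) : 0 < a -> exists2 d : R, 0 < d &
    forall x y, enorm (x - y) <= d -> `|h' x - h' y| < a.
  move=> a0; have [|d d0 hd] := hu (a / t); first by rewrite divr_gt0.
  exists d => // x y /hd; rewrite ltr_pdivlMr// /h' -mulrBr normrM gtr0_norm//.
  by rewrite mulrC.
have := perturbed_gradient lD DC L0 LK lv wD cv ccv ccvN lh' lE' h'B h'u.
rewrite OE => /(_ OO (wgradZ t lh lE wh) DEL) DLm.
have : m <= (L + m) / 2.
  apply: mle; first by rewrite divr_ge0// addr_ge0.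
  by apply: filterS3 DLm OS SO => x h1 h2 h3 /h3 Ox; have [_ -> _] := h2 Ox; exact: h1.
lra.
Qed.

End equivalence.

Theorem corollary8 (R : realType) (n : nat) (Omega : set 'rV[R]_n)
    (u : 'rV[R]_n -> R) (Du : 'rV[R]_n -> 'rV[R]_n) :
  open Omega -> W1infty Omega u Du ->
  infty_harmonic Omega u <->
  (forall (phi : 'rV[R]_n -> R) (Dphi : 'rV[R]_n -> 'rV[R]_n) (eps : R),
     W1infty0 Omega phi Dphi ->
     ~ (phi = cst 0 %[ae lebesgue_rV n in Omega]) ->
     0 < eps ->
     let S := Omega `&` [set x | phi x != 0] in
     let M := Linfty_norm S (enorm \o Du) in
     (0 <= ess_sup_on ([set x | M - eps%:E <= (enorm (Du x))%:E] `&` S)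
             (fun x => (dotp (Du x) (Dphi x))%:E))%E).
Proof.
move=> oO /(W1infty_lipschitz_representative oO)[v [D [C [K [lv lD DC wD [K0 DK vK uv]]]]]].
have cv := locally_lipschitz_continuous K0 vK.
have DuD : \forall x \ae lebesgue_rV n, Omega x -> Du x = D x.
  by apply: filterS uv => x h /h[].
have uE : \forall x \ae lebesgue_rV n, Omega x -> u x = v x.
  by apply: filterS uv => x h /h[].
(* Both sides now speak of the locally Lipschitz [v] and the bounded [D]: the equation because the
   continuous representative is unique, the inequality because [Du] equals [D] almost everywhere in
   [Omega]. *)
apply: (iff_trans (infty_harmonicE oO cv uE)); split.
  by move=> /viscosity_cone_comparable[ccv ccvN];
    exact: (cone_comparable_sup_condition oO lv lD DC wD K0 DK DuD cv ccv ccvN).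
move=> sup; apply: (peak_condition_viscosity oO lv lD DC wD K0 vK).
exact: (sup_condition_peak oO K0 DK DuD sup).
Qed.
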